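(* Let $\omega$ be a subadditive weight function and let $L=\frac{\partial}{\partial t}+\sum_{j=1}^{N}(a_j+ib_j)(t)\frac{\partial}{\partial x_j}$ on $\mathbb{T}^{N+1}$, with $a_j,b_j$ real-valued functions in $\mathcal{E}_{\{\omega\}}(\mathbb{T}^1)$. The following are equivalent: \begin{itemize} \item $L$ is strongly $\{\omega\}$-solvable; \item $L$ is globally $\{\omega\}$-hypoelliptic; \item (1) the functions $b_j$ do not change sign; (2) $\dim\mathrm{span}\{b_1,\dots,b_N\}\le1$; (3) the pair $(\alpha_0,\beta_0)$ satisfies $(EDC)_1^{\{\omega\}}$. \end{itemize}
   Context: $\mathbb{T}^n=(\mathbb{R}/2\pi\mathbb{Z})^n$; coordinates on $\mathbb{T}^{N+1}$ are $(t,x)$. A weight function is an increasing continuous $\omega:[0,\infty)\to[0,\infty)$ such that: there is $K\ge0$ with $\omega(2t)\le K(\omega(t)+1)$; $\omega(t)=O(t)$; $\log t=o(\omega(t))$ as $t\to\infty$; $\varphi(t)=\omega(e^t)$ convex (one may assume $\omega=0$ on $[0,1]$). Subadditive: $\omega(s+t)\le\omega(s)+\omega(t)$. $\varphi^*(t)=\sup_{s\ge0}\{st-\varphi(s)\}$. $\|f\|_\lambda=\sup_{x}\sup_{\alpha}|\partial^\alpha f(x)|\exp(-\lambda\varphi^*(|\alpha|/\lambda))$; $\mathcal{E}_{\{\omega\}}(\mathbb{T}^n)=\{f\in C^\infty(\mathbb{T}^n):\|f\|_\lambda<\infty$ for some $\lambda>0\}$ with the inductive limit topology of the Banach spaces $\{f:\|f\|_{1/k}<\infty\}$,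 $k\in\mathbb{N}$; $\mathcal{E}'_{\{\omega\}}$ is its strong dual. ${}^tL$ denotes the transpose of $L$ acting on $\mathcal{E}'_{\{\omega\}}(\mathbb{T}^{N+1})$ (${}^tL=-L$). $L$ is strongly $\{\omega\}$-solvable if $L\mathcal{E}_{\{\omega\}}(\mathbb{T}^{N+1})$ is closed in $\mathcal{E}_{\{\omega\}}(\mathbb{T}^{N+1})$ and $\ker{}^tL\subset\mathcal{E}'_{\{\omega\}}(\mathbb{T}^{N+1})$ is finite dimensional. $L$ is globally $\{\omega\}$-hypoelliptic if $\mu\in\mathcal{E}'_{\{\omega\}}(\mathbb{T}^{N+1})$ and $L\mu\in\mathcal{E}_{\{\omega\}}(\mathbb{T}^{N+1})$ imply $\mu\in\mathcal{E}_{\{\omega\}}(\mathbb{T}^{N+1})$. $\alpha_0=(a_{10},\dots,a_{N0})$, $\beta_0=(b_{10},\dots,b_{N0})$ with $a_{j0},b_{j0}$ the means of $a_j,b_j$ over $[0,2\pi]$. $(\alpha,\beta)\in\mathbb{R}^N\times\mathbb{R}^N$ satisfies $(EDC)_1^{\{\omega\}}$ if for every $\epsilon>0$ there is $C_\epsilon>0$ with $|\tau+\langle\xi,\alpha+i\beta\rangle|\ge C_\epsilon e^{-\epsilon\omega(|(\tau,\xi)|)}$ for all $(\tau,\xi)\in\mathbb{Z}^{N+1}\setminus\{0\}$. A real function changes sign if it takes both strictly positive and strictly negative values. *)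

(* Defs.v *)
From mathcomp Require Import all_boot all_order all_algebra.
From mathcomp Require Import all_classical all_reals all_analysis.
From mathcomp Require Import complex.
Set Implicit Arguments.
Unset Strict Implicit.
Unset Printing Implicit Defensive.
Import Order.TTheory GRing.Theory Num.Theory.
Import numFieldNormedType.Exports.
Local Open Scope ring_scope.
Local Open Scope classical_set_scope.

Section Defs.
Variable R : realType.

Definition wphi (om : R -> R) (t : R) : R := om (expR t).

(* omega is a weight function (as in the paper); omega is only relevant
   on [0, +oo). *)
Definition weight_function (om : R -> R) : Prop :=
      (forall s t, 0 <= s -> s <= t -> om s <= om t) /\
      (forall t, 0 <= t -> 0 <= om t) /\
      {within `[0, +oo[, continuous om} /\
      (exists K, 0 <= K /\ forall t, 0 <= t -> om (2 * t) <= K * (om t + 1)) /\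
      (exists C, exists T, forall t, T <= t -> om t <= C * t) /\
      (forall eps, 0 < eps -> exists T, forall t, T <= t -> ln t <= eps * om t) /\
      (forall s t l, 0 <= l -> l <= 1 ->
         wphi om (l * s + (1 - l) * t) <= l * wphi om s + (1 - l) * wphi om t).

Definition om_subadditive (om : R -> R) : Prop :=
  forall s t, 0 <= s -> 0 <= t -> om (s + t) <= om s + om t.

Definition phistar (om : R -> R) (t : R) : R :=
  sup [set s * t - wphi om s | s in [set s : R | 0 <= s]].

(* Complex-valued functions on the torus T^n = (R / 2piZ)^n, seen as    *)
(* functions on R^n = 'rV[R]_n that are 2pi-periodicT in each variable.  *)

Definition cabs (z : R[i]) : R :=
  Num.sqrt (complex.Re z ^+ 2 + complex.Im z ^+ 2).

Definition reF n (f : 'rV[R]_n -> R[i]) : 'rV[R]_n -> R :=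
  fun x => complex.Re (f x).
Definition imF n (f : 'rV[R]_n -> R[i]) : 'rV[R]_n -> R :=
  fun x => complex.Im (f x).

Definition pd n (i : 'I_n) (f : 'rV[R]_n -> R[i]) : 'rV[R]_n -> R[i] :=
  fun x => (('D_('e_i) (reF f) x) +i* ('D_('e_i) (imF f) x))%C.

(* iterated partial derivative d_{i_1} ... d_{i_k} f for s = [:: i_1; ..; i_k];
   since f will be C^oo, this is d^alpha f where alpha counts the
   occurrences of each index, and |alpha| = size s. *)
Definition dseq n (s : seq 'I_n) (f : 'rV[R]_n -> R[i]) : 'rV[R]_n -> R[i] :=
  foldr (@pd n) f s.

Definition smoothT n (f : 'rV[R]_n -> R[i]) : Prop :=
  forall s : seq 'I_n,
    continuous (reF (dseq s f)) /\ continuous (imF (dseq s f)) /\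
    forall (i : 'I_n) x,
      derivable (reF (dseq s f)) x 'e_i /\ derivable (imF (dseq s f)) x 'e_i.

Definition periodicT n (f : 'rV[R]_n -> R[i]) : Prop :=
  forall (i : 'I_n) x, f (x + (2 * pi) *: 'e_i) = f x.

(* ||f||_lam <= C, where
   ||f||_lam = sup_x sup_alpha |d^alpha f(x)| exp(-lam phi^*(|alpha|/lam)) *)
Definition normle (om : R -> R) n (lam : R) (f : 'rV[R]_n -> R[i]) (C : R) :=
  forall (x : 'rV[R]_n) (s : seq 'I_n),
    cabs (dseq s f x) * expR (- (lam * phistar om ((size s)%:R / lam))) <= C.

Definition inEom (om : R -> R) n (f : 'rV[R]_n -> R[i]) : Prop :=
  smoothT f /\ periodicT f /\ exists lam, 0 < lam /\ exists C, normle om lam f C.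

(* 0-neighbourhoods of the locally convex inductive limit topology of the
   Banach spaces E_k = {f : ||f||_{1/k} < oo}, k >= 1 : absolutely convex
   sets whose trace on every E_k contains a ball of E_k. *)
Definition ind_nbhd0 (om : R -> R) n (U : set ('rV[R]_n -> R[i])) : Prop :=
  (forall f g (a b : R[i]), U f -> U g -> cabs a + cabs b <= 1 ->
      U (fun x => a * f x + b * g x)) /\
  (forall k : nat, exists eps : R, 0 < eps /\
      forall f, smoothT f -> periodicT f ->
        normle om (k.+1%:R)^-1 f eps -> U f).

Definition closedE (om : R -> R) n (A : set ('rV[R]_n -> R[i])) : Prop :=
  forall g, inEom om g -> ~ A g ->
    exists U, ind_nbhd0 om U /\
      forall h, inEom om h -> U h -> ~ A (fun x => g x + h x).

(* mu in E'_{omega}(T^n): linear functionals on E_{omega}(T^n) (only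
   their values on E_{omega}(T^n) matter) that are continuous for the
   inductive limit topology, i.e. continuous on every step E_k. *)
Definition inEdualom (om : R -> R) n (mu : ('rV[R]_n -> R[i]) -> R[i]) : Prop :=
  (forall f g (a b : R[i]), inEom om f -> inEom om g ->
      mu (fun x => a * f x + b * g x) = a * mu f + b * mu g) /\
  (forall k : nat, exists C : R, 0 <= C /\
      forall f D, smoothT f -> periodicT f -> normle om (k.+1%:R)^-1 f D ->
        cabs (mu f) <= C * D).

Fixpoint tint (n : nat) : ('rV[R]_n -> R) -> R :=
  match n return ('rV[R]_n -> R) -> R with
  | 0 => fun F => F 0
  | m.+1 => fun F =>
      Rintegral (@lebesgue_measure R) `[0, 2 * pi]
        (fun t => tint (fun y : 'rV[R]_m =>
                          F (row_mx (const_mx t : 'rV[R]_1) y)))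
  end.

Definition cint n (F : 'rV[R]_n -> R[i]) : R[i] :=
  (tint (reF F) +i* tint (imF F))%C.

Definition fun_as_dist n (g : 'rV[R]_n -> R[i]) : ('rV[R]_n -> R[i]) -> R[i] :=
  fun f => cint (fun x => g x * f x).

(* coordinate 0 is t, coordinate lift ord0 j is x_{j+1}.               *)

Definition Lop N (a b : 'I_N -> R -> R) (f : 'rV[R]_N.+1 -> R[i])
  : 'rV[R]_N.+1 -> R[i] :=
  fun x => pd ord0 f x +
           \sum_(j < N) ((a j (x ord0 ord0)) +i* (b j (x ord0 ord0)))%C
                        * pd (lift ord0 j) f x.

Definition inE1_realom (om : R -> R) (f : R -> R) : Prop :=
  inEom om (fun x : 'rV[R]_1 => ((f (x ord0 ord0)) +i* 0)%C).

Definition strongly_solvable (om : R -> R) N (a b : 'I_N -> R -> R) : Prop :=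
  closedE om (fun g => exists f, inEom om f /\ g = Lop a b f) /\
  (* ker tL = {mu in E' : <mu, L f> = 0 for all f in E} is finite dimensional *)
  exists (m : nat) (v : 'I_m -> ('rV[R]_N.+1 -> R[i]) -> R[i]),
    forall mu, inEdualom om mu ->
      (forall f, inEom om f -> mu (Lop a b f) = 0) ->
      exists c : 'I_m -> R[i],
        forall f, inEom om f -> mu f = \sum_(l < m) c l * v l f.

(* L is globally {omega}-hypoelliptic; L mu is defined by
   <L mu, f> = <mu, tL f> = - <mu, L f>. *)
Definition globally_hypoelliptic (om : R -> R) N (a b : 'I_N -> R -> R)
  : Prop :=
  forall mu, inEdualom om mu ->
    (exists g, inEom om g /\
       forall f, inEom om f -> - mu (Lop a b f) = fun_as_dist g f) ->
    exists h, inEom om h /\ forall f, inEom om f -> mu f = fun_as_dist h f.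

Definition mean2pi (f : R -> R) : R :=
  (2 * pi)^-1 * Rintegral (@lebesgue_measure R) `[0, 2 * pi] f.

Definition EDC1 (om : R -> R) N (al be : 'I_N -> R) : Prop :=
  forall eps : R, 0 < eps -> exists C : R, 0 < C /\
    forall (tau : int) (xi : 'I_N -> int),
      (tau != 0 \/ exists j, xi j != 0) ->
      C * expR (- (eps * om (Num.sqrt (tau%:~R ^+ 2
                                   + \sum_(j < N) (xi j)%:~R ^+ 2))))
      <= cabs ((tau%:~R + \sum_(j < N) (xi j)%:~R * al j) +i*
               (\sum_(j < N) (xi j)%:~R * be j))%C.

Definition changes_sign (f : R -> R) : Prop :=
  (exists t, 0 < f t) /\ (exists t, f t < 0).

Definition span_dim_le1 N (b : 'I_N -> R -> R) : Prop :=
  exists g : R -> R, forall j, exists c : R, forall t, b j t = c * g t.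

End Defs.

(* Main.v *)
(* In the Fourier variables, L acts separately on each fibre {(tau, xi) : tau in Z}, where Lu = f is
   the equation u' + i<xi, a + ib>u = f on the circle. Classes are read on coefficients: E consists of
   the coefficients bounded by exp (- d omega) for some d > 0, E' of those bounded by
   C_e exp (e omega) for every e > 0. In the tau direction decay is automatic: if the right-hand side
   decays, then |u(tau)| is controlled by its values for |tau| <= m (|xi| + 1), because there i tau
   dominates the convolution with the Fourier coefficients of a + ib.

   Solvable implies hypoelliptic: if mu is a distribution with L mu = g in E, truncating mu to finitely
   many fibres shows that g lies in the closure of the range, hence g = L f with f in E; then mu - f is
   in the kernel of L, and as each of its fibres is again in the kernel, finite dimension leaves only
   finitely many nonzero fibres, each of which decays.

   Hypoelliptic implies the three conditions: a violation of (EDC) provides infinitely many fibres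
   carrying normalised almost-solutions. If <xi, b> has nonpositive mean but takes positive values, the
   solution on the fibre k xi for a right-hand side of size exp (- k M), with M the largest increase of
   a primitive of <xi, b> over a period, is bounded but not smaller than c / k, its phase being chosen to
   prevent cancellation. In both cases the sum over the fibres is a distribution outside E whose image
   under L is in E. Hence <xi, mean b> <= 0 implies <xi, b(t)> <= 0 for all integer xi, so the vector
   b(t) is a nonnegative multiple of its mean.

   Conversely, if the <xi, b> have constant signs, the explicit periodic solution on each fibre is
   bounded by the supremum of f divided by |1 - exp (- 2 pi i <xi, mean (a + ib)>)|, which (EDC) bounds
   from below; so the range of L is the set of functions with zero mean. *)

Require Import Defs.
From mathcomp Require Import all_boot all_order all_algebra.
From mathcomp Require Import all_classical all_reals all_analysis.
From mathcomp Require Import complex ring lra zify.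
Set Implicit Arguments.
Unset Strict Implicit.
Unset Printing Implicit Defensive.
Import Order.TTheory GRing.Theory Num.Theory.
Import numFieldNormedType.Exports.
Local Open Scope ring_scope.
Local Open Scope classical_set_scope.

(** * Complex-valued sums and derivatives *)

(** Subadditivity of [om] enters in two ways. It makes [exp (d omega)] submultiplicative, so that
    convolution with the Fourier coefficients of [a + ib] respects decay up to their own rate. It
    also gives [omega (k |xi|) <= k omega (|xi|)], so that data of size [exp (- k M)] on the fibres
    [k xi] lie in E for every [M > 0], whereas size [c / k] is never fast decay because
    [log t = o (omega t)]. The obstacle to decay in tau is that the coefficients of a distribution
    may grow: the weighted supremum to be absorbed is a priori infinite. Weights that follow
    [exp (d omega)] up to one chosen frequency and then turn down make it finite, with bounds
    independent of that frequency. Each use of the tau estimate costs a factor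
    [exp (d m omega (|xi|))]. Since [d] may be chosen after [m], the loss stays below any decay in
    xi known beforehand; hence the many minima of rates. The explicit solution is formed before
    dividing by 1 minus the monodromy, so that one formula serves the lower bound in the necessity
    part and the solution operator in the sufficiency part. *)

Section ComplexModulus.
Variable R : realType.
Implicit Types (x y z : R[i]) (r : R).
Local Notation Re := (@complex.Re R).
Local Notation Im := (@complex.Im R).

Lemma cReD x y : Re (x + y) = Re x + Re y. Proof. by case: x; case: y. Qed.
Lemma cImD x y : Im (x + y) = Im x + Im y. Proof. by case: x; case: y. Qed.
Lemma cReN x : Re (- x) = - Re x. Proof. by case: x. Qed.
Lemma cImN x : Im (- x) = - Im x. Proof. by case: x. Qed.
Lemma cReM x y : Re (x * y) = Re x * Re y - Im x * Im y.
Proof. by case: x; case: y. Qed.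
Lemma cImM x y : Im (x * y) = Re x * Im y + Im x * Re y.
Proof. by case: x => a b; case: y. Qed.

Definition ReImE := (cReD, cImD, cReN, cImN, cReM, cImM).

Lemma Re_sum (I : Type) (s : seq I) (F : I -> R[i]) :
  Re (\sum_(i <- s) F i) = \sum_(i <- s) Re (F i).
Proof. by elim: s => [|i s IH]; rewrite ?big_nil// !big_cons cReD IH. Qed.
Lemma Im_sum (I : Type) (s : seq I) (F : I -> R[i]) :
  Im (\sum_(i <- s) F i) = \sum_(i <- s) Im (F i).
Proof. by elim: s => [|i s IH]; rewrite ?big_nil// !big_cons cImD IH. Qed.

Lemma complex_ext x y : Re x = Re y -> Im x = Im y -> x = y.
Proof. by case: x => a b; case: y => c d /= -> ->. Qed.

Lemma cabsE z : (cabs z)%:C%C = `|z|.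
Proof. by rewrite normc_def. Qed.
Lemma cabs_ge0 z : 0 <= cabs z. Proof. exact: sqrtr_ge0. Qed.
Lemma cabsM x y : cabs (x * y) = cabs x * cabs y.
Proof. by apply: complexI; rewrite rmorphM /= !cabsE normrM. Qed.
Lemma cabsD x y : cabs (x + y) <= cabs x + cabs y.
Proof. by rewrite -lecR rmorphD /= !cabsE ler_normD. Qed.
Lemma cabsN x : cabs (- x) = cabs x.
Proof. by apply: complexI; rewrite !cabsE normrN. Qed.
Lemma cabsB x y : cabs (x - y) <= cabs x + cabs y.
Proof. by rewrite -(cabsN y) cabsD. Qed.
Lemma cabsC x y : cabs (x - y) = cabs (y - x).
Proof. by rewrite -cabsN opprB. Qed.
Lemma cabs0 : cabs (0 : R[i]) = 0.
Proof. by apply: complexI; rewrite cabsE normr0. Qed.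
Lemma cabs1 : cabs (1 : R[i]) = 1.
Proof. by apply: complexI; rewrite cabsE normr1. Qed.
Lemma cabs_eq0 z : cabs z = 0 -> z = 0.
Proof. by move=> h; apply/normr0_eq0; rewrite -cabsE h. Qed.
Lemma cabs_gt0 z : z != 0 -> 0 < cabs z.
Proof.
by move=> z0; rewrite lt_neqAle cabs_ge0 andbT eq_sym; apply: contra z0 => /eqP/cabs_eq0->.
Qed.
Lemma cabsR r : cabs r%:C%C = `|r|.
Proof. by rewrite /cabs /= expr0n addr0 sqrtr_sqr. Qed.
Lemma cabsi : cabs ('i%C : R[i]) = 1.
Proof. by rewrite /cabs /= expr0n add0r expr1n sqrtr1. Qed.
Lemma cabsV x : cabs x^-1 = (cabs x)^-1.
Proof. by apply: complexI; rewrite fmorphV /= !cabsE normfV. Qed.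
Lemma cabsX x n : cabs (x ^+ n) = cabs x ^+ n.
Proof. by elim: n => [|n IH]; rewrite ?expr0 ?cabs1// !exprS cabsM IH. Qed.
Lemma cabs_triB x y z : cabs (x - z) <= cabs (x - y) + cabs (y - z).
Proof. by have := cabsD (x - y) (y - z); rewrite addrA subrK. Qed.
Lemma cabs_sum (I : Type) (s : seq I) (F : I -> R[i]) :
  cabs (\sum_(i <- s) F i) <= \sum_(i <- s) cabs (F i).
Proof.
elim: s => [|i s IH]; rewrite ?big_nil ?cabs0// !big_cons.
by apply: le_trans (cabsD _ _) _; rewrite lerD2l.
Qed.
Lemma Re_le_cabs z : `|Re z| <= cabs z.
Proof. by rewrite -lecR cabsE normc_ge_Re. Qed.
Lemma Im_le_cabs z : `|Im z| <= cabs z.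
Proof.
have := Re_le_cabs (z * 'i%C); rewrite cReM /= mulr0 mulr1 sub0r normrN.
by rewrite cabsM cabsi mulr1.
Qed.
Lemma cabs_le_ReIm z : cabs z <= `|Re z| + `|Im z|.
Proof.
have {1}-> : z = (Re z)%:C%C + 'i%C * (Im z)%:C%C.
  by apply: complex_ext; rewrite !ReImE /=; ring.
by apply: le_trans (cabsD _ _) _; rewrite cabsM cabsi mul1r !cabsR.
Qed.
Lemma real_complexM r z : r%:C%C * z = (r * Re z +i* (r * Im z))%C.
Proof. by apply: complex_ext; rewrite !ReImE /=; ring. Qed.
Lemma cReZ r z : Re (r%:C%C * z) = r * Re z.
Proof. by rewrite real_complexM. Qed.
Lemma cImZ r z : Im (r%:C%C * z) = r * Im z.
Proof. by rewrite real_complexM. Qed.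

End ComplexModulus.

(** * Unconditional sums over an arbitrary index type *)

Section UnconditionalSums.
Variables (R : realType) (I : eqType).
Implicit Types (c d : I -> R[i]) (w : I -> R) (s : seq I).

(** Convergence along the net of finite subsets, each given by a duplicate-free sequence, so that
    lattices of frequencies need no enumeration. *)
Definition is_csum c (S : R[i]) := forall e : R, 0 < e ->
  exists s0 : seq I, forall s, uniq s -> {subset s0 <= s} ->
    cabs (S - \sum_(i <- s) c i) <= e.

Definition bsum w (W : R) := forall s, uniq s -> \sum_(i <- s) w i <= W.

Lemma is_csum_inj c S T : is_csum c S -> is_csum c T -> S = T.
Proof.
move=> hS hT; apply/eqP; rewrite -subr_eq0; apply/eqP/cabs_eq0.
apply/eqP; rewrite eq_le cabs_ge0 andbT; apply/ler_addgt0Pl => e e0.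
have e2 : 0 < e / 2 by lra.
have [s1 h1] := hS _ e2; have [s2 h2] := hT _ e2.
pose s := undup (s1 ++ s2).
have us : uniq s by exact: undup_uniq.
have s1s : {subset s1 <= s} by move=> i h; rewrite mem_undup mem_cat h.
have s2s : {subset s2 <= s} by move=> i h; rewrite mem_undup mem_cat h orbT.
have := cabs_triB S (\sum_(i <- s) c i) T.
have := h1 _ us s1s; have := h2 _ us s2s; rewrite (cabsC T); lra.
Qed.

Lemma eq_is_csum c d S : c =1 d -> is_csum c S -> is_csum d S.
Proof. by move=> /funext ->. Qed.

Lemma is_csumD c d S T :
  is_csum c S -> is_csum d T -> is_csum (fun i => c i + d i) (S + T).
Proof.
move=> hS hT e e0.
have e2 : 0 < e / 2 by lra.
have [s1 h1] := hS _ e2; have [s2 h2] := hT _ e2.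
exists (s1 ++ s2) => s us hs.
have H1 := h1 s us; have H2 := h2 s us.
rewrite big_split /= opprD addrACA; apply: le_trans (cabsD _ _) _.
have {}H1 : cabs (S - \sum_(i <- s) c i) <= e / 2.
  by apply: H1 => i h; apply: hs; rewrite mem_cat h.
have {}H2 : cabs (T - \sum_(i <- s) d i) <= e / 2.
  by apply: H2 => i h; apply: hs; rewrite mem_cat h orbT.
lra.
Qed.

Lemma is_csumZ a c S : is_csum c S -> is_csum (fun i => a * c i) (a * S).
Proof.
move=> hS e e0; have p : 0 < cabs a + 1 by have := cabs_ge0 a; lra.
have [s0 h0] := hS _ (divr_gt0 e0 p); exists s0 => s us hs.
rewrite -mulr_sumr -mulrBr cabsM.
apply: le_trans (_ : cabs a * (e / (cabs a + 1)) <= _).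
  by rewrite ler_wpM2l ?cabs_ge0// h0.
by rewrite mulrA ler_pdivrMr// mulrDr mulr1 mulrC lerDl ltW.
Qed.

Lemma is_csum0 : is_csum (fun=> 0) 0.
Proof. by move=> e e0; exists [::] => s us hs; rewrite big1// subrr cabs0 ltW. Qed.

Lemma is_csumN c S : is_csum c S -> is_csum (fun i => - c i) (- S).
Proof.
move=> h; rewrite -mulN1r; apply: eq_is_csum (is_csumZ (-1) h) => i.
by rewrite mulN1r.
Qed.

Lemma is_csum_sum (J : Type) (r : seq J) (c : J -> I -> R[i]) (S : J -> R[i]) :
  (forall j, is_csum (c j) (S j)) ->
  is_csum (fun i => \sum_(j <- r) c j i) (\sum_(j <- r) S j).
Proof.
move=> h; elim: r => [|j r IH].
  by rewrite big_nil; apply: eq_is_csum is_csum0 => i; rewrite big_nil.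
rewrite big_cons; apply: eq_is_csum (is_csumD (h j) IH) => i.
by rewrite big_cons.
Qed.

Lemma is_csum_single c i0 : (forall i, i != i0 -> c i = 0) -> is_csum c (c i0).
Proof.
move=> h e e0; exists [:: i0] => s us hs.
rewrite (bigD1_seq i0) ?hs ?inE//= big1 ?addr0 ?subrr ?cabs0 ?ltW//.
Qed.

Lemma sum_subset (V : zmodType) (F : I -> V) s0 s :
  uniq s0 -> uniq s -> {subset s0 <= s} ->
  \sum_(i <- s) F i = \sum_(i <- s0) F i + \sum_(i <- s | i \notin s0) F i.
Proof.
move=> u0 us hs; rewrite (bigID (mem s0)) /=; congr (_ + _).
rewrite -big_filter; apply: perm_big; apply: uniq_perm => //.
  exact: filter_uniq.
by move=> i; rewrite mem_filter; case: (boolP (i \in s0)) => //= /hs.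
Qed.

Lemma bsum_ge0 w W : bsum w W -> 0 <= W.
Proof. by move=> /(_ [::] isT); rewrite big_nil. Qed.

Lemma bsumZ w W a : 0 <= a -> bsum w W -> bsum (fun i => a * w i) (a * W).
Proof. by move=> a0 h s us; rewrite -mulr_sumr ler_wpM2l// h. Qed.

Lemma bsum_le w v W : (forall i, v i <= w i) -> bsum w W -> bsum v W.
Proof. by move=> h hw s us; apply: le_trans (hw s us); apply: ler_sum. Qed.

Lemma bsum_inj (J : eqType) (f : J -> I) w W :
  injective f -> bsum w W -> forall r, uniq r -> \sum_(j <- r) w (f j) <= W.
Proof.
move=> fi h r ur; have := h (map f r); rewrite map_inj_uniq// big_map; exact.
Qed.

(** Take a finite set whose sum is within [e] of the supremum of all finite sums: a disjoint finite
    set cannot add more than [e]. *)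
Lemma bsum_tail w W : (forall i, 0 <= w i) -> bsum w W -> forall e, 0 < e ->
  exists s0, uniq s0 /\ forall s, uniq s -> (forall i, i \in s -> i \notin s0) ->
    \sum_(i <- s) w i <= e.
Proof.
move=> w0 hW e e0.
pose A := [set r | exists2 s, uniq s & r = \sum_(i <- s) w i].
have A0 : A !=set0 by exists (\sum_(i <- [::]) w i), [::].
have uA : has_ubound A by exists W => _ [s us ->]; exact: hW.
have [_ [s0 us0 ->] hs0] := sup_adherent e0 (conj A0 uA).
exists s0; split => // s us dis.
have : \sum_(i <- s0 ++ s) w i <= sup A.
  apply: ub_le_sup => //; exists (s0 ++ s) => //.
  rewrite cat_uniq us0 us /= andbT; apply/hasPn => i /dis; exact.
rewrite big_cat /=; lra.
Qed.

Lemma is_csum_nonneg w W : (forall i, 0 <= w i) -> bsum w W ->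
  exists S : R, is_csum (fun i => (w i)%:C%C) (S%:C)%C.
Proof.
move=> w0 hW.
pose A := [set r | exists2 s, uniq s & r = \sum_(i <- s) w i].
have A0 : A !=set0 by exists (\sum_(i <- [::]) w i), [::].
have uA : has_ubound A by exists W => _ [s us ->]; exact: hW.
exists (sup A) => e e0.
have [_ [s0 us0 ->] hs0] := sup_adherent e0 (conj A0 uA).
exists s0 => s us hs.
rewrite -(rmorph_sum (real_complex R)) -rmorphB cabsR.
have h1 : \sum_(i <- s) w i <= sup A by apply: ub_le_sup => //; exists s.
have h2 : \sum_(i <- s0) w i <= \sum_(i <- s) w i.
  by rewrite (sum_subset w us0 us hs) lerDl sumr_ge0.
rewrite ger0_norm; lra.
Qed.

Lemma csum_exists c W : bsum (fun i => cabs (c i)) W -> exists S, is_csum c S.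
Proof.
move=> h.
have h0 := is_csum_nonneg (fun i => cabs_ge0 (c i)) h.
(* A real family dominated by the moduli is the difference of the nonnegative families [x + cabs c]
   and [cabs c]; this serves for both the real and the imaginary parts. *)
have aux (x : I -> R) : (forall i, `|x i| <= cabs (c i)) ->
    exists S, is_csum (fun i => (x i)%:C%C) S.
  move=> hx; have p i : 0 <= x i + cabs (c i).
    by have := hx i; rewrite ler_norml; lra.
  have [||S hS] := @is_csum_nonneg (fun i => x i + cabs (c i)) (2 * W) => //.
    move=> s us; apply: le_trans (_ : 2 * \sum_(i <- s) cabs (c i) <= _).
      rewrite mulr_sumr; apply: ler_sum => i _.
      by have := hx i; rewrite ler_norml; lra.
    by rewrite ler_pM2l// h.
  have [T hT] := h0; exists (S%:C%C + - T%:C%C).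
  apply: eq_is_csum (is_csumD hS (is_csumN hT)) => i /=.
  by rewrite rmorphD /= addrK.
have [S hS] := aux _ (fun i => Re_le_cabs (c i)).
have [T hT] := aux _ (fun i => Im_le_cabs (c i)).
exists (S + 'i%C * T); apply: eq_is_csum (is_csumD hS (is_csumZ 'i%C hT)) => i.
by apply: complex_ext; rewrite !ReImE /=; ring.
Qed.

Lemma is_csum_tail c S s e : is_csum c S -> uniq s ->
  (forall r, uniq r -> (forall i, i \in r -> i \notin s) ->
     \sum_(i <- r) cabs (c i) <= e) ->
  cabs (S - \sum_(i <- s) c i) <= e.
Proof.
move=> hS us ht; apply/ler_addgt0Pl => d d0.
have [s0 h0] := hS _ d0.
pose r := undup (s ++ s0).
have ur : uniq r by exact: undup_uniq.
have sr : {subset s <= r} by move=> i h; rewrite mem_undup mem_cat h.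
have s0r : {subset s0 <= r} by move=> i h; rewrite mem_undup mem_cat h orbT.
have := h0 _ ur s0r; rewrite (sum_subset c us ur sr) opprD addrA => h.
have h1 : cabs (\sum_(i <- r | i \notin s) c i) <= e.
  rewrite -big_filter; apply: le_trans (cabs_sum _ _) _; apply: ht.
    exact: filter_uniq.
  by move=> i; rewrite mem_filter => /andP[].
have := cabsD (S - \sum_(i <- s) c i - \sum_(i <- r | i \notin s) c i)
  (\sum_(i <- r | i \notin s) c i).
rewrite subrK; lra.
Qed.

Lemma is_csum_le c S W : is_csum c S -> bsum (fun i => cabs (c i)) W ->
  cabs S <= W.
Proof.
move=> hS hW; have := @is_csum_tail c S [::] W hS isT (fun r ur _ => hW r ur).
by rewrite big_nil subr0.
Qed.

Definition csum c : R[i] := xget 0 [set S | is_csum c S].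

Lemma csumP c W : bsum (fun i => cabs (c i)) W -> is_csum c (csum c).
Proof. by move=> /csum_exists[S hS]; apply: (xgetPex 0); exists S. Qed.

Lemma csumE c S : is_csum c S -> csum c = S.
Proof. by move=> h; apply: (is_csum_inj _ h); apply: (xgetPex 0); exists S. Qed.

End UnconditionalSums.

(** * Derivatives and primitives of real functions *)

Section RealDerivatives.
Variable R : realType.
Implicit Types (f g F G : R -> R) (t s a b d e : R).

Definition rder f t d := is_derive t 1 f d.

Lemma rder_cst c t : rder (fun=> c) t 0.
Proof. exact: is_derive_cst. Qed.
Lemma rder_id t : rder (fun s => s) t 1.
Proof. exact: is_derive_id. Qed.
Lemma rder_eq f t d e : rder f t d -> d = e -> rder f t e.
Proof. by move=> h <-. Qed.
Lemma rder_ext f g t d : f =1 g -> rder f t d -> rder g t d.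
Proof. by move=> /funext ->. Qed.
Lemma rderD f g t d e : rder f t d -> rder g t e ->
  rder (fun s => f s + g s) t (d + e).
Proof. exact: is_deriveD. Qed.
Lemma rderN f t d : rder f t d -> rder (fun s => - f s) t (- d).
Proof. exact: is_deriveN. Qed.
Lemma rderB f g t d e : rder f t d -> rder g t e ->
  rder (fun s => f s - g s) t (d - e).
Proof. exact: is_deriveB. Qed.
Lemma rderM f g t d e : rder f t d -> rder g t e ->
  rder (fun s => f s * g s) t (d * g t + f t * e).
Proof.
move=> hf hg; apply: (rder_eq (is_deriveM hf hg)).
by rewrite addrC /GRing.scale /= mulrC.
Qed.
Lemma rderZ c f t d : rder f t d -> rder (fun s => c * f s) t (c * d).
Proof. exact: is_deriveZ. Qed.
Lemma rder_comp f g t d e : rder g t e -> rder f (g t) d ->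
  rder (fun s => f (g s)) t (d * e).
Proof.
move=> hg hf; have := @is_derive1_comp _ f g t d e hf hg.
exact.
Qed.
Lemma rder_affine c b t : rder (fun s => c * s + b) t c.
Proof.
apply: rder_eq (rderD (rderZ c (rder_id t)) (rder_cst b t)) _.
by rewrite mulr1 addr0.
Qed.
Lemma rder_shift f c t d : rder f (t + c) d -> rder (fun s => f (s + c)) t d.
Proof.
move=> h; have h1 : rder (fun s => s + c) t 1.
  by apply: rder_eq (rderD (rder_id t) (rder_cst c t)) _; rewrite addr0.
by apply: rder_eq (rder_comp h1 h) _; rewrite mulr1.
Qed.
Lemma rder_continuous f t d : rder f t d -> {for t, continuous f}.
Proof.
move=> [h _]; apply: differentiable_continuous.
exact/derivable1_diffP.
Qed.

Lemma rder_MVT f (df : R -> R) a b : a <= b ->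
  (forall s, a <= s <= b -> rder f s (df s)) ->
  exists2 c, a <= c <= b & f b - f a = df c * (b - a).
Proof.
move=> ab h; have [||c cab e] := @MVT_segment _ f df a b ab.
- by move=> x; rewrite in_itv /= => /andP[ax xb]; apply: h; rewrite !ltW.
- apply: continuous_in_subspaceT => x; rewrite inE /= in_itv /= => xab.
  exact: rder_continuous (h _ xab).
- by exists c => //; move: cab; rewrite in_itv.
Qed.

Lemma rder_ge0 f (df : R -> R) a b : a <= b ->
  (forall s, a <= s <= b -> rder f s (df s)) ->
  (forall s, a <= s <= b -> 0 <= df s) -> f a <= f b.
Proof.
move=> ab h h0; have [c cab e] := rder_MVT ab h.
by rewrite -subr_ge0 e mulr_ge0 ?h0 ?subr_ge0.
Qed.

Lemma rder_lip f (df : R -> R) a b K : a <= b ->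
  (forall s, a <= s <= b -> rder f s (df s)) ->
  (forall s, a <= s <= b -> `|df s| <= K) -> `|f b - f a| <= K * (b - a).
Proof.
move=> ab h h0; have [c cab ->] := rder_MVT ab h.
by rewrite normrM (ger0_norm (_ : 0 <= b - a)) ?subr_ge0// ler_wpM2r ?subr_ge0 ?h0.
Qed.

(** The fundamental theorem is applied to integrals from a fixed left end, at points to its right.
    Here the left end moves with [t]; subtracting the value at 0 makes the result independent of
    that end ([FE]), hence differentiable on the whole line. *)
Lemma primitive_exists f : continuous f -> exists F, forall t, rder F t (f t).
Proof.
move=> cf.
pose FK (K : R) t := (\int[@lebesgue_measure R]_(x in `[K, t]) f x)%R.
have dFK K t : K < t -> rder (FK K) t (f t).
  move=> Kt; have [||||d1 d2] := @continuous_FTC1_closed _ f K t (t + 1).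
  - by rewrite ltrDl.
  - apply: continuous_compact_integrable; first exact: segment_compact.
    exact: continuous_subspaceT.
  - exact: Kt.
  - exact: cf.
  - by rewrite derive1E in d2; exact: DeriveDef d1 d2.
pose F t := FK (- (`|t| + 1)) t - FK (- (`|t| + 1)) 0.
have FE K t : `|t| + 1 <= K -> F t = FK (- K) t - FK (- K) 0.
  move=> tK; rewrite /F; set L := `|t| + 1.
  have L0 : 0 < L by rewrite ltr_pwDr.
  have key a b : - L < a -> a <= b ->
      FK (- L) b - FK (- K) b = FK (- L) a - FK (- K) a.
    move=> La ab.
    have [|c _ /eqP] := @rder_MVT (fun t => FK (- L) t - FK (- K) t) (fun=> 0) a b ab.
      move=> s /andP[as_ _]; have Ls : - L < s by exact: lt_le_trans as_.
      rewrite -(subrr (f s)); apply: rderB; apply: dFK => //.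
      by apply: le_lt_trans Ls; rewrite lerN2.
    by rewrite mul0r subr_eq0 => /eqP.
  have : FK (- L) t - FK (- K) t = FK (- L) 0 - FK (- K) 0.
    case: (leP 0 t) => t0; first by apply: key => //; rewrite oppr_lt0.
    by symmetry; apply: key; rewrite ?ltW// /L ltr0_norm//; lra.
  lra.
exists F => t.
have h : rder (fun s => FK (- (`|t| + 2)) s - FK (- (`|t| + 2)) 0) t (f t).
  rewrite -[f t]subr0; apply: rderB; last exact: rder_cst.
  apply: dFK; have := ler_norm (- t); rewrite normrN; lra.
apply: near_eq_is_derive h; near=> s; symmetry; rewrite (@FE (`|t| + 2))//.
have : `|s - t| < 1.
  by rewrite distrC; near: s; exact: nbhsx_ballx.
by have := ler_normD (s - t) t; rewrite subrK; lra.
Unshelve. all: by end_near. Qed.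

Lemma Rintegral_primitive f F a b : a < b -> continuous f ->
  (forall t, rder F t (f t)) ->
  Rintegral (@lebesgue_measure R) `[a, b] f = F b - F a.
Proof.
move=> ab cf dF; rewrite /Rintegral (@continuous_FTC2 _ f F)//.
- exact: continuous_subspaceT.
- split.
  + by move=> x _; case: (dF x).
  + apply: cvg_at_right_filter; exact: rder_continuous (dF a).
  + apply: cvg_at_left_filter; exact: rder_continuous (dF b).
- move=> x _; rewrite derive1E; case: (dF x) => _; exact.
Qed.

End RealDerivatives.

(** * Complex-valued functions of a real variable and the exponential *)

Section ComplexCalculus.
Variable R : realType.
Implicit Types (u v w : R -> R[i]) (t s a b : R) (d e : R[i]).
Local Notation Re := (@complex.Re R).
Local Notation Im := (@complex.Im R).

Definition cder u t d :=
  rder (fun s => Re (u s)) t (Re d) /\ rder (fun s => Im (u s)) t (Im d).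

Lemma cder_eq u t d e : cder u t d -> d = e -> cder u t e.
Proof. by move=> h <-. Qed.
Lemma cder_ext u v t d : u =1 v -> cder u t d -> cder v t d.
Proof. by move=> /funext ->. Qed.
Lemma cder_cst d t : cder (fun=> d) t 0.
Proof. by split; exact: rder_cst. Qed.
Lemma cderD u v t d e : cder u t d -> cder v t e ->
  cder (fun s => u s + v s) t (d + e).
Proof.
move=> [h1 h2] [k1 k2]; split.
  by apply: rder_ext (rder_eq (rderD h1 k1) _) => [s|]; rewrite cReD.
by apply: rder_ext (rder_eq (rderD h2 k2) _) => [s|]; rewrite cImD.
Qed.
Lemma cderM u v t d e : cder u t d -> cder v t e ->
  cder (fun s => u s * v s) t (d * v t + u t * e).
Proof.
move=> [h1 h2] [k1 k2]; split.
  apply: rder_ext (rder_eq (rderB (rderM h1 k1) (rderM h2 k2)) _) => [s|].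
    by rewrite cReM.
  by rewrite !ReImE; ring.
apply: rder_ext (rder_eq (rderD (rderM h1 k2) (rderM h2 k1)) _) => [s|].
  by rewrite cImM.
by rewrite !ReImE; ring.
Qed.
Lemma cderZ c u t d : cder u t d -> cder (fun s => c * u s) t (c * d).
Proof.
by move=> h; apply: cder_eq (cderM (cder_cst c t) h) _; rewrite mul0r add0r.
Qed.
Lemma cderN u t d : cder u t d -> cder (fun s => - u s) t (- d).
Proof.
move=> h; apply: cder_ext (cder_eq (cderZ (-1) h) _) => [s|]; exact: mulN1r.
Qed.
Lemma cderB u v t d e : cder u t d -> cder v t e ->
  cder (fun s => u s - v s) t (d - e).
Proof. by move=> h k; exact: cderD h (cderN k). Qed.
Lemma cder_real (f : R -> R) t x :
  rder f t x -> cder (fun s => (f s)%:C%C) t x%:C%C.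
Proof. by move=> h; split => //=; exact: rder_cst. Qed.
Lemma cder_shift u c t d : cder u (t + c) d -> cder (fun s => u (s + c)) t d.
Proof. by move=> [h k]; split; [exact: rder_shift h|exact: rder_shift k]. Qed.

(** The factor 2 comes from applying the mean value theorem to the real and imaginary parts
    separately. *)
Lemma cder_lip u (du : R -> R[i]) a b K : a <= b ->
  (forall s, a <= s <= b -> cder u s (du s)) ->
  (forall s, a <= s <= b -> cabs (du s) <= K) ->
  cabs (u b - u a) <= 2 * K * (b - a).
Proof.
move=> ab h hK; apply: le_trans (cabs_le_ReIm _) _.
rewrite cReD cImD cReN cImN.
have h1 : `|Re (u b) - Re (u a)| <= K * (b - a).
  apply: (@rder_lip _ (fun s => Re (u s)) (fun s => Re (du s)) a b K ab) => s hs; first by case: (h s hs).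
  exact: le_trans (Re_le_cabs _) (hK s hs).
have h2 : `|Im (u b) - Im (u a)| <= K * (b - a).
  apply: (@rder_lip _ (fun s => Im (u s)) (fun s => Im (du s)) a b K ab) => s hs; first by case: (h s hs).
  exact: le_trans (Im_le_cabs _) (hK s hs).
lra.
Qed.

Lemma cder_const u : (forall s, cder u s 0) -> forall a b, u a = u b.
Proof.
move=> h a b; apply: complex_ext.
  exact: (is_derive_0_is_cst a b (fun s => proj1 (h s))).
exact: (is_derive_0_is_cst a b (fun s => proj2 (h s))).
Qed.

Definition cis (x : R) : R[i] := (cos x +i* sin x)%C.
Definition cexp (z : R[i]) : R[i] := (expR (Re z))%:C%C * cis (Im z).

Lemma cisD x y : cis (x + y) = cis x * cis y.
Proof.
by apply: complex_ext; rewrite !ReImE /= ?cosD ?sinD//; rewrite addrC.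
Qed.
Lemma cis0 : cis 0 = 1. Proof. by rewrite /cis cos0 sin0. Qed.
Lemma cabs_cis x : cabs (cis x) = 1.
Proof. by rewrite /cabs /= cos2Dsin2 sqrtr1. Qed.
Lemma cisN x : cis (- x) * cis x = 1.
Proof. by rewrite -cisD addNr cis0. Qed.
Lemma cis_2pi_nat (k : nat) : cis (2 * pi * k%:R) = 1.
Proof.
elim: k => [|k IH]; first by rewrite mulr0 cis0.
rewrite -[k.+1]addn1 natrD mulrDr cisD IH mul1r mulr1 /cis.
by rewrite -mulr_natl mulr1 (mulr_natl pi 2) cos2pi sin2pi.
Qed.
Lemma cis_2pi_int (k : int) : cis (2 * pi * k%:~R) = 1.
Proof.
case: k => n; first exact: cis_2pi_nat.
by rewrite NegzE rmorphN /= -pmulrn mulrN -[LHS]mulr1 -[X in _ * X](cis_2pi_nat n.+1) cisN.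
Qed.
Lemma cexpD d e : cexp (d + e) = cexp d * cexp e.
Proof. by rewrite /cexp cReD cImD expRD cisD rmorphM /=; ring. Qed.
Lemma cexp0 : cexp 0 = 1.
Proof. by rewrite /cexp /= expR0 cis0 mulr1. Qed.
Lemma cabs_cexp d : cabs (cexp d) = expR (Re d).
Proof. by rewrite cabsM cabs_cis mulr1 cabsR ger0_norm// expR_ge0. Qed.
Lemma cexpN d : cexp (- d) * cexp d = 1.
Proof. by rewrite -cexpD addNr cexp0. Qed.
Lemma cis_cexp x : cis x = cexp ('i%C * x%:C%C).
Proof.
have -> : 'i%C * x%:C%C = (0 +i* x)%C by apply: complex_ext; rewrite !ReImE /=; ring.
by rewrite /cexp /= expR0 mul1r.
Qed.

Lemma cder_cis (f : R -> R) t x : rder f t x ->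
  cder (fun s => cis (f s)) t ('i%C * x%:C%C * cis (f t)).
Proof.
move=> h; split; rewrite !ReImE /=.
  by apply: rder_eq (rder_comp h (is_derive_cos (f t))) _; ring.
by apply: rder_eq (rder_comp h (is_derive_sin (f t))) _; ring.
Qed.

Lemma cder_cexp w t d : cder w t d ->
  cder (fun s => cexp (w s)) t (d * cexp (w t)).
Proof.
move=> [h k]; have e1 : rder (fun s => expR (Re (w s))) t (Re d * expR (Re (w t))).
  apply: rder_eq (rder_comp h (is_derive_expR (Re (w t)))) _; exact: mulrC.
apply: cder_eq (cderM (cder_real e1) (cder_cis k)) _.
rewrite /cexp rmorphM /=.
have {3}-> : d = (Re d)%:C%C + 'i%C * (Im d)%:C%C.
  by apply: complex_ext; rewrite !ReImE /=; ring.
ring.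
Qed.

Lemma cabs_cis_sub1 x : cabs (cis x - 1) <= 2 * `|x|.
Proof.
wlog x0 : x / 0 <= x.
  move=> H; case: (leP 0 x) => [/H//|xl].
  have := H (- x); rewrite oppr_ge0 ltW// normrN => /(_ isT).
  have -> : cis x - 1 = - (cis x * (cis (- x) - 1)).
    by rewrite mulrBr mulr1 mulrC cisN opprB.
  by rewrite cabsN cabsM cabs_cis mul1r.
have d s : cder cis s ('i%C * 1%:C%C * cis s).
  exact: (cder_cis (rder_id s)).
have := @cder_lip cis (fun s => 'i%C * 1%:C%C * cis s) 0 x 1 x0 (fun s _ => d s).
rewrite cis0 mulr1 subr0 ger0_norm//; apply => s _.
by rewrite !cabsM cabsi cabs_cis !mulr1 mul1r cabs1.
Qed.

Lemma cabs_cis_sub2 x : cabs (cis x - 1 - 'i%C * x%:C%C) <= 4 * x ^+ 2.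
Proof.
wlog x0 : x / 0 <= x.
  move=> H; case: (leP 0 x) => [/H//|xl].
  have := H (- x); rewrite oppr_ge0 ltW// sqrrN => /(_ isT).
  congr (_ <= _); rewrite /cabs; congr Num.sqrt; rewrite !ReImE /= cosN sinN; ring.
have d s : cder (fun s => cis s - 1 - 'i%C * s%:C%C) s ('i%C * (cis s - 1)).
  apply: cder_eq (cderB (cderB (cder_cis (rder_id s)) (cder_cst 1 s))
    (cderZ 'i%C (cder_real (rder_id s)))) _.
  by rewrite rmorph1; ring.
have := @cder_lip _ _ 0 x (2 * x) x0 (fun s _ => d s).
rewrite cis0 subrr sub0r mulr0 oppr0 !subr0 => H.
have -> : 4 * x ^+ 2 = 2 * (2 * x) * x by ring.
apply: H => s /andP[s0 sx]; rewrite cabsM cabsi mul1r.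
by apply: le_trans (cabs_cis_sub1 s) _; rewrite ger0_norm// ler_pM2l.
Qed.

End ComplexCalculus.

(** * Weight functions *)

Section Weights.
Variables (R : realType) (om : R -> R).
Hypotheses (wf : weight_function om) (sub : om_subadditive om).

Lemma om_mono s t : 0 <= s -> s <= t -> om s <= om t.
Proof. by case: wf => h _; exact: h. Qed.

Lemma om_ge0 t : 0 <= t -> 0 <= om t.
Proof. by case: wf => _ [h _]; exact: h. Qed.

Lemma om_natmul (k : nat) t : 0 <= t -> om (k.+1%:R * t) <= k.+1%:R * om t.
Proof.
move=> t0; elim: k => [|k IH]; first by rewrite !mul1r.
rewrite -[k.+2]addn1 natrD !mulrDl !mul1r.
by apply: le_trans (sub _ _) _ => //; [rewrite mulr_ge0|rewrite lerD2r].
Qed.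

Lemma om_log_growth e : 0 < e -> exists T, forall t, T <= t -> ln t <= e * om t.
Proof. by case: wf => _ [_ [_ [_ [_ [h _]]]]]; exact: h. Qed.

Lemma om_growth1 e : 0 < e -> exists2 C : R, 0 < C &
  forall t, 0 <= t -> 1 + t <= C * expR (e * om t).
Proof.
move=> e0; have [T hT] := om_log_growth e0.
exists (2 + `|T|); first by have := normr_ge0 T; lra.
move=> t t0; have p : 1 <= expR (e * om t) by rewrite -expR0 ler_expR mulr_ge0 ?om_ge0// ltW.
have hN := ler_norm T; have hN0 := normr_ge0 T.
case: (leP (1 + `|T|) t) => ht.
  have t1 : 0 < t by lra.
  have h1 : t <= expR (e * om t) by rewrite -[leLHS](lnK t1) ler_expR hT//; lra.
  nra.
nra.
Qed.

Lemma om_growth (p : nat) e : 0 < e -> exists2 C : R, 0 < C &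
  forall t, 0 <= t -> (1 + t) ^+ p <= C * expR (e * om t).
Proof.
(* The rate is divided by [p.+1] rather than by [p], so that [p = 0] is not an exception. *)
move=> e0; have p0 : 0 < p.+1%:R :> R by [].
have [C C0 hC] := om_growth1 (divr_gt0 e0 p0).
exists (C ^+ p); first exact: exprn_gt0.
move=> t t0; apply: le_trans (_ : (C * expR (e / p.+1%:R * om t)) ^+ p <= _).
  by rewrite lerXn2r ?nnegrE ?hC//; [lra|rewrite mulr_ge0 ?expR_ge0// ltW].
rewrite exprMn ler_pM2l ?exprn_gt0// -expRM_natl ler_expR.
rewrite mulrA ler_wpM2r ?om_ge0// mulrC -mulrA ler_piMr ?(ltW e0)//.
by rewrite mulrC ler_pdivrMr// mul1r ler_nat.
Qed.

(** Since [log t = o (omega t)], the function phi grows faster than any line, so the Legendre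
    transform is finite and [sup] has its intended meaning. *)
Lemma phistar_has_sup t :
  has_sup [set s * t - wphi om s | s in [set s : R | 0 <= s]].
Proof.
split; first by exists (0 * t - wphi om 0), 0 => //=.
have e0 : 0 < (`|t| + 1)^-1 by rewrite invr_gt0 ltr_wpDl.
have [T hT] := om_log_growth e0.
exists (`|T| * `|t|) => _ [s /= s0 <-].
have st : s * t <= s * `|t| by rewrite ler_wpM2l// ler_norm.
have Tt := mulr_ge0 (normr_ge0 T) (normr_ge0 t).
case: (leP T (expR s)) => Ts.
  have := hT _ Ts; rewrite expRK mulrC ler_pdivlMr ?ltr_wpDl// /wphi.
  by nra.
have h1 : s <= `|T|.
  have := ler_norm T; have := expR_ge1Dx s; lra.
have : 0 <= wphi om s by rewrite om_ge0// expR_ge0.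
have := ler_wpM2r (normr_ge0 t) h1; lra.
Qed.

Lemma phistar_ub s t : 0 <= s -> s * t - wphi om s <= phistar om t.
Proof.
move=> s0; apply: ub_le_sup; first by case: (phistar_has_sup t).
by exists s.
Qed.

Lemma phistar_le t B : (forall s, 0 <= s -> s * t - wphi om s <= B) ->
  phistar om t <= B.
Proof.
move=> h; apply: ge_sup; first by case: (phistar_has_sup t).
by move=> _ [s /= s0 <-]; exact: h.
Qed.

Lemma phistar_mono s t : s <= t -> phistar om s <= phistar om t.
Proof.
move=> st; apply: phistar_le => u u0.
by apply: le_trans (phistar_ub t u0); rewrite lerB// ler_wpM2l.
Qed.

(** Young's inequality at the point [ln r], which must be nonnegative; hence [1 <= r]. *)
Lemma pow_phistar r lam (j : nat) : 1 <= r -> 0 < lam ->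
  r ^+ j * expR (- (lam * phistar om (j%:R / lam))) <= expR (lam * om r).
Proof.
move=> r1 l0; have r0 : 0 < r by exact: lt_le_trans r1.
have s0 : 0 <= ln r by rewrite ln_ge0.
have := phistar_ub (j%:R / lam) s0; rewrite /wphi lnK// => h.
rewrite -{1}(lnK r0) -expRM_natl -expRD ler_expR.
have : lam * (ln r * (j%:R / lam) - om r) <= lam * phistar om (j%:R / lam).
  by rewrite ler_pM2l.
have -> : lam * (ln r * (j%:R / lam) - om r) = j%:R * ln r - lam * om r.
  by field; rewrite gt_eqF.
lra.
Qed.

Lemma wphi_convex v s u : v < s -> s < u ->
  (wphi om s - wphi om v) * (u - s) <= (wphi om u - wphi om s) * (s - v).
Proof.
move=> vs su; case: wf => _ [_ [_ [_ [_ [_ h]]]]].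
have uv : 0 < u - v by lra.
have := h v u ((u - s) / (u - v)).
have -> : (u - s) / (u - v) * v + (1 - (u - s) / (u - v)) * u = s.
  by field; rewrite gt_eqF.
have -> : (u - s) / (u - v) * wphi om v + (1 - (u - s) / (u - v)) * wphi om u =
   ((u - s) * wphi om v + (s - v) * wphi om u) / (u - v).
  by field; rewrite gt_eqF.
move=> H; have {H} : wphi om s <=
    ((u - s) * wphi om v + (s - v) * wphi om u) / (u - v).
  by apply: H; [rewrite divr_ge0//|rewrite ler_pdivrMr// mul1r]; lra.
by rewrite ler_pdivlMr//; lra.
Qed.

Lemma wphi_mono s t : s <= t -> wphi om s <= wphi om t.
Proof. by move=> st; rewrite om_mono ?expR_ge0// ler_expR. Qed.

(** By convexity every slope to the left of [s] is at most every slope to the right, so the supremum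
    of the left slopes supports the graph. *)
Lemma wphi_subgradient s : exists2 p : R, 0 <= p &
  forall u, wphi om s + p * (u - s) <= wphi om u.
Proof.
pose A := [set (wphi om s - wphi om v) / (s - v) | v in [set v | v < s]].
have Aub u : s < u -> ubound A ((wphi om u - wphi om s) / (u - s)).
  move=> su _ [v /= vs <-].
  rewrite ler_pdivrMr ?subr_gt0// mulrAC ler_pdivlMr ?subr_gt0//.
  exact: wphi_convex.
have A0 : A !=set0.
  by exists ((wphi om s - wphi om (s - 1)) / (s - (s - 1))), (s - 1) => //=; lra.
have hA : has_ubound A.
  by exists ((wphi om (s + 1) - wphi om s) / (s + 1 - s)); apply: Aub; lra.
have pub v : v < s -> (wphi om s - wphi om v) / (s - v) <= sup A.
  by move=> vs; apply: ub_le_sup => //; exists v.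
exists (sup A).
  apply: le_trans (pub (s - 1) _); last lra.
  by rewrite divr_ge0// subr_ge0 ?wphi_mono//; lra.
move=> u; case: (ltgtP u s) => [us|su|->]; last by rewrite subrr mulr0 addr0.
  by have := pub _ us; rewrite ler_pdivrMr ?subr_gt0//; lra.
have := ge_sup A0 (Aub _ su); rewrite ler_pdivlMr ?subr_gt0//; lra.
Qed.

(* The slope [p] of a supporting line of phi at [log r] makes Young's
   inequality an equality; rounding [lam * p] down to an integer costs [r]. *)
Lemma phistar_attained r lam : 1 <= r -> 0 < lam -> exists j : nat,
  expR (lam * phistar om (j%:R / lam)) <= r * r ^+ j * expR (- (lam * om r)).
Proof.
move=> r1 l0; have r0 : 0 < r by exact: lt_le_trans r1.
have s0 : 0 <= ln r by rewrite ln_ge0.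
have [p p0 hp] := wphi_subgradient (ln r).
pose j := Num.truncn (lam * p); exists j.
have /andP[j1 j2] : j%:R <= lam * p < j.+1%:R.
  by rewrite truncn_itv// mulr_ge0// ltW.
have jp : j%:R / lam <= p by rewrite ler_pdivrMr// mulrC.
have h1 : phistar om (j%:R / lam) <= p * ln r - om r.
  apply: le_trans (phistar_mono jp) _; apply: phistar_le => u _.
  by have := hp u; rewrite {1}/wphi lnK//; lra.
rewrite -exprS -{1}(lnK r0) -expRM_natl -expRD ler_expR.
have := ler_wpM2l (ltW l0) h1; have := ler_wpM2r s0 (ltW j2); lra.
Qed.

End Weights.

(** * Norms of lattice points and summability of the weights *)

Section MultiIndices.
Variables (R : realType) (n : nat).
Implicit Types z : 'rV[int]_n.

(** The l1 norm splits exactly into the tau and xi parts; up to a factor of the dimension it agrees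
    with the Euclidean norm of the Diophantine condition. *)
Definition nz z : R := \sum_i `|z 0 i|%:~R.

Lemma nz_ge0 z : 0 <= nz z.
Proof. by apply: sumr_ge0 => i _; rewrite ler0z. Qed.
Lemma nz0 : nz 0 = 0.
Proof. by rewrite /nz big1// => i _; rewrite mxE normr0. Qed.
Lemma nzN z : nz (- z) = nz z.
Proof. by apply: eq_bigr => i _; rewrite mxE normrN. Qed.
Lemma nzD y z : nz (y + z) <= nz y + nz z.
Proof.
rewrite /nz -big_split /=; apply: ler_sum => i _.
by rewrite mxE -intrD ler_int ler_normD.
Qed.
Lemma le_nz z i : `|z 0 i|%:~R <= nz z.
Proof.
rewrite /nz (bigD1 i)//= lerDl; apply: sumr_ge0 => j _; by rewrite ler0z.
Qed.
Lemma nz_max z : z != 0 -> exists2 i, 1 <= `|z 0 i|%:~R :> R &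
  nz z <= n%:R * `|z 0 i|%:~R.
Proof.
move=> z0; have [i0 hi0] : exists i, z 0 i != 0.
  apply: contrapT => h; move/eqP: z0; apply; apply/rowP => i; rewrite mxE.
  by apply/eqP; apply: contrapT => hi; apply: h; exists i; exact/negP.
case: (@arg_maxnP _ i0 xpredT (fun i => absz (z 0 i))) => // i _ hi.
exists i.
  rewrite -[1]/(1%:~R) ler_int; have := hi i0 isT.
  by have := hi0; rewrite -absz_gt0; move=> h1 h2; rewrite -abszE lez_nat (leq_trans h1).
apply: le_trans (_ : \sum_(j < n) `|z 0 i|%:~R <= _).
  by apply: ler_sum => j _; rewrite ler_int -!abszE lez_nat; exact: hi.
by rewrite sumr_const card_ord mulr_natl.
Qed.

End MultiIndices.

Section LatticeSums.
Variable R : realType.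

(** The term [- 4 / K.+1] closes the induction: with [x = K + 1], each of the two new terms is at
    most [2 (1 / x - 1 / (x + 1))], which telescopes. *)
Lemma sum_inv_sqr_le (K : nat) :
  \sum_(k < K.*2.+1) (1 + (k%:R - K%:R) ^+ 2)^-1 <= 5 - 4 / K.+1%:R :> R.
Proof.
elim: K => [|K IH].
  by rewrite big_ord1 subrr expr0n addr0 invr1; lra.
rewrite doubleS big_ord_recr big_ord_recl /=.
have -> : \sum_(i < K.*2.+1) (1 + ((bump 0 i)%:R - K.+1%:R) ^+ 2)^-1 =
   \sum_(i < K.*2.+1) (1 + (i%:R - K%:R) ^+ 2)^-1 :> R.
  apply: eq_bigr => i _; congr (1 + _ ^+ 2)^-1.
  by rewrite /bump leq0n add1n -(natr1 i) -(natr1 K); ring.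
have -> : K.*2.+2%:R = 2 * K.+1%:R :> R.
  by rewrite -doubleS -muln2 natrM mulrC.
rewrite sub0r sqrrN; set x := K.+1%:R in IH *.
have -> : (2 * x - x) = x by ring.
have -> : K.+2%:R = x + 1 by rewrite -natr1.
have x0 : 0 < x by rewrite ltr0n.
have h : (1 + x ^+ 2)^-1 <= 2 * (x^-1 - (x + 1)^-1).
  have -> : 2 * (x^-1 - (x + 1)^-1) = 2 / (x * (x + 1)).
    by field; rewrite !gt_eqF//; lra.
  rewrite -[leLHS]mul1r ler_pdivrMr; last by nra.
  by rewrite mulrAC ler_pdivlMr; nra.
move: h IH; move: (x^-1) ((x + 1)^-1) ((1 + x ^+ 2)^-1) (\sum_(_ < _) _) => a b c d.
lra.
Qed.

Definition invsqr n (z : 'rV[int]_n) : R := \prod_i (1 + (z 0 i)%:~R ^+ 2)^-1.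

Lemma invsqr_gt0 n (z : 'rV[int]_n) : 0 < invsqr z.
Proof.
by apply: prodr_gt0 => i _; rewrite invr_gt0 ltr_pwDl// sqr_ge0.
Qed.

(** A finite set lies in a cube, over which the sum of products factors into [n] one-dimensional
    sums. *)
Lemma bsum_invsqr n : bsum (@invsqr n) (5 ^+ n).
Proof.
move=> s us.
pose K := (\max_(z <- s) \max_(i < n) `|z 0%R i|)%N.
have hK z i : z \in s -> (`|z 0%R i| <= K)%N.
  move=> zs; apply: leq_trans (_ : \max_(i < n) `|z 0%R i| <= _)%N.
    exact: (leq_bigmax i).
  exact: (leq_bigmax_seq _ zs).
pose dec (f : {ffun 'I_n -> 'I_K.*2.+1}) : 'rV[int]_n := \row_i ((f i)%:Z - K%:Z).
have dec_inj : injective dec.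
  move=> f g /rowP e; apply/ffunP => i; have := e i; rewrite !mxE => /addIr [].
  exact: val_inj.
have sub : {subset s <= map dec (enum {: {ffun 'I_n -> 'I_K.*2.+1}})}.
  move=> z zs; apply/mapP.
  exists [ffun i => inord (absz (z 0 i + K%:Z))]; first by rewrite mem_enum.
  apply/rowP => i; rewrite mxE ffunE; have := hK z i zs => h.
  have p : 0 <= z 0 i + K%:Z by lia.
  by rewrite inordK; lia.
have um : uniq (map dec (enum {: {ffun 'I_n -> 'I_K.*2.+1}})).
  by rewrite map_inj_uniq// enum_uniq.
apply: le_trans (_ : \sum_(z <- map dec (enum {: {ffun 'I_n -> 'I_K.*2.+1}})) invsqr z <= _).
  rewrite (sum_subset _ us um sub) lerDl sumr_ge0// => z _.
  exact: ltW (invsqr_gt0 z).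
rewrite big_map big_enum /=.
have -> : \sum_f invsqr (dec f) =
   \prod_(i < n) \sum_(k < K.*2.+1) (1 + (k%:R - K%:R) ^+ 2)^-1.
  rewrite bigA_distr_bigA /=; apply: eq_bigr => f _; apply: eq_bigr => i _.
  by rewrite mxE rmorphB.
rewrite prodr_const card_ord lerXn2r ?nnegrE//.
  by apply: sumr_ge0 => k _; rewrite invr_ge0 addr_ge0// sqr_ge0.
apply: le_trans (sum_inv_sqr_le K) _.
by rewrite lerBlDr lerDl divr_ge0.
Qed.

Lemma invsqr_ge n (z : 'rV[int]_n) : 1 <= (1 + nz R z) ^+ (2 * n) * invsqr z.
Proof.
rewrite exprM -[X in _ ^+ X]card_ord -prodr_const /invsqr -big_split /=.
apply: (big_ind (fun x => 1 <= x)) => // [x y hx hy|i _]; first by nra.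
rewrite ler_pdivlMr ?mul1r; last by rewrite ltr_pwDl// sqr_ge0.
have h := le_nz R z i; have h0 := nz_ge0 R z.
have -> : (z 0 i)%:~R ^+ 2 = `|z 0 i|%:~R ^+ 2 :> R.
  by rewrite intr_norm real_normK ?num_real.
have : 0 <= `|z 0 i|%:~R :> R by rewrite ler0z.
nra.
Qed.

End LatticeSums.

Section WeightedSums.
Variables (R : realType) (om : R -> R).
Hypotheses (wf : weight_function om) (sub : om_subadditive om).

Definition ow n (z : 'rV[int]_n) : R := om (nz R z).

Section Fixed.
Variable n : nat.
Implicit Types y z : 'rV[int]_n.

Lemma ow_ge0 z : 0 <= ow z. Proof. exact: om_ge0 (nz_ge0 _ z). Qed.
Lemma owN z : ow (- z) = ow z. Proof. by rewrite /ow nzN. Qed.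
Lemma owD y z : ow (y + z) <= ow y + ow z.
Proof.
apply: le_trans (om_mono wf (nz_ge0 _ _) (nzD R y z)) _.
exact: sub (nz_ge0 _ _) (nz_ge0 _ _).
Qed.
Lemma owB y z : ow y <= ow (y - z) + ow z.
Proof. by have := owD (y - z) z; rewrite subrK. Qed.

Lemma poly_ow (p : nat) e : 0 < e -> exists2 C : R, 0 < C &
  forall z, (1 + nz R z) ^+ p <= C * expR (e * ow z).
Proof.
by move=> e0; have [C C0 h] := om_growth wf p e0; exists C => // z; apply/h/nz_ge0.
Qed.

(** [exp (e omega)] dominates the power [2 n] of the norm, which dominates the inverse of the
    summable [invsqr]. *)
Lemma bsum_ow e : 0 < e -> exists2 W, 0 < W &
  bsum (fun z => expR (- (e * ow z))) W.
Proof.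
move=> e0; have [C C0 hC] := poly_ow (2 * n) e0.
exists (C * 5 ^+ n); first by rewrite mulr_gt0// exprn_gt0.
apply: bsum_le (bsumZ (ltW C0) (@bsum_invsqr R n)) => z.
have h1 := invsqr_ge R z; have h2 := hC z; have h3 := invsqr_gt0 R z.
rewrite expRN -[leLHS]mul1r ler_pdivrMr ?expR_gt0//.
have : (1 + nz R z) ^+ (2 * n) * invsqr R z <= C * expR (e * ow z) * invsqr R z.
  by rewrite ler_pM2r.
lra.
Qed.

End Fixed.
End WeightedSums.

(** * Fourier coefficients on the torus *)

Section PeriodIntegral.
Variable R : realType.
Implicit Types (f g : R -> R).

Definition perint f := Rintegral (@lebesgue_measure R) `[0, 2 * pi] f.

Lemma twopi_gt0 : 0 < 2 * pi :> R. Proof. by rewrite mulr_gt0// pi_gt0. Qed.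

Lemma perintE f F : continuous f -> (forall t, rder F t (f t)) ->
  perint f = F (2 * pi) - F 0.
Proof. by move=> cf dF; apply: Rintegral_primitive dF => //; exact: twopi_gt0. Qed.

Lemma perintD f g : continuous f -> continuous g ->
  perint (fun t => f t + g t) = perint f + perint g.
Proof.
move=> cf cg; have [F dF] := primitive_exists cf; have [G dG] := primitive_exists cg.
rewrite (perintE cf dF) (perintE cg dG).
rewrite (@perintE _ (fun t => F t + G t)); first ring.
- by move=> t; apply: continuousD; [exact: cf|exact: cg].
- by move=> t; exact: rderD.
Qed.

Lemma perintZ c f : continuous f -> perint (fun t => c * f t) = c * perint f.
Proof.
move=> cf; have [F dF] := primitive_exists cf.
rewrite (perintE cf dF) (@perintE _ (fun t => c * F t)); first ring.
- by move=> t; apply: continuousM; [exact: cvg_cst|exact: cf].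
- by move=> t; exact: rderZ.
Qed.

Lemma perint_le f g : continuous f -> continuous g -> (forall t, f t <= g t) ->
  perint f <= perint g.
Proof.
move=> cf cg fg; have [F dF] := primitive_exists cf; have [G dG] := primitive_exists cg.
rewrite (perintE cf dF) (perintE cg dG).
have : G 0 - F 0 <= G (2 * pi) - F (2 * pi).
  apply: (@rder_ge0 _ (fun t => G t - F t) (fun t => g t - f t)).
  - exact: ltW twopi_gt0.
  - by move=> s _; exact: rderB.
  - by move=> s _; rewrite subr_ge0.
lra.
Qed.

Lemma perint_cst c : perint (fun=> c) = c * (2 * pi).
Proof.
rewrite (@perintE _ (fun t => c * t + 0)); first ring.
- by move=> t; exact: cvg_cst.
- by move=> t; exact: rder_affine.
Qed.

(** For a primitive [F] of a periodic function, [F (t + 2 * pi) - F t] has zero derivative, so it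
    does not depend on [t]. *)
Lemma perint_shift f h : continuous f -> (forall t, f (t + 2 * pi) = f t) ->
  perint (fun t => f (t + h)) = perint f.
Proof.
move=> cf per; have [F dF] := primitive_exists cf.
rewrite (perintE cf dF) (@perintE _ (fun t => F (t + h))); last 2 first.
- move=> t; apply: continuous_comp; last exact: cf.
  by apply: continuousD; [exact: cvg_id|exact: cvg_cst].
- by move=> t; apply: rder_shift.
have d s : rder (fun t => F (t + 2 * pi) - F t) s 0.
  rewrite -(subrr (f s)); apply: rderB => //.
  by apply: rder_shift; rewrite -per.
have := is_derive_0_is_cst h 0 d; rewrite /= !add0r => <-; congr (F _ - _); exact: addrC.
Qed.

Lemma lip_continuous f K : (forall x h, `|f (x + h) - f x| <= K * `|h|) ->
  continuous f.
Proof.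
move=> hf x; apply/cvgrPdist_le => e e0.
have K0 : 0 < `|K| + 1 by rewrite ltr_wpDl.
have r0 : 0 < e / (`|K| + 1) by exact: divr_gt0.
near=> y; have := hf x (y - x); rewrite (addrC x) subrK distrC => h.
have xy : `|x - y| < e / (`|K| + 1) by near: y; exact: (@nbhsx_ballx _ R^o).
apply: le_trans h _; rewrite distrC.
move: xy; rewrite ltr_pdivlMr// => xy.
have := ler_wpM2r (normr_ge0 (x - y)) (ler_norm K).
have := normr_ge0 (x - y); lra.
Unshelve. all: by end_near. Qed.

End PeriodIntegral.

(** * Iterated integrals of bounded Lipschitz functions *)

Section TorusIntegral.
Variable R : realType.

(** A class closed under sums, products and slices, in which the inner integral is continuous in the
    remaining variable; iterated integrals are thus always integrals of continuous functions of one
    variable. *)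
Definition rlip n (F : 'rV[R]_n -> R) := exists K : R,
  (forall x, `|F x| <= K) /\
  forall x i h, `|F (x + h *: 'e_i) - F x| <= K * `|h|.

Definition rper n (F : 'rV[R]_n -> R) :=
  forall i x, F (x + (2 * pi) *: 'e_i) = F x.

Lemma rlip_cst n c : rlip (fun _ : 'rV[R]_n => c).
Proof.
exists `|c|; split=> // x i h; rewrite subrr normr0 mulr_ge0//.
Qed.

Lemma rlipD n (F G : 'rV[R]_n -> R) : rlip F -> rlip G -> rlip (fun x => F x + G x).
Proof.
move=> [K [k1 k2]] [L [l1 l2]]; exists (K + L); split=> [x|x i h].
  by apply: le_trans (ler_normD _ _) _; exact: lerD.
rewrite opprD addrACA mulrDl; apply: le_trans (ler_normD _ _) _; exact: lerD.
Qed.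

Lemma rlipM n (F G : 'rV[R]_n -> R) : rlip F -> rlip G -> rlip (fun x => F x * G x).
Proof.
move=> [K [k1 k2]] [L [l1 l2]]; exists (2 * K * L + K * L); split=> [x|x i h].
  have : `|F x * G x| <= K * L by rewrite normrM ler_pM.
  have : 0 <= K * L by apply: le_trans (_ : `|F x * G x| <= _); rewrite // normrM ler_pM.
  lra.
have -> : F (x + h *: 'e_i) * G (x + h *: 'e_i) - F x * G x =
   (F (x + h *: 'e_i) - F x) * G (x + h *: 'e_i) + F x * (G (x + h *: 'e_i) - G x).
  by ring.
apply: le_trans (ler_normD _ _) _; rewrite !normrM.
have h1 : `|F (x + h *: 'e_i) - F x| * `|G (x + h *: 'e_i)| <= K * `|h| * L.
  by rewrite ler_pM.
have h2 : `|F x| * `|G (x + h *: 'e_i) - G x| <= K * (L * `|h|) by rewrite ler_pM.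
have K0 : 0 <= K * L * `|h|.
  by have := mulr_ge0 (normr_ge0 (F x)) (normr_ge0 (G (x + h *: 'e_i) - G x)); lra.
lra.
Qed.

Lemma rlipZ n c (F : 'rV[R]_n -> R) : rlip F -> rlip (fun x => c * F x).
Proof. by move=> h; apply: rlipM => //; exact: rlip_cst. Qed.

Lemma rlipN n (F : 'rV[R]_n -> R) : rlip F -> rlip (fun x => - F x).
Proof.
by move=> h; rewrite (_ : (fun x => _) = fun x => -1 * F x);
  [exact: rlipZ|apply/funext => x; rewrite mulN1r].
Qed.

Lemma row_mx_shift0 m (t h : R) (y : 'rV[R]_m) :
  row_mx (const_mx t : 'rV[R]_1) y + h *: ('e_ord0 : 'rV[R]_m.+1) =
  row_mx (const_mx (t + h)) y.
Proof.
apply/rowP => j; rewrite !mxE; case: splitP => k jk.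
  by rewrite !mxE eqxx -(inj_eq val_inj) /= jk (ord1 k) mulr1.
by rewrite eqxx -(inj_eq val_inj) /= jk mulr0 addr0.
Qed.

Lemma row_mx_shiftS m (t h : R) (y : 'rV[R]_m) (i : 'I_m) :
  row_mx (const_mx t : 'rV[R]_1) y + h *: ('e_(lift ord0 i) : 'rV[R]_m.+1) =
  row_mx (const_mx t) (y + h *: 'e_i).
Proof.
apply/rowP => j; rewrite !mxE; case: splitP => k jk.
  by rewrite !mxE eqxx -(inj_eq val_inj) /= jk (ord1 k) mulr0 addr0.
by rewrite !mxE eqxx -(inj_eq val_inj) /= jk /bump leq0n !add1n eqSS (inj_eq val_inj).
Qed.

Definition slice m (F : 'rV[R]_m.+1 -> R) (t : R) : 'rV[R]_m -> R :=
  fun y => F (row_mx (const_mx t : 'rV[R]_1) y).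

Lemma rlip_slice m (F : 'rV[R]_m.+1 -> R) t : rlip F -> rlip (slice F t).
Proof.
move=> [K [k1 k2]]; exists K; split=> [x|x i h]; first exact: k1.
by rewrite /slice -row_mx_shiftS.
Qed.

(** The four properties go through one induction on the dimension, because the continuity of the
    inner integral uses all of them one dimension lower. *)
Let linear_monotone n :=
  [/\ forall F G : 'rV[R]_n -> R, rlip F -> rlip G ->
        tint (fun x => F x + G x) = tint F + tint G,
      forall c (F : 'rV[R]_n -> R), rlip F -> tint (fun x => c * F x) = c * tint F,
      forall F G : 'rV[R]_n -> R, rlip F -> rlip G -> (forall x, F x <= G x) ->
        tint F <= tint G &
      forall c, tint (fun _ : 'rV[R]_n => c) = c * (2 * pi) ^+ n].

Let tint_slice_continuous m (F : 'rV[R]_m.+1 -> R) : linear_monotone m -> rlip F ->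
  continuous (fun t => tint (slice F t)).
Proof.
move=> [aD aZ aM aC] hF; have [K [k1 k2]] := hF.
apply: (@lip_continuous _ _ (K * (2 * pi) ^+ m)) => t h.
have d : tint (fun y => slice F (t + h) y + -1 * slice F t y) =
    tint (slice F (t + h)) - tint (slice F t).
  by rewrite aD ?aZ ?mulN1r//; try apply: rlipZ; exact: rlip_slice.
have hl : rlip (fun y => slice F (t + h) y + -1 * slice F t y).
  by apply: rlipD; [|apply: rlipZ]; exact: rlip_slice.
have b y : `|slice F (t + h) y + -1 * slice F t y| <= K * `|h|.
  by rewrite mulN1r /slice -row_mx_shift0; exact: k2.
rewrite -d ler_norml mulrAC -mulNr -!aC; apply/andP; split; apply: aM => //;
  try exact: rlip_cst; by move=> y; have := b y; rewrite ler_norml => /andP[].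
Qed.

Let tintS m (F : 'rV[R]_m.+1 -> R) : tint F = perint (fun t => tint (slice F t)).
Proof. by []. Qed.

Let tint_props n : linear_monotone n.
Proof.
elim: n => [|m IH].
  split=> //= c; by rewrite expr0 mulr1.
have [aD aZ aM aC] := IH; split.
- move=> F G hF hG; rewrite !tintS -perintD; try exact: tint_slice_continuous.
  by congr perint; apply/funext => t; rewrite -aD//; exact: rlip_slice.
- move=> c F hF; rewrite !tintS -perintZ; last exact: tint_slice_continuous.
  by congr perint; apply/funext => t; rewrite -aZ//; exact: rlip_slice.
- move=> F G hF hG FG; rewrite !tintS; apply: perint_le;
    try exact: tint_slice_continuous.
  by move=> t; apply: aM; [exact: rlip_slice|exact: rlip_slice|move=> x; exact: FG].
- move=> c; rewrite tintS /slice (_ : (fun t => _) = fun=> c * (2 * pi) ^+ m).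
    by rewrite perint_cst exprSr -[LHS]mulrA.
  by apply/funext => t; exact: aC.
Qed.

Section Mean.
Variable n : nat.
Implicit Types F G : 'rV[R]_n -> R.

Lemma tintD F G : rlip F -> rlip G -> tint (fun x => F x + G x) = tint F + tint G.
Proof. by case: (tint_props n) => h _ _ _; exact: h. Qed.
Lemma tintZ c F : rlip F -> tint (fun x => c * F x) = c * tint F.
Proof. by case: (tint_props n) => _ h _ _; exact: h. Qed.
Lemma tint_le F G : rlip F -> rlip G -> (forall x, F x <= G x) -> tint F <= tint G.
Proof. by case: (tint_props n) => _ _ h _; exact: h. Qed.
Lemma tint_cst c : tint (fun _ : 'rV[R]_n => c) = c * (2 * pi) ^+ n.
Proof. by case: (tint_props n) => _ _ _ h; exact: h. Qed.
End Mean.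

Lemma tint_shift n (F : 'rV[R]_n -> R) i h : rlip F -> rper F ->
  tint (fun x => F (x + h *: 'e_i)) = tint F.
Proof.
elim: n F i => [|m IH] F i hF pF; first by case: i.
case: (unliftP ord0 i) => [j ->|->].
  rewrite !tintS; congr perint; apply/funext => t.
  rewrite -(IH (slice F t) j) //; last 2 first.
  - exact: rlip_slice.
  - by move=> k x; rewrite /slice -row_mx_shiftS pF.
  by congr tint; apply/funext => y; rewrite /slice row_mx_shiftS.
rewrite !tintS -(@perint_shift _ (fun t => tint (slice F t)) h).
- congr perint; apply/funext => t; congr tint; apply/funext => y.
  by rewrite /slice row_mx_shift0.
- exact: tint_slice_continuous (tint_props m) hF.
- move=> t; congr tint; apply/funext => y.
  by rewrite /slice -row_mx_shift0 pF.
Qed.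

End TorusIntegral.

Section BoundedLipschitz.
Variables (R : realType) (n : nat).
Implicit Types (f g : 'rV[R]_n -> R[i]) (x : 'rV[R]_n) (c : R[i]).

Definition BL f := exists K : R, (forall x, cabs (f x) <= K) /\
  forall x i h, cabs (f (x + h *: 'e_i) - f x) <= K * `|h|.

Lemma BL_re f : BL f -> rlip (reF f).
Proof.
move=> [K [k1 k2]]; exists K; split=> [x|x i h].
  exact: le_trans (Re_le_cabs _) (k1 x).
by apply: le_trans (k2 x i h); rewrite /reF -cReN -cReD; exact: Re_le_cabs.
Qed.
Lemma BL_im f : BL f -> rlip (imF f).
Proof.
move=> [K [k1 k2]]; exists K; split=> [x|x i h].
  exact: le_trans (Im_le_cabs _) (k1 x).
by apply: le_trans (k2 x i h); rewrite /imF -cImN -cImD; exact: Im_le_cabs.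
Qed.
Lemma BL_cst c : BL (fun=> c).
Proof.
by exists (cabs c); split=> // x i h; rewrite subrr cabs0 mulr_ge0 ?cabs_ge0.
Qed.
Lemma BL_real (F : 'rV[R]_n -> R) : rlip F -> BL (fun x => (F x)%:C%C).
Proof.
move=> [K [k1 k2]]; exists K; split=> [x|x i h]; first by rewrite cabsR.
by rewrite -rmorphB cabsR.
Qed.
Lemma BLD f g : BL f -> BL g -> BL (fun x => f x + g x).
Proof.
move=> [K [k1 k2]] [L [l1 l2]]; exists (K + L); split=> [x|x i h].
  by apply: le_trans (cabsD _ _) _; exact: lerD.
rewrite opprD addrACA mulrDl; apply: le_trans (cabsD _ _) _; exact: lerD.
Qed.
Lemma BLM f g : BL f -> BL g -> BL (fun x => f x * g x).
Proof.
move=> [K [k1 k2]] [L [l1 l2]]; exists (2 * K * L + K * L); split=> [x|x i h].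
  have : cabs (f x * g x) <= K * L by rewrite cabsM ler_pM ?cabs_ge0.
  have : 0 <= K * L.
    by apply: le_trans (_ : cabs (f x * g x) <= _); rewrite ?cabs_ge0// cabsM ler_pM ?cabs_ge0.
  lra.
have -> : f (x + h *: 'e_i) * g (x + h *: 'e_i) - f x * g x =
   (f (x + h *: 'e_i) - f x) * g (x + h *: 'e_i) + f x * (g (x + h *: 'e_i) - g x).
  by ring.
apply: le_trans (cabsD _ _) _; rewrite !cabsM.
have h1 : cabs (f (x + h *: 'e_i) - f x) * cabs (g (x + h *: 'e_i)) <= K * `|h| * L.
  by rewrite ler_pM ?cabs_ge0.
have h2 : cabs (f x) * cabs (g (x + h *: 'e_i) - g x) <= K * (L * `|h|).
  by rewrite ler_pM ?cabs_ge0.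
have K0 : 0 <= K * L * `|h|.
  by have := mulr_ge0 (cabs_ge0 (f x)) (cabs_ge0 (g (x + h *: 'e_i) - g x)); lra.
lra.
Qed.
Lemma BLZ c f : BL f -> BL (fun x => c * f x).
Proof. by move=> h; apply: BLM => //; exact: BL_cst. Qed.
Lemma BLN f : BL f -> BL (fun x => - f x).
Proof.
by move=> h; rewrite (_ : (fun x => _) = fun x => -1 * f x);
  [exact: BLZ|apply/funext => x; rewrite mulN1r].
Qed.
Lemma BLB f g : BL f -> BL g -> BL (fun x => f x - g x).
Proof. by move=> hf hg; apply: BLD => //; exact: BLN. Qed.
Lemma BL_sum (J : Type) (r : seq J) (F : J -> 'rV[R]_n -> R[i]) :
  (forall j, BL (F j)) -> BL (fun x => \sum_(j <- r) F j x).
Proof.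
move=> h; elim: r => [|j r IH].
  by rewrite (_ : (fun x => _) = fun=> 0); [exact: BL_cst|apply/funext => x; rewrite big_nil].
rewrite (_ : (fun x => _) = fun x => F j x + \sum_(j <- r) F j x).
  exact: BLD.
by apply/funext => x; rewrite big_cons.
Qed.
Lemma BL_shift f y : BL f -> BL (fun x => f (x + y)).
Proof.
move=> [K [k1 k2]]; exists K; split=> [x|x i h]; first exact: k1.
by rewrite addrAC; exact: k2.
Qed.

(* Locked: unification must not unfold the integral. *)
Fact mean_key : unit. Proof. exact: tt. Qed.
Definition mean f : R[i] := locked_with mean_key (((2 * pi) ^- n)%:C%C * cint f).
Lemma meanE f : mean f = ((2 * pi) ^- n)%:C%C * cint f.
Proof. exact: locked_withE. Qed.

Let tpn : (2 * pi) ^+ n != 0 :> R.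
Proof. by rewrite expf_neq0// gt_eqF// twopi_gt0. Qed.

Lemma cint_mean f : cint f = ((2 * pi) ^+ n)%:C%C * mean f.
Proof. by rewrite !meanE mulrA -rmorphM /= divff// mul1r. Qed.

Lemma cintD f g : BL f -> BL g -> cint (fun x => f x + g x) = cint f + cint g.
Proof.
move=> hf hg; rewrite /cint.
rewrite (_ : reF (fun x => f x + g x) = fun x => reF f x + reF g x); last first.
  by apply/funext => x; rewrite /reF cReD.
rewrite (_ : imF (fun x => f x + g x) = fun x => imF f x + imF g x); last first.
  by apply/funext => x; rewrite /imF cImD.
by rewrite !tintD//; [exact: BL_im|exact: BL_im|exact: BL_re|exact: BL_re].
Qed.

Lemma cintZ c f : BL f -> cint (fun x => c * f x) = c * cint f.
Proof.
move=> hf; have hr := BL_re hf; have hi := BL_im hf; rewrite /cint.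
rewrite (_ : reF (fun x => c * f x) = fun x => complex.Re c * reF f x + (- complex.Im c) * imF f x); last first.
  by apply/funext => x; rewrite /reF cReM mulNr.
rewrite (_ : imF (fun x => c * f x) = fun x => complex.Re c * imF f x + complex.Im c * reF f x); last first.
  by apply/funext => x; rewrite /imF cImM.
rewrite !tintD ?tintZ//; try exact: rlipZ.
by apply: complex_ext; rewrite !ReImE /=; ring.
Qed.

Lemma meanD f g : BL f -> BL g -> mean (fun x => f x + g x) = mean f + mean g.
Proof. by move=> hf hg; rewrite !meanE cintD// mulrDr. Qed.
Lemma meanZ c f : BL f -> mean (fun x => c * f x) = c * mean f.
Proof. by move=> hf; rewrite !meanE cintZ// mulrCA. Qed.
Lemma meanB f g : BL f -> BL g -> mean (fun x => f x - g x) = mean f - mean g.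
Proof.
move=> hf hg; have -> : (fun x => f x - g x) = fun x => f x + -1 * g x.
  by apply/funext => x; rewrite mulN1r.
by rewrite meanD ?meanZ ?mulN1r//; exact: BLZ.
Qed.
Lemma mean_sum (J : Type) (r : seq J) (F : J -> 'rV[R]_n -> R[i]) :
  (forall j, BL (F j)) -> mean (fun x => \sum_(j <- r) F j x) = \sum_(j <- r) mean (F j).
Proof.
move=> h; elim: r => [|j r IH].
  rewrite big_nil -[RHS](mul0r (mean (fun=> 0))) -meanZ; last exact: BL_cst.
  by congr mean; apply/funext => x; rewrite big_nil mulr0.
rewrite big_cons -IH -meanD//; last exact: BL_sum.
by congr mean; apply/funext => x; rewrite big_cons.
Qed.
Lemma mean_real (F : 'rV[R]_n -> R) :
  mean (fun x => (F x)%:C%C) = ((2 * pi) ^- n * tint F)%:C%C.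
Proof.
rewrite !meanE /cint rmorphM /=; congr (_ * _).
apply: complex_ext => //=; rewrite (_ : imF _ = fun=> 0) ?tint_cst ?mul0r//.
Qed.
Lemma mean1 : mean (fun=> 1) = 1.
Proof. by rewrite (mean_real (fun=> 1)) tint_cst mul1r mulVf. Qed.

Lemma mean_le f K : BL f -> (forall x, cabs (f x) <= K) -> cabs (mean f) <= 2 * K.
Proof.
move=> hf hK; have p : 0 < (2 * pi) ^+ n :> R by rewrite exprn_gt0// twopi_gt0.
have b (F : 'rV[R]_n -> R) : rlip F -> (forall x, `|F x| <= K) ->
    `|tint F| <= K * (2 * pi) ^+ n.
  move=> hF FK; rewrite ler_norml -mulNr -!tint_cst; apply/andP; split;
    apply: tint_le => //; try exact: rlip_cst;
    by move=> x; have := FK x; rewrite ler_norml => /andP[].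
rewrite !meanE cabsM cabsR ger0_norm ?invr_ge0 ?(ltW p)// mulrC ler_pdivrMr//.
apply: le_trans (cabs_le_ReIm _) _ => /=.
have := b _ (BL_re hf) (fun x => le_trans (Re_le_cabs _) (hK x)).
have := b _ (BL_im hf) (fun x => le_trans (Im_le_cabs _) (hK x)).
lra.
Qed.

Lemma mean_shift f i h : BL f -> periodicT f -> mean (fun x => f (x + h *: 'e_i)) = mean f.
Proof.
move=> hf pf; rewrite !meanE /cint; congr (_ * (_ +i* _)%C).
  apply: (tint_shift i h (BL_re hf)) => j x; by rewrite /reF pf.
apply: (tint_shift i h (BL_im hf)) => j x; by rewrite /imF pf.
Qed.

Definition line f x i : R -> R[i] := fun h => f (x + h *: 'e_i).

Lemma cder_line f f' i : (forall x, cder (line f x i) 0 (f' x)) ->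
  forall x s, cder (line f x i) s (f' (x + s *: 'e_i)).
Proof.
move=> h x s; have := h (x + s *: 'e_i); rewrite -{1}(subrr s) => /cder_shift.
by apply: cder_ext => t; rewrite /line -addrA -scalerDl addrCA subrr addr0.
Qed.

Lemma line_lip f f' i K : (forall x, cder (line f x i) 0 (f' x)) ->
  (forall x, cabs (f' x) <= K) ->
  forall x h, cabs (f (x + h *: 'e_i) - f x) <= 2 * K * `|h|.
Proof.
move=> d hK; have pos x h : 0 <= h -> cabs (f (x + h *: 'e_i) - f x) <= 2 * K * h.
  move=> h0; have := @cder_lip _ (line f x i) _ 0 h K h0 (fun s _ => cder_line d x s).
  by rewrite /line scale0r addr0 subr0; apply => s _; exact: hK.
move=> x h; case: (leP 0 h) => h0; first by rewrite ger0_norm// pos.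
have h1 : 0 <= - h by lra.
have := pos (x + h *: 'e_i) (- h) h1.
by rewrite -addrA -scalerDl subrr scale0r addr0 ltr0_norm// cabsC.
Qed.

Lemma line_taylor f f' i K : (forall x, cder (line f x i) 0 (f' x)) ->
  (forall x h, cabs (f' (x + h *: 'e_i) - f' x) <= K * `|h|) ->
  forall x h, 0 <= h ->
  cabs (f (x + h *: 'e_i) - f x - h%:C%C * f' x) <= 2 * K * h ^+ 2.
Proof.
move=> d hK x h h0; have K0 : 0 <= K.
  have := le_trans (cabs_ge0 _) (hK x 1); by rewrite normr1 mulr1.
have ds s : cder (fun s => line f x i s - s%:C%C * f' x) s
    (f' (x + s *: 'e_i) - f' x).
  apply: cder_eq (cderB (cder_line d x s)
    (cderM (cder_real (rder_id s)) (cder_cst (f' x) s))) _.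
  by rewrite mulr0 addr0 mul1r.
have := @cder_lip _ _ _ 0 h (K * h) h0 (fun s _ => ds s).
rewrite /line scale0r addr0 mul0r !subr0 => H.
have -> : 2 * K * h ^+ 2 = 2 * (K * h) * h by ring.
rewrite addrAC; apply: H => s /andP[s0 sh]; apply: le_trans (hK x s) _.
by rewrite ger0_norm// ler_wpM2l.
Qed.

(** No differentiation under the integral: a difference of translates of [f] has mean zero, and it
    differs from [h * f'] by a Taylor remainder of order [h ^+ 2], so the mean of [f'] is of order
    [h] for every [h > 0]. *)
Lemma mean_pd f f' i : BL f -> periodicT f -> BL f' ->
  (forall x, cder (line f x i) 0 (f' x)) -> mean f' = 0.
Proof.
move=> hf pf hf' d; have [K [_ k2]] := hf'.
have key h : 0 < h -> cabs (mean f') <= 4 * K * h.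
  move=> h0; pose r x := f (x + h *: 'e_i) - f x - h%:C%C * f' x.
  have hr : BL r.
    by apply: BLB; [apply: BLB => //; exact: BL_shift|exact: BLZ].
  have : h%:C%C * mean f' = - mean r.
    rewrite /r meanB; [|apply: BLB => //; exact: BL_shift|exact: BLZ].
    rewrite meanB//; last exact: BL_shift.
    by rewrite mean_shift// subrr sub0r opprK meanZ.
  move=> /(congr1 (@cabs R)); rewrite cabsM cabsR cabsN gtr0_norm// => e.
  have := mean_le hr (fun x => line_taylor d (fun x h => k2 x i h) x (ltW h0)).
  rewrite -e => H; rewrite -(ler_pM2l h0); lra.
apply: cabs_eq0; apply/eqP; rewrite eq_le cabs_ge0 andbT; apply/ler_addgt0Pl => e e0.
have K0 : 0 < 4 * `|K| + 1 by have := normr_ge0 K; lra.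
apply: le_trans (key _ (divr_gt0 e0 K0)) _; rewrite mulrA ler_pdivrMr//.
have := ler_norm K; nra.
Qed.

End BoundedLipschitz.

(** * Characters and Fourier coefficients *)

Section Exponentials.
Variables (R : realType) (n : nat).
Implicit Types (x : 'rV[R]_n) (y z : 'rV[int]_n).

Definition dot z x : R := \sum_i (z 0 i)%:~R * x 0 i.
Definition ee z x : R[i] := cis (dot z x).

Lemma dotDl y z x : dot (y + z) x = dot y x + dot z x.
Proof.
by rewrite /dot -big_split; apply: eq_bigr => i _; rewrite mxE rmorphD /= mulrDl.
Qed.
Lemma dot_line z x i h : dot z (x + h *: 'e_i) = dot z x + (z 0 i)%:~R * h.
Proof.
rewrite /dot (eq_bigr (fun j => (z 0 j)%:~R * x 0 j + (z 0 j)%:~R * (h * (j == i)%:R))).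
  rewrite big_split /=; congr (_ + _); rewrite (bigD1 i)//= eqxx mulr1 big1 ?addr0//.
  by move=> j /negbTE ->; rewrite !mulr0.
by move=> j _; rewrite !mxE eqxx mulrDr.
Qed.
Lemma eeD y z x : ee (y + z) x = ee y x * ee z x.
Proof. by rewrite /ee dotDl cisD. Qed.
Lemma ee0 x : ee 0 x = 1.
Proof. by rewrite /ee /dot big1 ?cis0// => i _; rewrite mxE mul0r. Qed.
Lemma cabs_ee z x : cabs (ee z x) = 1. Proof. exact: cabs_cis. Qed.
Lemma periodic_ee z : periodicT (ee z).
Proof. by move=> i x; rewrite /ee dot_line cisD mulrC (mulrC _%:~R) cis_2pi_int mul1r. Qed.
Lemma cder_ee z x i : cder (line (ee z) x i) 0 ('i%C * (z 0 i)%:~R * ee z x).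
Proof.
have h : rder (fun h => (z 0 i)%:~R * h + dot z x) 0 (z 0 i)%:~R by exact: rder_affine.
apply: cder_ext (cder_eq (cder_cis h) _) => [s|].
  by rewrite /line /ee dot_line addrC.
by rewrite mulr0 add0r rmorph_int.
Qed.
Lemma cabs_int (k : int) : cabs (k%:~R : R[i]) = `|k|%:~R.
Proof. by rewrite -(rmorph_int (real_complex R)) cabsR intr_norm. Qed.
Lemma cabs_ee_sub z x i h : cabs (ee z (x + h *: 'e_i) - ee z x) <= 2 * nz R z * `|h|.
Proof.
apply: (line_lip (fun x => cder_ee z x i)) => {}x.
by rewrite !cabsM cabsi cabs_ee mul1r mulr1 cabs_int; exact: le_nz.
Qed.
Lemma BL_ee z : BL (ee z).
Proof.
exists (1 + 2 * nz R z); split=> [x|x i h].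
  by rewrite cabs_ee lerDl mulr_ge0// nz_ge0.
apply: le_trans (cabs_ee_sub z x i h) _.
by rewrite ler_wpM2r// lerDr.
Qed.

Lemma mean_ee z : mean (ee z) = (z == 0)%:R.
Proof.
case: eqVneq => [->|z0].
  by rewrite (_ : ee 0 = fun=> 1) ?mean1//; apply/funext => x; exact: ee0.
have [i hi] : exists i, z 0 i != 0.
  apply: contrapT => h; move/eqP: z0; apply; apply/rowP => i; rewrite mxE.
  by apply/eqP; apply: contrapT => hi; apply: h; exists i; exact/negP.
(* Up to the nonzero factor [i z_i], the character is its own derivative in direction [i], hence has
   mean zero. *)
have := mean_pd (BL_ee z) (periodic_ee z) (BLZ _ (BL_ee z)) (fun x => cder_ee z x i).
rewrite meanZ; last exact: BL_ee.
move/eqP; rewrite mulf_eq0 => /orP[|/eqP //].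
rewrite mulf_eq0 intr_eq0 (negbTE hi) orbF => /eqP h.
by have := cabsi R; rewrite h cabs0 => /esym/eqP; rewrite oner_eq0.
Qed.

Definition fc (f : 'rV[R]_n -> R[i]) z : R[i] := mean (fun x => f x * ee (- z) x).

Lemma fcD f g z : BL f -> BL g -> fc (fun x => f x + g x) z = fc f z + fc g z.
Proof.
move=> hf hg; rewrite /fc -meanD; try by apply: BLM => //; exact: BL_ee.
by congr mean; apply/funext => x; rewrite mulrDl.
Qed.
Lemma fcZ c f z : BL f -> fc (fun x => c * f x) z = c * fc f z.
Proof.
move=> hf; rewrite /fc -meanZ; last by apply: BLM => //; exact: BL_ee.
by congr mean; apply/funext => x; rewrite mulrA.
Qed.
Lemma fcB f g z : BL f -> BL g -> fc (fun x => f x - g x) z = fc f z - fc g z.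
Proof.
move=> hf hg; have -> : (fun x => f x - g x) = fun x => f x + -1 * g x.
  by apply/funext => x; rewrite mulN1r.
by rewrite fcD ?fcZ ?mulN1r//; exact: BLZ.
Qed.
Lemma fc_sum (J : Type) (r : seq J) (F : J -> 'rV[R]_n -> R[i]) z :
  (forall j, BL (F j)) -> fc (fun x => \sum_(j <- r) F j x) z = \sum_(j <- r) fc (F j) z.
Proof.
move=> h; rewrite /fc -mean_sum; last by move=> j; apply: BLM => //; exact: BL_ee.
by congr mean; apply/funext => x; rewrite mulr_suml.
Qed.
Lemma fc_ee y z : fc (ee y) z = (y == z)%:R.
Proof.
rewrite /fc -subr_eq0 -mean_ee; congr mean.
by apply/funext => x; rewrite eeD.
Qed.
Lemma fc_le f z K : BL f -> (forall x, cabs (f x) <= K) -> cabs (fc f z) <= 2 * K.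
Proof.
move=> hf h; apply: mean_le; first by apply: BLM => //; exact: BL_ee.
by move=> x; rewrite cabsM cabs_ee mulr1.
Qed.
Lemma fc_pd f f' i z : BL f -> periodicT f -> BL f' ->
  (forall x, cder (line f x i) 0 (f' x)) -> fc f' z = 'i%C * (z 0 i)%:~R * fc f z.
Proof.
move=> hf pf hf' d.
have hE := BL_ee (- z).
have := @mean_pd R n (fun x => f x * ee (- z) x)
  (fun x => f' x * ee (- z) x + ('i%C * (- z 0 i)%:~R) * (f x * ee (- z) x)) i
  (BLM hf hE) _ _ _.
rewrite meanD ?meanZ; try exact: BLM; last by apply: BLZ; exact: BLM.
move=> H; have {H} : mean (fun x => f' x * ee (- z) x) +
   'i%C * (- z 0 i)%:~R * mean (fun x => f x * ee (- z) x) = 0.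
  apply: H.
  - by move=> j x; rewrite pf periodic_ee.
  - by apply: BLD; [exact: BLM|apply: BLZ; exact: BLM].
  - move=> x; apply: cder_eq (cderM (d x) (cder_ee (- z) x i)) _.
    rewrite /line scale0r addr0 mxE; ring.
move/eqP; rewrite addr_eq0 => /eqP; rewrite /fc => ->.
by rewrite rmorphN /= mulrN mulNr opprK.
Qed.

End Exponentials.

Section Periods.
Variable R : realType.

Lemma nearest_period (t : R) : exists k : int, `|t - 2 * pi * k%:~R| <= pi.
Proof.
have p := @twopi_gt0 R; pose k := Num.floor ((t + pi) / (2 * pi)); exists k.
have h1 := floor_le_tmp ((t + pi) / (2 * pi)).
have h2 := floorD1_gt ((t + pi) / (2 * pi)).
move: h1 h2; rewrite -/k ler_pdivlMr// ltr_pdivrMr// rmorphD /= => h1 h2.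
by rewrite ler_norml; apply/andP; split; lra.
Qed.

End Periods.

(** * A function is determined by its Fourier coefficients *)

Section FourierUniqueness.
Variables (R : realType) (n : nat).
Implicit Types (x : 'rV[R]_n) (r : seq 'I_n).

Lemma mean_pd_real (F F' : 'rV[R]_n -> R) i : rlip F -> rper F -> rlip F' ->
  (forall x, rder (fun h => F (x + h *: 'e_i)) 0 (F' x)) -> tint F' = 0.
Proof.
move=> hF pF hF' d.
have : mean (fun x => (F' x)%:C%C) = 0.
  apply: (mean_pd (f := fun x => (F x)%:C%C) (i := i)); try exact: BL_real.
    by move=> j x; rewrite pF.
  by move=> x; exact: cder_real (d x).
rewrite mean_real => /complexI/eqP; rewrite mulf_eq0 => /orP[|/eqP //].
by rewrite invr_eq0 expf_eq0 gt_eqF ?twopi_gt0// andbF.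
Qed.

(* If all Fourier coefficients of f vanish, so do its integrals against the trigonometric polynomials
   [ker r], which concentrate at x0 as the multiplicities in r grow. *)
Section Kernel.
Variable x0 : 'rV[R]_n.

Let co i x := cos (x 0 i - x0 0 i).
Let sn i x := sin (x 0 i - x0 0 i).
(** The squared cosine of half the angle from [x0] in direction [i]: between 0 and 1, and equal to 1
    only where the angle is a multiple of [2 * pi]. *)
Let kap i x := (1 + co i x) / 2.
Let ker r x := \prod_(i <- r) kap i x.

Let unit_z i : 'rV[int]_n := delta_mx 0 i.

Let dot_unit i x : dot (unit_z i) x = x 0 i.
Proof.
rewrite /dot (bigD1 i)//= mxE !eqxx mul1r big1 ?addr0// => j /negbTE ji.
by rewrite mxE ji andbF mul0r.
Qed.

Let wE i x : cis (- x0 0 i) * ee (unit_z i) x = (co i x +i* sn i x)%C.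
Proof. by rewrite /ee dot_unit -cisD addrC. Qed.

Let rlip_co i : rlip (co i).
Proof.
have -> : co i = reF (fun x => cis (- x0 0 i) * ee (unit_z i) x).
  by apply/funext => x; rewrite /reF wE.
by apply/BL_re/BLZ/BL_ee.
Qed.
Let rlip_sn i : rlip (sn i).
Proof.
have -> : sn i = imF (fun x => cis (- x0 0 i) * ee (unit_z i) x).
  by apply/funext => x; rewrite /imF wE.
by apply/BL_im/BLZ/BL_ee.
Qed.
Let rlip_kap i : rlip (kap i).
Proof.
have -> : kap i = fun x => 2^-1 * (1 + co i x) by apply/funext => x; rewrite mulrC.
by apply: rlipZ; apply: rlipD => //; exact: rlip_cst.
Qed.
Let rlip_ker r : rlip (ker r).
Proof.
elim: r => [|i r IH].
  by rewrite (_ : ker _ = fun=> 1); [exact: rlip_cst|apply/funext => x; rewrite /ker big_nil].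
rewrite (_ : ker _ = fun x => kap i x * ker r x); first exact: rlipM.
by apply/funext => x; rewrite /ker big_cons.
Qed.

Let kerS i r x : ker (i :: r) x = kap i x * ker r x.
Proof. by rewrite /ker big_cons. Qed.

Let kap01 i x : 0 <= kap i x <= 1.
Proof. by rewrite /kap /co; have := cos_geN1 (x 0 i - x0 0 i); have := cos_le1 (x 0 i - x0 0 i); lra. Qed.

Let ker_ge0 r x : 0 <= ker r x.
Proof. by apply: prodr_ge0 => i _; case/andP: (kap01 i x). Qed.

Let coord_line x i j h : (x + h *: 'e_j) 0 i = x 0 i + h * (i == j)%:R.
Proof. by rewrite !mxE eqxx. Qed.

Let per_w i : rper (co i) /\ rper (sn i).
Proof.
split=> j x; rewrite /co /sn coord_line; case: (i == j); rewrite ?mulr0 ?addr0 ?mulr1//;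
  by rewrite addrAC mulr_natl ?cosD2pi ?sinD2pi.
Qed.

Let per_ker r : rper (ker r).
Proof.
move=> j x; rewrite /ker; apply: eq_bigr => i _; rewrite /kap.
by have [-> _] := per_w i.
Qed.

Let d_arg x i j : rder (fun h => (x + h *: 'e_j) 0 i - x0 0 i) 0 (i == j)%:R.
Proof.
apply: rder_ext (rder_affine (i == j)%:R (x 0 i - x0 0 i) 0) => h.
by rewrite coord_line mulrC; ring.
Qed.

Let d_co x i j : rder (fun h => co i (x + h *: 'e_j)) 0 (- sn i x * (i == j)%:R).
Proof.
apply: rder_eq (rder_comp (d_arg x i j) (is_derive_cos _)) _.
by rewrite coord_line mul0r addr0.
Qed.
Let d_sn x i j : rder (fun h => sn i (x + h *: 'e_j)) 0 (co i x * (i == j)%:R).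
Proof.
apply: rder_eq (rder_comp (d_arg x i j) (is_derive_sin _)) _.
by rewrite coord_line mul0r addr0.
Qed.

Let at0 (F : 'rV[R]_n -> R) x j : F (x + 0 *: 'e_j) = F x.
Proof. by rewrite scale0r addr0. Qed.

Let d_kap x i j : rder (fun h => kap i (x + h *: 'e_j)) 0 (- (sn i x / 2) * (i == j)%:R).
Proof.
have := rderM (rderD (rder_cst 1 0) (d_co x i j)) (rder_cst 2^-1 0).
by move/rder_eq; apply; rewrite mulr0 addr0 add0r; ring.
Qed.

(* The derivative of a product of kernels is not a multiple of the product,
   but becomes one after multiplication by the sine. *)
Let d_ker r i : exists2 D : 'rV[R]_n -> R, rlip D &
  forall x, rder (fun h => ker r (x + h *: 'e_i)) 0 (D x) /\
    D x * sn i x = - (2 * (count_mem i r)%:R) * ((1 - kap i x) * ker r x).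
Proof.
elim: r => [|j r [D hD hd]].
  exists (fun=> 0); first exact: rlip_cst.
  move=> x; split; last by rewrite /= mulr0 oppr0 !mul0r.
  by apply: rder_ext (rder_cst 1 0) => h; rewrite /ker big_nil.
exists (fun x => - (sn j x / 2) * (j == i)%:R * ker r x + kap j x * D x).
  apply: rlipD; last exact: rlipM.
  apply: rlipM => //.
  rewrite (_ : (fun x => _) = fun x => (- (j == i)%:R / 2) * sn j x); first exact: rlipZ.
  by apply/funext => x; ring.
move=> x; have [h1 h2] := hd x; split.
  have := rderM (d_kap x j i) h1; rewrite !at0.
  by apply: rder_ext => h; rewrite kerS.
rewrite kerS mulrDl -(mulrA (kap j x)) h2 /= natrD.
case: eqVneq => [->|_]; last by rewrite /= mulr0n; ring.
have e : sn i x ^+ 2 = 4 * kap i x * (1 - kap i x).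
  have := cos2Dsin2 (x 0 i - x0 0 i); rewrite -/(co i x) -/(sn i x) => e.
  have -> : sn i x ^+ 2 = 1 - co i x ^+ 2 by rewrite -e addrC addKr.
  by rewrite /kap; field.
have -> : - (sn i x / 2) * 1 * ker r x * sn i x = - (sn i x ^+ 2) / 2 * ker r x.
  by field.
by rewrite e /=; field.
Qed.

Let T r := tint (ker r).

Let rlip_1kap i r : rlip (fun x => (1 - kap i x) * ker r x).
Proof.
by apply: rlipM => //; apply: rlipD; [exact: rlip_cst|exact: rlipN].
Qed.

(* Integrating the derivative of [ker r * sn i] in the direction i. *)
Let tint_1kap i r : tint (fun x => (1 - kap i x) * ker r x) =
  T r / (2 * (count_mem i r)%:R + 2).
Proof.
have [D hD hd] := d_ker r i; set m := (count_mem i r)%:R in hd *.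
have m0 : 0 <= m by rewrite ler0n.
have hl := rlip_1kap i r.
have e0 : tint (fun x => ker r x + (- (2 * m + 2)) * ((1 - kap i x) * ker r x)) = 0.
  apply: (@mean_pd_real (fun x => ker r x * sn i x) _ i).
  - exact: rlipM.
  - by move=> j x; have [_ ->] := per_w i; rewrite per_ker.
  - by apply: rlipD => //; exact: rlipZ.
  - move=> x; have [h1 h2] := hd x.
    apply: rder_eq (rderM h1 (d_sn x i i)) _; rewrite eqxx !at0 h2 /=.
    have -> : co i x = 2 * kap i x - 1 by rewrite /kap; field.
    by ring.
move: e0; rewrite tintD//; last exact: rlipZ.
rewrite tintZ// => e0; apply/eqP; rewrite -subr_eq0.
have -> : tint (fun x => (1 - kap i x) * ker r x) - T r / (2 * m + 2) =
  - (T r + - (2 * m + 2) * tint (fun x => (1 - kap i x) * ker r x)) / (2 * m + 2).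
  by field; lra.
by rewrite /T e0 oppr0 mul0r.
Qed.

Let T_gt0 r : 0 < T r.
Proof.
elim: r => [|i r IH].
  rewrite /T (_ : ker _ = fun=> 1); last by apply/funext => x; rewrite /ker big_nil.
  by rewrite tint_cst mul1r exprn_gt0// twopi_gt0.
have -> : T (i :: r) = T r + -1 * tint (fun x => (1 - kap i x) * ker r x).
  rewrite /T -tintZ// -tintD//; last exact: rlipZ.
  by congr tint; apply/funext => x; rewrite kerS; ring.
rewrite tint_1kap mulN1r subr_gt0 ltr_pdivrMr ?ltr_pwDr ?mulr_ge0//.
have : 0 <= (count_mem i r)%:R :> R by rewrite ler0n.
by nra.
Qed.

Let per_nat (F : 'rV[R]_n -> R) i (k : nat) x : rper F ->
  F (x + (2 * pi * k%:R) *: 'e_i) = F x.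
Proof.
move=> pF; elim: k => [|k IH]; first by rewrite mulr0 at0.
by rewrite -(natr1 k) mulrDr mulr1 scalerDl addrA pF.
Qed.
Let per_int (F : 'rV[R]_n -> R) i (k : int) x : rper F ->
  F (x + (2 * pi * k%:~R) *: 'e_i) = F x.
Proof.
move=> pF; case: k => k; first exact: per_nat.
rewrite NegzE rmorphN /= -pmulrn mulrN -(@per_nat F i k.+1 (x + _))//.
by rewrite -addrA -scalerDl addNr at0.
Qed.

(** After reduction modulo periods every angle is at most [pi]. Angles below a small [eta] change
    [F] by at most [e] in total by the Lipschitz bound; for larger angles [1 - kap i] is bounded
    below and a large [C] pays. *)
Let modulus (F : 'rV[R]_n -> R) : rlip F -> rper F -> forall e, 0 < e ->
  exists2 C, 0 <= C & forall x, F x0 - F x <= e + C * \sum_i (1 - kap i x).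
Proof.
move=> [K [_ k2]] pF e e0.
have pi0 := @pi_gt0 R; have n0 : 0 <= n%:R :> R by [].
have K0 : 0 < `|K| + 1 by have := normr_ge0 K; lra.
(* Small enough that moving all [n] coordinates by [eta] costs at most [e]. *)
pose eta := Num.min pi (e / ((`|K| + 1) * (n%:R + 1))).
have eta0 : 0 < eta by rewrite lt_min pi0 divr_gt0// mulr_gt0// ltr_pwDr.
have eta_pi : eta <= pi by rewrite ge_min lexx.
have eta_e : (`|K| + 1) * (n%:R * eta) <= e.
  have : eta <= e / ((`|K| + 1) * (n%:R + 1)) by rewrite ge_min lexx orbT.
  by rewrite ler_pdivlMr ?mulr_gt0 ?ltr_pwDr//; nra.
have c0 : 0 < 1 - cos eta.
  by rewrite subr_gt0 -cos0 ltr_cos// in_itv /= ?lexx ltW.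
have ang d : `|d| <= pi -> `|d| <= eta + pi / (1 - cos eta) * (1 - cos d).
  move=> dpi; have cd : 0 <= 1 - cos d by rewrite subr_ge0 cos_le1.
  case: (leP `|d| eta) => de.
    by apply: le_trans de _; rewrite lerDl mulr_ge0// divr_ge0// ltW.
  have -> : cos d = cos `|d|.
    by case: (ger0P d) => _; rewrite ?cosN.
  have : cos `|d| <= cos eta.
    by rewrite ltW// ltr_cos// in_itv /= ?normr_ge0 ?(ltW eta0).
  move=> h; have : pi <= pi / (1 - cos eta) * (1 - cos `|d|).
    by rewrite mulrAC ler_pdivlMr// ler_pM2l//; lra.
  lra.
exists ((`|K| + 1) * (pi / (1 - cos eta) * 2)).
  by rewrite mulr_ge0 ?(ltW K0)// mulr_ge0// divr_ge0// ltW.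
move=> x; pose th i := x 0 i - x0 0 i.
have /choice[k hk] : forall i, exists k : int, `|th i - 2 * pi * k%:~R| <= pi.
  by move=> i; exact: nearest_period.
pose d i := th i - 2 * pi * (k i)%:~R.
have cosd i : cos (d i) = co i x.
  have : cis (d i) = cis (th i).
    by rewrite -[LHS]mulr1 -(cis_2pi_int R (k i)) -cisD /d subrK.
  by case.
(* The Lipschitz bound holds along coordinate directions only, so [x0] is joined to [x] by changing
   one coordinate at a time; [path2] replaces the reduced angles by the true ones. *)
have path1 (r : seq 'I_n) y :
    `|F (y + \sum_(i <- r) d i *: 'e_i) - F y| <= K * \sum_(i <- r) `|d i|.
  elim: r y => [|i r IH] y; first by rewrite !big_nil addr0 subrr normr0 mulr0.
  rewrite !big_cons addrA.
  have := ler_normD (F (y + d i *: 'e_i + \sum_(j <- r) d j *: 'e_j) -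
    F (y + d i *: 'e_i)) (F (y + d i *: 'e_i) - F y).
  by rewrite addrA subrK; have := IH (y + d i *: 'e_i); have := k2 y i (d i); lra.
have path2 (r : seq 'I_n) y :
    F (y + \sum_(i <- r) d i *: 'e_i) = F (y + \sum_(i <- r) th i *: 'e_i).
  elim: r y => [|i r IH] y; first by rewrite !big_nil.
  have e1 : th i *: ('e_i : 'rV[R]_n) = d i *: 'e_i + (2 * pi * (k i)%:~R) *: 'e_i.
    by rewrite -scalerDl subrK.
  by rewrite !big_cons !addrA IH e1 addrA [in RHS]addrAC per_int.
have xE : x = x0 + \sum_(i <- index_enum 'I_n) th i *: 'e_i.
  rewrite (_ : \sum_(i <- _) _ = x - x0); first by rewrite addrC subrK.
  rewrite [RHS]row_sum_delta; apply: eq_bigr => i _; by rewrite /th !mxE.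
have := path1 (index_enum 'I_n) x0; rewrite path2 -xE distrC => h.
apply: le_trans (ler_norm _) _; apply: le_trans h _.
have S0 : 0 <= \sum_(i <- index_enum 'I_n) `|d i| by exact: sumr_ge0.
apply: le_trans (_ : (`|K| + 1) * \sum_(i <- index_enum 'I_n) `|d i| <= _).
  by rewrite ler_wpM2r//; have := ler_norm K; lra.
apply: le_trans (_ : (`|K| + 1) * (n%:R * eta + pi / (1 - cos eta) * 2 * \sum_i (1 - kap i x)) <= _).
  rewrite ler_pM2l// -[n in n%:R]card_ord mulr_natl -sumr_const mulr_sumr -big_split /=.
  apply: ler_sum => i _; apply: le_trans (ang _ (hk i)) _.
  rewrite cosd /kap le_eqVlt; apply/orP; left; apply/eqP; field.
  by rewrite gt_eqF.
by rewrite mulrDr -[X in _ <= _ + X]mulrA lerD2r.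
Qed.

Let many m : exists r, forall i, (m <= count_mem i r)%N.
Proof.
elim: m => [|m [r hr]]; first by exists [::].
exists (enum 'I_n ++ r) => i; rewrite count_cat -add1n leq_add// -has_count.
by apply/hasP; exists i; rewrite ?mem_enum//=.
Qed.

(** Integrate [modulus] against [ker r]: the left side becomes [F x0 * T r] by orthogonality, and by
    [tint_1kap] the error is [T r] times a sum that large multiplicities make small. *)
Let le0_of_orthogonal (F : 'rV[R]_n -> R) : rlip F -> rper F ->
  (forall r, tint (fun x => F x * ker r x) = 0) -> F x0 <= 0.
Proof.
move=> hF pF horth; apply/ler_addgt0Pl => e e0; rewrite addr0.
have e2 : 0 < e / 2 by lra.
have [C C0 hC] := modulus hF pF e2.
have n0 : 0 <= n%:R :> R by [].
(* Multiplicities of at least [m] bound the error by [C n / (2 (m + 1))] times [T r], below [e / 2]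
   for this [m]. *)
pose m := Num.truncn (2 * C * n%:R / e).
have hm : 2 * C * n%:R / e < m.+1%:R.
  by rewrite truncnS_gt// divr_ge0 ?(ltW e0)// mulr_ge0// mulr_ge0.
have [r hr] := many m.
have T0 := T_gt0 r.
have bound : F x0 * T r <= (e / 2) * T r + C * \sum_(i < n) (T r / (2 * (count_mem i r)%:R + 2)).
  have -> : F x0 * T r = tint (fun x => F x0 * ker r x + -1 * (F x * ker r x)).
    rewrite tintD ?tintZ ?horth ?mulr0 ?addr0//; try exact: rlipM; try exact: rlipZ.
    by apply: rlipZ; exact: rlipM.
  have tsum (q : seq 'I_n) :
      rlip (fun x => \sum_(i <- q) (1 - kap i x) * ker r x) /\
      tint (fun x => \sum_(i <- q) (1 - kap i x) * ker r x) =
      \sum_(i <- q) (T r / (2 * (count_mem i r)%:R + 2)).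
    elim: q => [|i q [IH1 IH2]].
      rewrite big_nil (_ : (fun x => _) = fun=> 0); last by apply/funext => x; rewrite big_nil.
      by split; [exact: rlip_cst|rewrite tint_cst mul0r].
    rewrite big_cons -IH2 -tint_1kap -tintD//.
    rewrite (_ : (fun x => _) = fun x => (1 - kap i x) * ker r x +
      \sum_(j <- q) (1 - kap j x) * ker r x); last by apply/funext => x; rewrite big_cons.
    by split => //; exact: rlipD.
  have [ts1 ts2] := tsum (index_enum 'I_n).
  rewrite -ts2 -!tintZ// -tintD; try exact: rlipZ.
  apply: tint_le.
  - by apply: rlipD; apply: rlipZ => //; exact: rlipM.
  - by apply: rlipD; exact: rlipZ.
  - move=> x; rewrite -mulr_suml.
    have -> : F x0 * ker r x + -1 * (F x * ker r x) = (F x0 - F x) * ker r x by ring.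
    by rewrite mulrA -mulrDl ler_wpM2r.
have s_le : \sum_(i < n) (T r / (2 * (count_mem i r)%:R + 2)) <= n%:R * (T r / (2 * m.+1%:R)).
  apply: le_trans (_ : \sum_(i < n) (T r / (2 * m.+1%:R)) <= _).
    apply: ler_sum => i _; rewrite ler_pM2l//.
    have p1 : 0 < 2 * (count_mem i r)%:R + 2 :> R by rewrite ltr_pwDr// mulr_ge0.
    have p2 : 0 < 2 * m.+1%:R :> R by rewrite mulr_gt0.
    rewrite lef_pV2 ?posrE// -(natr1 m) mulrDr mulr1 lerD2r ler_pM2l// ler_nat; exact: hr.
  by rewrite sumr_const card_ord -[leLHS]mulr_natl.
rewrite -(ler_pM2r T0); apply: le_trans bound _.
have h3 : C * \sum_(i < n) (T r / (2 * (count_mem i r)%:R + 2)) <= C * (n%:R * (T r / (2 * m.+1%:R))).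
  by rewrite ler_wpM2l.
move: hm; rewrite ltr_pdivrMr// => hm.
have mp : 0 < m.+1%:R :> R by [].
have h4 : C * (n%:R * (T r / (2 * m.+1%:R))) <= e / 2 * T r.
  have -> : C * (n%:R * (T r / (2 * m.+1%:R))) = C * n%:R / (2 * m.+1%:R) * T r.
    by field; rewrite gt_eqF.
  rewrite ler_pM2r// ler_pdivrMr ?mulr_gt0//.
  have -> : e / 2 * (2 * m.+1%:R) = m.+1%:R * e by field.
  have : 0 <= C * n%:R by exact: mulr_ge0.
  lra.
rewrite {2}(splitr e) mulrDl lerD2l; exact: le_trans h3 h4.
Qed.

Let mean_ker (f : 'rV[R]_n -> R[i]) : BL f -> (forall z, fc f z = 0) ->
  forall r, mean (fun x => f x * (ker r x)%:C%C) = 0.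
Proof.
move=> hf f0 r.
(* The induction needs an arbitrary extra character: each factor [kap i] is a combination of 1 and
   two characters of frequency plus and minus [unit_z i], which shift it. *)
suff : forall z, mean (fun x => f x * (ker r x)%:C%C * ee z x) = 0.
  move=> /(_ 0); rewrite (_ : (fun x => f x * _ * _) = fun x => f x * (ker r x)%:C%C)//.
  by apply/funext => x; rewrite ee0 mulr1.
elim: r => [|i r IH] z.
  rewrite -(f0 (- z)) /fc opprK; congr mean; apply/funext => x.
  by rewrite /ker big_nil mulr1.
have hB y : BL (fun x => f x * (ker r x)%:C%C * ee y x).
  by apply: BLM; [apply: BLM => //; exact: BL_real|exact: BL_ee].
have -> : (fun x => f x * (ker (i :: r) x)%:C%C * ee z x) = fun x =>
    2^-1 * (f x * (ker r x)%:C%C * ee z x) +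
    (cis (- x0 0 i) / 4 * (f x * (ker r x)%:C%C * ee (unit_z i + z) x) +
     cis (x0 0 i) / 4 * (f x * (ker r x)%:C%C * ee (- unit_z i + z) x)).
  apply/funext => x; rewrite kerS.
  have -> : (kap i x * ker r x)%:C%C = (kap i x)%:C%C * (ker r x)%:C%C :> R[i].
    exact: rmorphM.

  have -> : (kap i x)%:C%C = 2^-1 + (cis (- x0 0 i) / 4 * ee (unit_z i) x +
     cis (x0 0 i) / 4 * ee (- unit_z i) x) :> R[i].
    have -> : cis (- x0 0 i) / 4 * ee (unit_z i) x =
       (co i x +i* sn i x)%C / 4 by rewrite -wE mulrAC.
    have -> : cis (x0 0 i) / 4 * ee (- unit_z i) x = (co i x +i* - sn i x)%C / 4.
      rewrite mulrAC; congr (_ / _); rewrite /ee.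
      have -> : dot (- unit_z i) x = - x 0 i.
        have := dotDl (unit_z i) (- unit_z i) x; rewrite subrr dot_unit.
        have -> : dot 0 x = 0 by rewrite /dot big1// => j _; rewrite mxE mul0r.
        lra.
      rewrite -cisD /cis /co /sn.
      have -> : x0 0 i - x 0 i = - (x 0 i - x0 0 i) by ring.
      by rewrite cosN sinN.
    have -> : (co i x +i* sn i x)%C / 4 + (co i x +i* - sn i x)%C / 4 =
       ((co i x)%:C%C / 2) :> R[i].
      rewrite -mulrDl.
      have -> : (co i x +i* sn i x)%C + (co i x +i* - sn i x)%C = 2 * (co i x)%:C%C :> R[i].
        by apply: complex_ext; rewrite !ReImE /=; ring.
      by field.
    by rewrite /kap rmorphM rmorphD /= rmorph1 fmorphV /= rmorph_nat mulrDl mul1r.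
  rewrite !eeD; ring.
rewrite meanD; [|exact: BLZ|by apply: BLD; exact: BLZ].
rewrite meanD; try exact: BLZ.
by rewrite !meanZ// !IH !mulr0 !addr0.
Qed.

Lemma fourier_unique_at (f : 'rV[R]_n -> R[i]) : BL f -> periodicT f ->
  (forall z, fc f z = 0) -> f x0 = 0.
Proof.
move=> hf pf f0; have mk := mean_ker hf f0.
have tpn : (2 * pi) ^- n != 0 :> R.
  by rewrite invr_eq0 expf_neq0// gt_eqF// twopi_gt0.
have [hr hi] := (BL_re hf, BL_im hf).
have pr : rper (reF f) by move=> i x; rewrite /reF pf.
have pim : rper (imF f) by move=> i x; rewrite /imF pf.
have orth r : tint (fun x => reF f x * ker r x) = 0 /\
              tint (fun x => imF f x * ker r x) = 0.
  have := mk r; rewrite !meanE /cint => /eqP; rewrite mulf_eq0.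
  rewrite (inj_eq (@complexI R) _ 0) (negbTE tpn) /= => /eqP[h1 h2].
  split; [rewrite -[RHS]h1|rewrite -[RHS]h2]; congr tint; apply/funext => x.
    by rewrite /reF cReM /= mulr0 subr0.
  by rewrite /imF cImM /= mulr0 add0r.
have neg (F : 'rV[R]_n -> R) : rlip F -> (forall r, tint (fun x => F x * ker r x) = 0) ->
    forall r, tint (fun x => - F x * ker r x) = 0.
  move=> hF h r; rewrite (_ : (fun x => _) = fun x => -1 * (F x * ker r x)).
    by rewrite tintZ ?h ?mulr0//; exact: rlipM.
  by apply/funext => x; ring.
have zero (F : 'rV[R]_n -> R) : rlip F -> rper F ->
    (forall r, tint (fun x => F x * ker r x) = 0) -> F x0 = 0.
  move=> hF pF h; apply/eqP; rewrite eq_le le0_of_orthogonal//=.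
  rewrite -oppr_le0; apply: (@le0_of_orthogonal (fun x => - F x)).
  - exact: rlipN.
  - by move=> i x; rewrite pF.
  - exact: neg.
apply: complex_ext.
  by apply: (zero (reF f) hr pr) => r; case: (orth r).
by apply: (zero (imF f) hi pim) => r; case: (orth r).
Qed.

End Kernel.

Lemma fourier_unique (f g : 'rV[R]_n -> R[i]) : BL f -> BL g ->
  periodicT f -> periodicT g -> (forall z, fc f z = fc g z) -> f = g.
Proof.
move=> hf hg pf pg e; apply/funext => x; apply/eqP; rewrite -subr_eq0; apply/eqP.
apply: (@fourier_unique_at x (fun x => f x - g x)).
- exact: BLB.
- by move=> i y; rewrite pf pg.
- by move=> z; rewrite fcB// e subrr.
Qed.

End FourierUniqueness.

(** * Derivatives from quadratic remainders, and continuity from coordinates *)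

Section QuadraticApproximation.
Variable R : realType.

Lemma rder_quad (u : R -> R) d K :
  (forall h, `|u h - u 0 - h * d| <= K * h ^+ 2) -> rder u 0 d.
Proof.
move=> hu; suff cv : h^-1 *: (u (h *: 1 + 0) - u 0) @[h --> 0^'] --> d.
  apply: DeriveDef; first by apply/cvg_ex; exists d.
  exact: cvg_lim cv.
apply/cvgrPdist_le => e e0.
have K0 : 0 < `|K| + 1 by have := normr_ge0 K; lra.
have r0 : 0 < e / (`|K| + 1) by exact: divr_gt0.
near=> h.
have h0 : h != 0 by near: h; exact: nbhs_dnbhs_neq.
have hr : `|h| <= e / (`|K| + 1) by near: h; exact: dnbhs0_le.
have h0' : 0 < `|h| by rewrite normr_gt0.
rewrite /GRing.scale /= mulr1 addr0 distrC.
have -> : h^-1 * (u h - u 0) - d = h^-1 * (u h - u 0 - h * d) by field.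
rewrite normrM normfV mulrC ler_pdivrMr//.
apply: le_trans (hu h) _; rewrite -[h ^+ 2]real_normK ?num_real// expr2 mulrA ler_pM2r//.
move: hr; rewrite ler_pdivlMr//; have := ler_norm K; nra.
Unshelve. all: by end_near. Qed.

Lemma cder_quad (u : R -> R[i]) d K :
  (forall h, cabs (u h - u 0 - h%:C%C * d) <= K * h ^+ 2) -> cder u 0 d.
Proof.
move=> hu; split; apply: (@rder_quad _ _ K) => h.
  by apply: le_trans (hu h); rewrite -cReZ -!cReN -!cReD; exact: Re_le_cabs.
by apply: le_trans (hu h); rewrite -cImZ -!cImN -!cImD; exact: Im_le_cabs.
Qed.

Lemma is_derive_lineP n (F : 'rV[R]_n -> R) x i d :
  is_derive x 'e_i F d <-> rder (fun h => F (x + h *: 'e_i)) 0 d.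
Proof.
have e : (fun h => h^-1 *: (F (h *: 'e_i + x) - F x)) =
    (fun h : R => h^-1 *: (F (x + (h *: 1 + 0) *: 'e_i) - F (x + 0 *: 'e_i))).
  by apply/funext => h; rewrite scale0r !addr0 [h%:A]mulr1 (addrC x).
split=> -[h1 h2]; apply: DeriveDef.
- by move: h1; rewrite /derivable e.
- by move: h2; rewrite /derive e.
- by move: h1; rewrite /derivable -e.
- by move: h2; rewrite /derive -e.
Qed.

Lemma cder_pdP n (f : 'rV[R]_n -> R[i]) x i d :
  cder (line f x i) 0 d <->
  [/\ derivable (reF f) x 'e_i, derivable (imF f) x 'e_i & pd i f x = d].
Proof.
split.
  move=> [/(is_derive_lineP (reF f) x i)[r1 r2] /(is_derive_lineP (imF f) x i)[i1 i2]].
  by split => //; rewrite /pd r2 i2; case: d {r2 i2}.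
move=> [/derivableP h1 /derivableP h2 <-]; split.
  exact/(is_derive_lineP (reF f)).
exact/(is_derive_lineP (imF f)).
Qed.

Lemma coord_lip_continuous n (F : 'rV[R]_n -> R) K :
  (forall x y, `|F x - F y| <= K * \sum_i `|x 0 i - y 0 i|) -> continuous F.
Proof.
move=> hF x; apply/(@cvgrPdist_le _ _ _ (nbhs x) (nbhs_filter x)) => e e0.
have K0 : 0 < (`|K| + 1) * (n%:R + 1).
  by rewrite mulr_gt0// ltr_wpDl.
have r0 : 0 < e / ((`|K| + 1) * (n%:R + 1)) by exact: divr_gt0.
have near_x : nbhs x (fun y : 'rV[R]_n => forall i, `|x 0 i - y 0 i| <= e / ((`|K| + 1) * (n%:R + 1))).
  apply: (@filter_forall _ _ _ _ (nbhs_filter x)) => i.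
  have h : (fun y : 'rV[R]_n => y 0 i) @ x --> x 0 i by exact: coord_continuous.
  by move/(@cvgrPdist_le _ _ _ (nbhs x) (nbhs_filter x)): h => /(_ _ r0).
near=> y.
have hy i : `|x 0 i - y 0 i| <= e / ((`|K| + 1) * (n%:R + 1)).
  by move: i; near: y.
apply: le_trans (hF x y) _.
have : \sum_i `|x 0 i - y 0 i| <= n%:R * (e / ((`|K| + 1) * (n%:R + 1))).
  by rewrite mulr_natl -[n in _ *+ n]card_ord -sumr_const; apply: ler_sum => i _.
have s0 : 0 <= \sum_i `|x 0 i - y 0 i| by exact: sumr_ge0.
set s := \sum_i _ in s0 *; set q := e / _ => hs.
have qe : q * ((`|K| + 1) * (n%:R + 1)) = e by rewrite /q divfK// gt_eqF.
have q0 : 0 < q by [].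
have n0 : 0 <= n%:R :> R by [].
apply: le_trans (_ : (`|K| + 1) * s <= _).
  by rewrite ler_wpM2r//; have := ler_norm K; lra.
apply: le_trans (_ : (`|K| + 1) * (n%:R * q) <= _).
  by rewrite ler_pM2l//; have := normr_ge0 K; lra.
rewrite -qe; have := normr_ge0 K; nra.
Unshelve. all: by end_near. Qed.

End QuadraticApproximation.

(** * Ultradifferentiable functions and their duals *)

Section FastSeries.
Variables (R : realType) (om : R -> R).
Hypotheses (wf : weight_function om) (sub : om_subadditive om).
Variable n : nat.
Implicit Types (f g : 'rV[R]_n -> R[i]) (c : 'rV[int]_n -> R[i]) (z : 'rV[int]_n).

Definition ser c f := forall x, is_csum (fun z => c z * ee z x) (f x).
Definition fast d C c := forall z, cabs (c z) <= C * expR (- (d * ow om z)).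
Definition fastc c := exists d C, 0 < d /\ fast d C c.

Lemma fast_ge0 d C c : fast d C c -> 0 <= C.
Proof.
move=> /(_ 0) h; have := le_trans (cabs_ge0 _) h.
by rewrite pmulr_lge0// expR_gt0.
Qed.

Lemma fast_mono d d' C C' c : d' <= d -> C <= C' -> fast d C c -> fast d' C' c.
Proof.
move=> dd CC h z; apply: le_trans (h z) _; have C0 := fast_ge0 h.
rewrite ler_pM ?expR_ge0// ler_expR lerN2 ler_wpM2r//; exact: ow_ge0.
Qed.

(** Half of the decay rate pays for summability, the other half remains as a weight. *)
Lemma fast_weighted c : fastc c -> exists d W, [/\ 0 < d, 0 < W &
  bsum (fun z => cabs (c z) * expR (d * ow om z)) W].
Proof.
move=> [d [C [d0 hc]]]; have d2 : 0 < d / 2 by lra.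
have [W W0 hW] := bsum_ow wf n d2.
exists (d / 2), ((C + 1) * W); split => //.
  by rewrite mulr_gt0//; have := fast_ge0 hc; lra.
have C0 : 0 <= C + 1 by have := fast_ge0 hc; lra.
apply: bsum_le (bsumZ C0 hW) => z.
apply: le_trans (_ : C * expR (- (d * ow om z)) * expR (d / 2 * ow om z) <= _).
  by rewrite ler_wpM2r ?expR_ge0.
rewrite -mulrA -expRD.
have -> : - (d * ow om z) + d / 2 * ow om z = - (d / 2 * ow om z) by field.
by rewrite ler_wpM2r ?expR_ge0// lerDl.
Qed.

Lemma fast_poly c p : fastc c -> exists2 W, 0 < W &
  bsum (fun z => cabs (c z) * (1 + nz R z) ^+ p) W.
Proof.
move=> /fast_weighted[d [W [d0 W0 hW]]].
have [C C0 hC] := poly_ow wf n p d0.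
exists (C * W); first by rewrite mulr_gt0.
apply: bsum_le (bsumZ (ltW C0) hW) => z.
by rewrite mulrCA ler_wpM2l ?cabs_ge0.
Qed.

Lemma fast_bsum c : fastc c -> exists2 W, 0 < W & bsum (fun z => cabs (c z)) W.
Proof.
by move=> /(fast_poly 0)[W W0 h]; exists W => //; apply: bsum_le h => z; rewrite expr0 mulr1.
Qed.

Lemma fastc_mul c (p : nat) (m : 'rV[int]_n -> R[i]) :
  (forall z, cabs (m z) <= (1 + nz R z) ^+ p) -> fastc c -> fastc (fun z => m z * c z).
Proof.
move=> hm [d [C [d0 hc]]]; have d2 : 0 < d / 2 by lra.
have [B B0 hB] := poly_ow wf n p d2.
exists (d / 2), (B * C); split => // z; rewrite cabsM.
apply: le_trans (_ : (B * expR (d / 2 * ow om z)) * (C * expR (- (d * ow om z))) <= _).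
  by rewrite ler_pM ?cabs_ge0//; apply: le_trans (hm z) _.
rewrite mulrACA -expRD.
by have -> : d / 2 * ow om z + - (d * ow om z) = - (d / 2 * ow om z) by field.
Qed.

Lemma fastc_pd c i : fastc c -> fastc (fun z => 'i%C * (z 0 i)%:~R * c z).
Proof.
apply: (@fastc_mul _ 1) => z; rewrite cabsM cabsi mul1r cabs_int expr1.
by have := le_nz R z i; lra.
Qed.

Lemma ser_exists c W : bsum (fun z => cabs (c z)) W -> exists f, ser c f.
Proof.
move=> hW; exists (fun x => csum (fun z => c z * ee z x)) => x.
apply: (@csumP _ _ _ W); apply: bsum_le hW => z.
by rewrite cabsM cabs_ee mulr1.
Qed.

Lemma ser_le c f W : bsum (fun z => cabs (c z)) W -> ser c f -> forall x, cabs (f x) <= W.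
Proof.
move=> hW hs x; apply: (is_csum_le (hs x)); apply: bsum_le hW => z.
by rewrite cabsM cabs_ee mulr1.
Qed.

Lemma ser_lip c f : fastc c -> ser c f -> exists K, forall x y,
  cabs (f x - f y) <= K * \sum_i `|x 0 i - y 0 i|.
Proof.
move=> hc hs; have [W W0 hW] := fast_poly 1 hc; exists (2 * W) => x y.
set S := \sum_i _; have S0 : 0 <= S by exact: sumr_ge0.
apply: (@is_csum_le _ _ (fun z => c z * ee z x + - (c z * ee z y))).
  exact: is_csumD (hs x) (is_csumN (hs y)).
have -> : 2 * W * S = (2 * S) * W by ring.
apply: bsum_le (bsumZ _ hW) => [z|]; last by rewrite mulr_ge0.
rewrite -mulrBr cabsM expr1 [leRHS]mulrCA ler_wpM2l ?cabs_ge0//.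
have -> : ee z x - ee z y = ee z y * (cis (dot z x - dot z y) - 1).
  by rewrite mulrBr mulr1 /ee -cisD (addrC (dot z y)) subrK.
rewrite cabsM cabs_ee mul1r; apply: le_trans (cabs_cis_sub1 _) _.
rewrite -mulrA ler_pM2l// mulrC.
apply: le_trans (_ : nz R z * S <= _); last by rewrite ler_wpM2r// lerDr.
rewrite /dot -sumrB; apply: le_trans (ler_norm_sum _ _ _) _.
rewrite /S mulr_sumr; apply: ler_sum => i _.
rewrite -mulrBr normrM ler_wpM2r// -intr_norm; exact: le_nz.
Qed.

Lemma ser_continuous c f : fastc c -> ser c f ->
  continuous (reF f) /\ continuous (imF f).
Proof.
move=> hc hs; have [K hK] := ser_lip hc hs.
split; apply: (@coord_lip_continuous _ _ _ K) => x y; apply: le_trans (hK x y).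
  by rewrite /reF -cReN -cReD; exact: Re_le_cabs.
by rewrite /imF -cImN -cImD; exact: Im_le_cabs.
Qed.

Lemma ser_BL c f : fastc c -> ser c f -> BL f.
Proof.
move=> hc hs; have [W W0 hW] := fast_bsum hc; have [K hK] := ser_lip hc hs.
exists (W + `|K|); split=> [x|x i h].
  by apply: le_trans (ser_le hW hs x) _; rewrite lerDl.
apply: le_trans (hK _ _) _.
have -> : \sum_j `|(x + h *: 'e_i) 0 j - x 0 j| = `|h|.
  rewrite (bigD1 i)//= !mxE !eqxx mulr1 (addrC (x 0 i)) addrK big1 ?addr0// => j /negbTE ji.
  by rewrite !mxE ji andbF mulr0 addr0 subrr normr0.
rewrite ler_wpM2r//; have := ler_norm K; lra.
Qed.

(** Termwise differentiation: each character has a quadratic remainder of size [4 (z_i h) ^ 2], and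
    these are summable against [c] by [fast_poly]. *)
Lemma ser_cder c f f' i : fastc c -> ser c f ->
  ser (fun z => 'i%C * (z 0 i)%:~R * c z) f' ->
  forall x, cder (line f x i) 0 (f' x).
Proof.
move=> hc hs hs' x; have [W W0 hW] := fast_poly 2 hc.
apply: (@cder_quad _ _ _ (4 * W)) => h.
rewrite /line scale0r addr0.
apply: (@is_csum_le _ _ (fun z => c z * ee z (x + h *: 'e_i) + - (c z * ee z x) +
   - (h%:C%C * ('i%C * (z 0 i)%:~R * c z * ee z x)))).
  exact: is_csumD (is_csumD (hs _) (is_csumN (hs x))) (is_csumN (is_csumZ _ (hs' x))).
have -> : 4 * W * h ^+ 2 = (4 * h ^+ 2) * W by ring.
apply: bsum_le (bsumZ _ hW) => [z|]; last by rewrite mulr_ge0// sqr_ge0.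
have -> : c z * ee z (x + h *: 'e_i) + - (c z * ee z x) +
   - (h%:C%C * ('i%C * (z 0 i)%:~R * c z * ee z x)) =
   c z * (ee z x * (cis ((z 0 i)%:~R * h) - 1 - 'i%C * ((z 0 i)%:~R * h)%:C%C)).
  rewrite {1}/ee dot_line cisD -/(ee z x).
  have -> : ((z 0 i)%:~R * h)%:C%C = (z 0 i)%:~R * h%:C%C :> R[i].
    by rewrite -(rmorph_int (real_complex R)) -rmorphM.
  ring.
rewrite !cabsM cabs_ee mul1r [leRHS]mulrCA ler_wpM2l ?cabs_ge0//.
apply: le_trans (cabs_cis_sub2 _) _; rewrite exprMn -[leRHS]mulrA ler_pM2l// mulrC.
rewrite ler_wpM2l ?sqr_ge0//.
have -> : (z 0 i)%:~R ^+ 2 = `|z 0 i|%:~R ^+ 2 :> R.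
  by rewrite intr_norm real_normK ?num_real.
have := le_nz R z i; have : 0 <= `|z 0 i|%:~R :> R by rewrite ler0z.
nra.
Qed.

Lemma ser_pd c f i : fastc c -> ser c f ->
  ser (fun z => 'i%C * (z 0 i)%:~R * c z) (pd i f).
Proof.
move=> hc hs; have hc' := fastc_pd i hc.
have [W _ hW] := fast_bsum hc'; have [g hg] := ser_exists hW.
suff -> : pd i f = g by [].
by apply/funext => x; have /cder_pdP[] := ser_cder hc hs hg x.
Qed.

Definition zmul (s : seq 'I_n) z : R[i] := \prod_(i <- s) ('i%C * (z 0 i)%:~R).

Lemma cabs_zmul s z : cabs (zmul s z) <= nz R z ^+ size s.
Proof.
elim: s => [|i s IH]; first by rewrite /zmul big_nil cabs1 expr0.
rewrite /zmul big_cons cabsM exprS; apply: ler_pM; rewrite ?cabs_ge0//.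
by rewrite cabsM cabsi mul1r cabs_int; exact: le_nz.
Qed.

Lemma ser_dseq c f s : fastc c -> ser c f ->
  fastc (fun z => zmul s z * c z) /\ ser (fun z => zmul s z * c z) (dseq s f).
Proof.
move=> hc hs; elim: s => [|i s [IH1 IH2]] /=.
  by rewrite (_ : (fun z => _) = c)//; apply/funext => z; rewrite /zmul big_nil mul1r.
have -> : (fun z => zmul (i :: s) z * c z) =
    fun z => 'i%C * (z 0 i)%:~R * (zmul s z * c z).
  by apply/funext => z; rewrite /zmul big_cons mulrA.
by split; [exact: fastc_pd|exact: ser_pd].
Qed.

Lemma ser_smooth c f : fastc c -> ser c f -> smoothT f.
Proof.
move=> hc hs s; have [h1 h2] := ser_dseq s hc hs.
have [k1 k2] := ser_continuous h1 h2; split => //; split => // i x.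
have h1' := fastc_pd i h1; have [W _ hW] := fast_bsum h1'.
have [g hg] := ser_exists hW.
by have /cder_pdP[] := ser_cder h1 h2 hg x.
Qed.

Lemma ser_periodic c f : ser c f -> periodicT f.
Proof.
move=> hs i x; apply: is_csum_inj (hs (x + (2 * pi) *: 'e_i)) _.
by apply: eq_is_csum (hs x) => z; rewrite periodic_ee.
Qed.

(** [pow_phistar] at the norm of [z] when that is at least 1; the factor [expR (lam * om 1)] pays
    for the rest by comparison with [r = 1]. *)
Lemma nz_phistar lam (j : nat) z : 0 < lam ->
  nz R z ^+ j * expR (- (lam * phistar om (j%:R / lam))) <=
  expR (lam * om 1) * expR (lam * ow om z).
Proof.
move=> l0; case: (leP 1 (nz R z)) => hz.
  apply: le_trans (pow_phistar wf j hz l0) _; rewrite -/(ow om z) ler_peMl ?expR_ge0//.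
  by rewrite -expR0 ler_expR mulr_ge0 ?(ltW l0)// (om_ge0 wf).
apply: le_trans (_ : 1 ^+ j * expR (- (lam * phistar om (j%:R / lam))) <= _).
  by rewrite ler_wpM2r ?expR_ge0// lerXn2r ?nnegrE ?nz_ge0// ltW.
apply: le_trans (pow_phistar wf j (lexx 1) l0) _; rewrite ler_peMr ?expR_ge0//.
by rewrite -expR0 ler_expR mulr_ge0 ?(ltW l0)// ow_ge0.
Qed.

Lemma ser_normle c f lam W : fastc c -> ser c f -> 0 < lam ->
  bsum (fun z => cabs (c z) * expR (lam * ow om z)) W ->
  normle om lam f (expR (lam * om 1) * W).
Proof.
move=> hc hs l0 hW x s; have [h1 h2] := ser_dseq s hc hs.
set E := expR (- _); have E0 : 0 < E by exact: expR_gt0.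
rewrite -ler_pdivlMr//; apply: (is_csum_le (h2 x)).
rewrite mulrAC.
have A0 : 0 <= expR (lam * om 1) / E by rewrite divr_ge0 ?expR_ge0.
apply: bsum_le (bsumZ A0 hW) => z.
rewrite !cabsM cabs_ee mulr1 [leRHS]mulrCA mulrC ler_wpM2l ?cabs_ge0//.
rewrite mulrAC ler_pdivlMr//; apply: le_trans (nz_phistar (size s) z l0).
by rewrite ler_wpM2r ?(ltW E0)// cabs_zmul.
Qed.

Lemma ser_inEom c f : fastc c -> ser c f -> inEom om f.
Proof.
move=> hc hs; split; first exact: ser_smooth hc hs.
split; first exact: ser_periodic hs.
have [d [W [d0 W0 hW]]] := fast_weighted hc.
exists d; split => //; exists (expR (d * om 1) * W); exact: ser_normle hc hs d0 hW.
Qed.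

Lemma ser_approx c f : fastc c -> ser c f -> forall e, 0 < e ->
  exists s0 : seq 'rV[int]_n, forall s, uniq s -> {subset s0 <= s} -> forall x,
  cabs (f x - \sum_(z <- s) c z * ee z x) <= e.
Proof.
move=> hc hs e e0; have [W W0 hW] := fast_bsum hc.
have [s0 [us0 hs0]] := bsum_tail (fun z => cabs_ge0 (c z)) hW e0.
exists s0 => s us ss x; apply: (is_csum_tail (hs x) us) => r ur hr.
apply: le_trans (hs0 r ur _); last first.
  by move=> z /hr; apply: contra; exact: ss.
by apply: ler_sum => z _; rewrite cabsM cabs_ee mulr1.
Qed.

Lemma BL_trig (c : 'rV[int]_n -> R[i]) (s : seq 'rV[int]_n) :
  BL (fun x : 'rV[R]_n => \sum_(z <- s) c z * ee z x).
Proof. by apply: BL_sum => z; apply: BLZ; exact: BL_ee. Qed.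

Lemma fc_trig (c : 'rV[int]_n -> R[i]) (s : seq 'rV[int]_n) y : uniq s -> y \in s ->
  fc (fun x => \sum_(z <- s) c z * ee z x) y = c y.
Proof.
move=> us ys; rewrite fc_sum; last by move=> z; apply: BLZ; exact: BL_ee.
rewrite (bigD1_seq y)//= fcZ; last exact: BL_ee.
rewrite fc_ee eqxx mulr1 big1 ?addr0// => z /negbTE zy.
by rewrite fcZ ?fc_ee ?zy ?mulr0//; exact: BL_ee.
Qed.

Lemma fc_ser c f : fastc c -> ser c f -> fc f =1 c.
Proof.
move=> hc hs z; apply/eqP; rewrite -subr_eq0; apply/eqP/cabs_eq0/eqP.
rewrite eq_le cabs_ge0 andbT; apply/ler_addgt0Pl => e e0; rewrite addr0.
have e2 : 0 < e / 2 by lra.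
have [s0 hs0] := ser_approx hc hs e2.
pose s := undup (z :: s0); have us : uniq s by exact: undup_uniq.
have zs : z \in s by rewrite mem_undup mem_head.
have ss : {subset s0 <= s} by move=> y ys; rewrite mem_undup in_cons ys orbT.
rewrite -(fc_trig c us zs) -fcB; [|exact: ser_BL hc hs|exact: BL_trig].
apply: le_trans (fc_le _ _ (hs0 s us ss)) _; last lra.
by apply: BLB; [exact: ser_BL hc hs|exact: BL_trig].
Qed.

(** The series converges to some function with the same coefficients; uniqueness identifies it with
    [f]. *)
Lemma ser_fc f : BL f -> periodicT f -> fastc (fc f) -> ser (fc f) f.
Proof.
move=> hf pf hc; have [W _ hW] := fast_bsum hc; have [g hg] := ser_exists hW.
have e : f = g.
  apply: fourier_unique => //; [exact: ser_BL hc hg|exact: ser_periodic hg|].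
  by move=> z; rewrite (fc_ser hc hg).
by move: hg; rewrite -e.
Qed.

Lemma inEom_of_fc f : BL f -> periodicT f -> fastc (fc f) -> inEom om f.
Proof. by move=> hf pf hc; exact: (ser_inEom hc (ser_fc hf pf hc)). Qed.

End FastSeries.

(** * Membership in E read on Fourier coefficients *)

Section UltraFunctions.
Variables (R : realType) (om : R -> R).
Hypotheses (wf : weight_function om) (sub : om_subadditive om).
Variable n : nat.
Implicit Types (f g : 'rV[R]_n -> R[i]).

Lemma smooth_cder f s i x : smoothT f ->
  cder (line (dseq s f) x i) 0 (dseq (i :: s) f x).
Proof.
move=> hf; have [_ [_ h]] := hf s; have [h1 h2] := h i x.
by apply/cder_pdP; split.
Qed.

Lemma periodic_pd f i : periodicT f -> periodicT (pd i f).
Proof.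
move=> pf j x; have e (F : 'rV[R]_n -> R) :
    (forall x, F (x + (2 * pi) *: 'e_j) = F x) ->
    'D_('e_i) F (x + (2 * pi) *: 'e_j) = 'D_('e_i) F x.
  move=> hF; rewrite /derive; have -> : (fun h : R => h^-1 *: (F (h *: 'e_i + (x + (2 * pi) *: 'e_j)) - F (x + (2 * pi) *: 'e_j))) = (fun h : R => h^-1 *: (F (h *: 'e_i + x) - F x)) :> (R -> R).
    by apply/funext => h; rewrite hF addrA hF.
  by [].
by rewrite /pd !e// => y; rewrite /reF /imF pf.
Qed.

Lemma periodic_dseq f s : periodicT f -> periodicT (dseq s f).
Proof. by move=> pf; elim: s => //= i s; exact: periodic_pd. Qed.

Lemma normle_dseq f lam D s x : normle om lam f D ->
  cabs (dseq s f x) <= D * expR (lam * phistar om ((size s)%:R / lam)).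
Proof.
by move=> /(_ x s); rewrite expRN ler_pdivrMr ?expR_gt0.
Qed.

Lemma normle_ge0 f lam D : normle om lam f D -> 0 <= D.
Proof.
move=> /(_ 0 [::]); apply: le_trans; by rewrite mulr_ge0 ?cabs_ge0 ?expR_ge0.
Qed.

Lemma BL_dseq f lam D s : smoothT f -> normle om lam f D -> BL (dseq s f).
Proof.
move=> hf hD.
pose B k := D * expR (lam * phistar om (k%:R / lam)).
have B0 k : 0 <= B k by rewrite mulr_ge0 ?expR_ge0// (normle_ge0 hD).
exists (B (size s) + 2 * B (size s).+1); split=> [x|x i h].
  by apply: le_trans (normle_dseq s x hD) _; rewrite lerDl mulr_ge0.
apply: le_trans (_ : 2 * B (size s).+1 * `|h| <= _).
  apply: (@line_lip _ _ _ (dseq (i :: s) f)) => y; first exact: smooth_cder.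
  exact: normle_dseq (i :: s) y hD.
by rewrite ler_wpM2r// lerDr.
Qed.

Lemma fc_dseq f lam D i j z : smoothT f -> periodicT f -> normle om lam f D ->
  fc (dseq (nseq j i) f) z = ('i%C * (z 0 i)%:~R) ^+ j * fc f z.
Proof.
move=> hf pf hD; elim: j => [|j IH]; first by rewrite expr0 mul1r.
rewrite exprS -mulrA -IH.
apply: fc_pd; [exact: BL_dseq hD|exact: periodic_dseq|exact: BL_dseq (nseq j.+1 i) hf hD|].
by move=> x; exact: smooth_cder.
Qed.

(** Integrate by parts [j] times along the coordinate of largest modulus [r], with the [j] of
    [phistar_attained]. That [d] and [C] depend on [lam] alone is what makes functionals defined by
    coefficients continuous on each Banach step. *)
Lemma fc_fast lam : 0 < lam -> exists d C, [/\ 0 < d, 0 < C &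
  forall f D, smoothT f -> periodicT f -> normle om lam f D ->
    fast om d (C * D) (fc f)].
Proof.
move=> l0; have l2 : 0 < lam / 2 by lra.
have [C1 C10 hC1] := om_growth1 wf l2.
have n1 : 0 < n.+1%:R :> R by [].
(* One half of [lam] absorbs the factor [r] lost in [phistar_attained]; dividing by [n.+1] passes
   from [om r] to [om] of the whole norm, which is at most [n * r]. *)
pose d := lam / 2 / n.+1%:R.
have d0 : 0 < d by rewrite divr_gt0.
(* [C2] serves the frequency 0, which has no coordinate of modulus at least 1. *)
pose C2 := 2 * expR (lam * phistar om (0%:R / lam)) * expR (d * om 0).
have C20 : 0 < C2 by rewrite !mulr_gt0// expR_gt0.
exists d, (2 * C1 + C2); split => //; first by rewrite addr_gt0// mulr_gt0.
move=> f D hf pf hD z; have D0 := normle_ge0 hD.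
case: (eqVneq z 0) => [->|z0].
  have := fc_le 0 (BL_dseq [::] hf hD) (fun x => normle_dseq [::] x hD).
  move=> /= h; apply: le_trans h _.
  rewrite /ow nz0 expRN ler_pdivlMr ?expR_gt0// mulrDl /C2.
  have : 0 <= 2 * C1 * D by rewrite mulr_ge0// mulr_ge0// ltW.
  lra.
have [i zi hi] := nz_max R z0; set r := `|z 0 i|%:~R in zi hi.
have r0 : 0 < r by exact: lt_le_trans zi.
have [j hj] := phistar_attained wf zi l0.
have h1 : r ^+ j * cabs (fc f z) <= 2 * (D * expR (lam * phistar om (j%:R / lam))).
  have := fc_le z (BL_dseq (nseq j i) hf hD) (fun x => normle_dseq (nseq j i) x hD).
  by rewrite (fc_dseq _ _ _ hf pf hD) cabsM cabsX cabsM cabsi mul1r cabs_int size_nseq.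
have h2 : cabs (fc f z) <= 2 * D * (r * expR (- (lam * om r))).
  rewrite -(ler_pM2l (exprn_gt0 j r0)); apply: le_trans h1 _.
  apply: le_trans (_ : 2 * (D * (r * r ^+ j * expR (- (lam * om r)))) <= _).
    by rewrite ler_pM2l// ler_wpM2l.
  by rewrite le_eqVlt; apply/orP; left; apply/eqP; ring.
have h3 : r * expR (- (lam * om r)) <= C1 * expR (- (lam / 2 * om r)).
  have -> : - (lam / 2 * om r) = lam / 2 * om r + - (lam * om r) by field.
  rewrite expRD mulrA ler_pM2r ?expR_gt0//.
  by apply: le_trans (hC1 r (ltW r0)); rewrite lerDr.
have h4 : expR (- (lam / 2 * om r)) <= expR (- (d * ow om z)).
  rewrite ler_expR lerN2 /d mulrAC ler_pdivrMr// -[leRHS]mulrA ler_pM2l// mulrC.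
  apply: le_trans (om_natmul sub n (ltW r0)).
  apply: om_mono => //; first exact: nz_ge0.
  by apply: le_trans hi _; rewrite ler_pM2r// ler_nat.
apply: le_trans h2 _.
apply: le_trans (_ : 2 * D * (C1 * expR (- (d * ow om z))) <= _).
  rewrite ler_wpM2l//; first by rewrite mulr_ge0.
  by apply: le_trans h3 _; rewrite ler_pM2l.
have : 0 <= C2 * D * expR (- (d * ow om z)) by rewrite !mulr_ge0 ?expR_ge0// ltW.
lra.
Qed.

Lemma inEomP f : inEom om f <-> [/\ BL f, periodicT f & fastc om (fc f)].
Proof.
split=> [[hf [pf [lam [l0 [D hD]]]]]|[hf pf hc]]; last exact: inEom_of_fc.
have [d [C [d0 C0 h]]] := fc_fast l0.
split => //; first exact: BL_dseq [::] hf hD.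
by exists d, (C * D); split => //; exact: h.
Qed.

Lemma inEom_ser f : inEom om f -> ser (fc f) f.
Proof. by move=> /inEomP[hf pf hc]; exact: ser_fc hf pf hc. Qed.

End UltraFunctions.

Section Reindexing.
Variables (R : realType) (I J : eqType).

Lemma is_csum_reindex (h : J -> I) (c : I -> R[i]) S : injective h ->
  (forall i, (forall j, i != h j) -> c i = 0) ->
  is_csum c S -> is_csum (fun j => c (h j)) S.
Proof.
move=> hinj c0 hS e e0; have [s0 h0] := hS e e0.
have /choice[pre hpre] : forall i, exists t : seq J, forall j, h j = i -> j \in t.
  move=> i; case: (pselect (exists j, h j = i)) => [[j hj]|nj].
    by exists [:: j] => k hk; rewrite inE; apply/eqP/hinj; rewrite hk hj.
  by exists [::] => j hj; case: nj; exists j.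
exists (flatten (map pre s0)) => t ut st.
pose s := map h t ++ [seq i <- undup s0 | i \notin map h t].
have us : uniq s.
  rewrite cat_uniq map_inj_uniq// ut filter_uniq ?undup_uniq//= andbT.
  by apply/hasPn => i; rewrite mem_filter => /andP[].
have s0s : {subset s0 <= s}.
  move=> i hi; rewrite mem_cat mem_filter mem_undup hi andbT.
  by case: (i \in map h t).
have := h0 s us s0s; rewrite big_cat /= big_map [X in _ - (_ + X)]big1_seq ?addr0//.
move=> i /andP[_]; rewrite mem_filter mem_undup => /andP[hi si]; apply: c0 => j.
apply: contra hi => /eqP ij; rewrite ij map_f//.
by apply: st; apply/flattenP; exists (pre i); [exact: map_f|exact: hpre].
Qed.

End Reindexing.

(** * The dual of E read on Fourier coefficients *)

Section DualCoefficients.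
Variables (R : realType) (om : R -> R).
Hypotheses (wf : weight_function om) (sub : om_subadditive om).
Variable n : nat.
Implicit Types (f g : 'rV[R]_n -> R[i]) (z : 'rV[int]_n) (u : 'rV[int]_n -> R[i]).
Implicit Types mu nu : ('rV[R]_n -> R[i]) -> R[i].

Definition slow u := forall e : R, 0 < e ->
  exists C : R, forall z, cabs (u z) <= C * expR (e * ow om z).

Lemma small_inv (e : R) : 0 < e -> exists k : nat, (k.+1%:R)^-1 <= e.
Proof.
move=> e0; exists (Num.truncn e^-1).
have h : e^-1 < (Num.truncn e^-1).+1%:R by rewrite truncnS_gt// invr_ge0 ltW.
by rewrite invf_ple ?posrE// ltW.
Qed.

Lemma fastc_eq (c d : 'rV[int]_n -> R[i]) : c =1 d -> fastc om c -> fastc om d.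
Proof. by move=> /funext ->. Qed.

Lemma fastc_cond (P : pred 'rV[int]_n) (c : 'rV[int]_n -> R[i]) : fastc om c ->
  fastc om (fun z => if P z then c z else 0).
Proof.
move=> [d [C [d0 h]]]; exists d, C; split => // z; case: ifP => // _.
by rewrite cabs0 mulr_ge0 ?expR_ge0// (fast_ge0 h).
Qed.

Lemma fast_finite (s : seq 'rV[int]_n) (c : 'rV[int]_n -> R[i]) :
  (forall z, z \notin s -> c z = 0) -> fastc om c.
Proof.
move=> hc; exists 1, (\sum_(z <- undup s) cabs (c z) * expR (1 * ow om z)); split => // z.
rewrite expRN ler_pdivlMr ?expR_gt0//.
case: (boolP (z \in s)) => zs; last first.
  rewrite hc// cabs0 mul0r; apply: sumr_ge0 => y _; by rewrite mulr_ge0 ?cabs_ge0 ?expR_ge0.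
rewrite (bigD1_seq z) ?mem_undup ?undup_uniq//= lerDl; apply: sumr_ge0 => y _.
by rewrite mulr_ge0 ?cabs_ge0 ?expR_ge0.
Qed.

Lemma ser_ee z : ser (fun y => (y == z)%:R) (ee z : 'rV[R]_n -> R[i]).
Proof.
move=> x; have := @is_csum_single R _ (fun y => (y == z)%:R * ee y x) z.
rewrite eqxx mul1r; apply => y /negbTE ->; exact: mul0r.
Qed.

Lemma fastc_delta z : fastc om (fun y => (y == z)%:R).
Proof. by apply: (@fast_finite [:: z]) => y; rewrite inE => /negbTE ->. Qed.

Lemma inEom_ee z : inEom om (ee z : 'rV[R]_n -> R[i]).
Proof. exact (ser_inEom wf (fastc_delta z) (ser_ee z)). Qed.

Lemma fastcD (c d : 'rV[int]_n -> R[i]) : fastc om c -> fastc om d ->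
  fastc om (fun z => c z + d z).
Proof.
move=> [p [C [p0 hC]]] [q [D [q0 hD]]].
exists (Num.min p q), (C + D); split; first by rewrite lt_min p0.
move=> z; apply: le_trans (cabsD _ _) _; rewrite mulrDl lerD//.
  by apply: (fast_mono wf _ (lexx C) hC); rewrite ge_min lexx.
by apply: (fast_mono wf _ (lexx D) hD); rewrite ge_min lexx orbT.
Qed.

Lemma fastcZ a (c : 'rV[int]_n -> R[i]) : fastc om c -> fastc om (fun z => a * c z).
Proof.
move=> [p [C [p0 hC]]]; exists p, (cabs a * C); split => // z.
by rewrite cabsM -mulrA ler_wpM2l ?cabs_ge0.
Qed.

Lemma inEomD f g : inEom om f -> inEom om g -> inEom om (fun x => f x + g x).
Proof.
move=> /(inEomP wf sub)[h1 h2 h3] /(inEomP wf sub)[k1 k2 k3].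
apply/(inEomP wf sub); split; first exact: BLD.
  by move=> i x; rewrite h2 k2.
apply: fastc_eq (fastcD h3 k3) => z; by rewrite fcD.
Qed.

Lemma inEomZ a f : inEom om f -> inEom om (fun x => a * f x).
Proof.
move=> /(inEomP wf sub)[h1 h2 h3].
apply/(inEomP wf sub); split; first exact: BLZ.
  by move=> i x; rewrite h2.
apply: fastc_eq (fastcZ a h3) => z; by rewrite fcZ.
Qed.

Lemma inEom_sum (K : Type) (r : seq K) (F : K -> 'rV[R]_n -> R[i]) :
  (forall k, inEom om (F k)) -> inEom om (fun x => \sum_(k <- r) F k x).
Proof.
move=> h; elim: r => [|k r IH].
  rewrite (_ : (fun x => _) = fun x => 0 * ee 0 x); last first.
    by apply/funext => x; rewrite big_nil mul0r.
  exact: inEomZ (inEom_ee 0).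
rewrite (_ : (fun x => _) = fun x => F k x + \sum_(k <- r) F k x); last first.
  by apply/funext => x; rewrite big_cons.
exact: inEomD.
Qed.

Lemma inEom_pd f i : inEom om f -> inEom om (pd i f).
Proof.
move=> hf; have /(inEomP wf sub)[h1 h2 h3] := hf.
exact (ser_inEom wf (fastc_pd wf i h3) (ser_pd wf i h3 (inEom_ser wf sub hf))).
Qed.

Lemma fc_pd_E f i z : inEom om f -> fc (pd i f) z = 'i%C * (z 0 i)%:~R * fc f z.
Proof.
move=> hf; have /(inEomP wf sub)[h1 h2 h3] := hf.
exact (fc_ser wf (fastc_pd wf i h3) (ser_pd wf i h3 (inEom_ser wf sub hf)) z).
Qed.

Lemma dualZ mu a f : inEdualom om mu -> inEom om f -> mu (fun x => a * f x) = a * mu f.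
Proof.
move=> [lin _] hf; have := lin f f a 0 hf hf; rewrite mul0r addr0 => <-.
by congr mu; apply/funext => x; rewrite mul0r addr0.
Qed.

Lemma dualD mu f g : inEdualom om mu -> inEom om f -> inEom om g ->
  mu (fun x => f x + g x) = mu f + mu g.
Proof.
move=> [lin _] hf hg; have := lin f g 1 1 hf hg; rewrite !mul1r => <-.
by congr mu; apply/funext => x; rewrite !mul1r.
Qed.

Lemma dual_sum mu (K : Type) (r : seq K) (F : K -> 'rV[R]_n -> R[i]) :
  inEdualom om mu -> (forall k, inEom om (F k)) ->
  mu (fun x => \sum_(k <- r) F k x) = \sum_(k <- r) mu (F k).
Proof.
move=> hmu h; elim: r => [|k r IH].
  rewrite big_nil -[RHS](mul0r (mu (ee 0))) -(dualZ 0 hmu (inEom_ee 0)).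
  by congr mu; apply/funext => x; rewrite big_nil mul0r.
rewrite big_cons -IH -(dualD hmu (h k) (inEom_sum r h)).
by congr mu; apply/funext => x; rewrite big_cons.
Qed.

(** A character has norm at most a constant times [exp (lam omega)] in the step of parameter [lam],
    and [mu] is bounded on the steps of arbitrarily small parameter. *)
Lemma dual_ee_slow mu : inEdualom om mu -> slow (fun z => mu (ee z)).
Proof.
move=> [_ bd] e e0; have [k hk] := small_inv e0.
have [C [C0 hC]] := bd k; have l0 : 0 < (k.+1%:R)^-1 :> R by rewrite invr_gt0.
set lam := (k.+1%:R)^-1 in hk hC l0.
exists (C * expR (lam * om 1)) => z.
have b : bsum (fun y => cabs ((y == z)%:R : R[i]) * expR (lam * ow om y)) (expR (lam * ow om z)).
  move=> s us; case: (boolP (z \in s)) => zs.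
    rewrite (bigD1_seq z)//= eqxx cabs1 mul1r big1 ?addr0// => y /negbTE ->.
    by rewrite cabs0 mul0r.
  rewrite big1_seq ?expR_ge0// => y /andP[_ ys]; case: eqVneq => [e1|_].
    by move: zs; rewrite -e1 ys.
  by rewrite cabs0 mul0r.
have hn := ser_normle wf (fastc_delta z) (ser_ee z) l0 b.
have [h1 [h2 _]] := inEom_ee z.
apply: le_trans (hC _ _ h1 h2 hn) _; rewrite mulrA ler_wpM2l ?mulr_ge0 ?expR_ge0//.
by rewrite ler_expR ler_wpM2r// ow_ge0.
Qed.

Lemma fast_slow_bsum (c u : 'rV[int]_n -> R[i]) : fastc om c -> slow u ->
  exists W, bsum (fun z => cabs (c z * u z)) W.
Proof.
move=> /(fast_weighted wf)[d [W [d0 W0 hW]]] hu.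
have [C hC] := hu d d0.
have C0 : 0 <= `|C| by [].
exists (`|C| * W); apply: bsum_le (bsumZ C0 hW) => z.
rewrite cabsM mulrCA ler_wpM2l ?cabs_ge0//; apply: le_trans (hC z) _.
by rewrite ler_wpM2r ?expR_ge0// ler_norm.
Qed.

(** Continuity of [mu] is available on each Banach step separately. A step with [1 / (k + 1)] at
    most the rate of [f] contains [f], and there the Fourier series converges in norm, so [mu] may
    be applied termwise. *)
Lemma dual_ser mu f : inEdualom om mu -> inEom om f ->
  is_csum (fun z => fc f z * mu (ee z)) (mu f).
Proof.
move=> hmu hf; have /(inEomP wf sub)[h1 h2 hc] := hf.
have [d [W [d0 W0 hW]]] := fast_weighted wf hc.
have [k hk] := small_inv d0.
have l0 : 0 < (k.+1%:R)^-1 :> R by rewrite invr_gt0.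
set lam := (k.+1%:R)^-1 in hk l0.
have hWl : bsum (fun z => cabs (fc f z) * expR (lam * ow om z)) W.
  apply: bsum_le hW => z; rewrite ler_wpM2l ?cabs_ge0// ler_expR ler_wpM2r//.
  exact: ow_ge0.
have [C [C0 hC]] := hmu.2 k.
have p0 : 0 < C * expR (lam * om 1) + 1 by rewrite ltr_wpDl// mulr_ge0 ?expR_ge0.
move=> e e0.
have w0 z : 0 <= cabs (fc f z) * expR (lam * ow om z).
  by rewrite mulr_ge0 ?cabs_ge0 ?expR_ge0.
have [s0 [us0 hs0]] := bsum_tail w0 hWl (divr_gt0 e0 p0).
exists s0 => s us ss.
pose c z := if z \notin s then fc f z else 0.
have hcc : fastc om c := fastc_cond (fun z => z \notin s) hc.
pose T x := \sum_(z <- s) fc f z * ee z x.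
have hT : inEom om T by apply: inEom_sum => z; apply/inEomZ/inEom_ee.
have hser : ser c (fun x => f x + -1 * T x).
  move=> x.
  have h3 : is_csum (fun z => if z \in s then fc f z * ee z x else 0) (T x).
    move=> e' e0'; exists s => r ur sr.
    rewrite (sum_subset _ us ur sr) [X in _ - (_ + X)]big1 ?addr0; last first.
      by move=> z /negbTE ->.
    rewrite /T (eq_big_seq (fun z => if z \in s then fc f z * ee z x else 0)).
      by rewrite subrr cabs0 ltW.
    by move=> z ->.
  apply: eq_is_csum (is_csumD (inEom_ser wf sub hf x) (is_csumZ (-1) h3)) => z.
  by rewrite /c; case: (z \in s); rewrite /= ?mulr0 ?addr0//; ring.
have bc : bsum (fun z => cabs (c z) * expR (lam * ow om z)) (e / (C * expR (lam * om 1) + 1)).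
  move=> r ur; rewrite (bigID (fun z => z \notin s)) /= [X in _ + X]big1 ?addr0; last first.
    by move=> z; rewrite /c => /negbTE ->; rewrite cabs0 mul0r.
  rewrite (eq_bigr (fun z => cabs (fc f z) * expR (lam * ow om z))); last first.
    by move=> z; rewrite /c => ->.
  rewrite -big_filter; apply: hs0; first exact: filter_uniq.
  by move=> z; rewrite mem_filter => /andP[zs _]; apply: contra zs; exact: ss.
have hn := ser_normle wf hcc hser l0 bc.
have [k1 [k2 _]] := ser_inEom wf hcc hser.
have := hC _ _ k1 k2 hn.
rewrite (dualD hmu hf (inEomZ (-1) hT)) (dualZ (-1) hmu hT) mulN1r.
have -> : mu T = \sum_(z <- s) fc f z * mu (ee z).
  rewrite /T dual_sum//; last by move=> z; apply/inEomZ/inEom_ee.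
  apply: eq_bigr => z _; rewrite dualZ//; exact: inEom_ee.
move=> h; apply: le_trans h _; rewrite !mulrA ler_pdivrMr//.
by rewrite mulrC ler_pM2l// lerDl.
Qed.

Lemma dual_ext mu nu : inEdualom om mu -> inEdualom om nu ->
  (forall z, mu (ee z) = nu (ee z)) -> forall f, inEom om f -> mu f = nu f.
Proof.
move=> hmu hnu e f hf; apply: is_csum_inj (dual_ser hmu hf) _.
by apply: eq_is_csum (dual_ser hnu hf) => z; rewrite e.
Qed.

Definition tpn : R[i] := ((2 * pi) ^+ n)%:C%C.
Lemma tpn_neq0 : tpn != 0.
Proof.
by rewrite /tpn (inj_eq (@complexI R) _ 0) expf_neq0// gt_eqF// twopi_gt0.
Qed.

(** Normalised so that the distribution of a function [g] has the coefficients [fc g]. *)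
Definition mc mu z : R[i] := tpn^-1 * mu (ee (- z)).

Lemma mcE mu z : mu (ee (- z)) = tpn * mc mu z.
Proof. by rewrite /mc mulrA divff ?tpn_neq0// mul1r. Qed.

Lemma mc_slow mu : inEdualom om mu -> slow (mc mu).
Proof.
move=> hmu e e0; have [C hC] := dual_ee_slow hmu e0.
exists (cabs tpn^-1 * C) => z; rewrite /mc cabsM -mulrA ler_wpM2l ?cabs_ge0//.
by apply: le_trans (hC (- z)) _; rewrite owN.
Qed.

(** The inverse of [mc]. Off E the sum may diverge and [csum] then takes a conventional value; only
    values on E are ever used. *)
Definition dual_of u : ('rV[R]_n -> R[i]) -> R[i] :=
  fun f => tpn * csum (fun z => fc f z * u (- z)).

Lemma slowN u : slow u -> slow (fun z => u (- z)).
Proof. by move=> h e e0; have [C hC] := h e e0; exists C => z; rewrite -(owN om z). Qed.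

Lemma dual_of_csum u f : slow u -> inEom om f ->
  is_csum (fun z => fc f z * u (- z)) (csum (fun z => fc f z * u (- z))).
Proof.
move=> hu /(inEomP wf sub)[_ _ hc].
have [W hW] := fast_slow_bsum hc (slowN hu); exact: csumP hW.
Qed.

Lemma dual_of_dual u : slow u -> inEdualom om (dual_of u).
Proof.
move=> hu; split.
  move=> f g a b hf hg; rewrite /dual_of !(mulrCA _ tpn) -mulrDr; congr (_ * _).
  apply: csumE; have h1 := is_csumZ a (dual_of_csum hu hf).
  have h2 := is_csumZ b (dual_of_csum hu hg).
  apply: eq_is_csum (is_csumD h1 h2) => z.
  have /(inEomP wf sub)[bf _ _] := hf; have /(inEomP wf sub)[bg _ _] := hg.
  by rewrite fcD ?fcZ//; [ring|exact: BLZ|exact: BLZ].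
move=> k; have l0 : 0 < (k.+1%:R)^-1 :> R by rewrite invr_gt0.
have [d [C [d0 C0 h]]] := fc_fast wf sub n l0.
have d2 : 0 < d / 2 by lra.
have [B hB] := hu _ d2; have [W W0 hW] := bsum_ow wf n d2.
exists (cabs tpn * (C * `|B| * W)); split.
  by rewrite mulr_ge0 ?cabs_ge0// !mulr_ge0// ltW.
move=> f D sf pf hD; have D0 := normle_ge0 hD.
have hf : inEom om f by split => //; split => //; exists (k.+1%:R)^-1; split => //; exists D.
rewrite /dual_of cabsM -mulrA ler_wpM2l ?cabs_ge0//.
apply: (is_csum_le (dual_of_csum hu hf)).
have p : 0 <= C * `|B| * D by rewrite !mulr_ge0// ltW.
rewrite (_ : C * `|B| * W * D = C * `|B| * D * W); last by ring.
apply: bsum_le (bsumZ p hW) => z; rewrite cabsM.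
apply: le_trans (_ : (C * D * expR (- (d * ow om z))) * (`|B| * expR (d / 2 * ow om z)) <= _).
  rewrite ler_pM ?cabs_ge0//; first exact: h.
  apply: le_trans (hB (- z)) _; rewrite owN ler_wpM2r ?expR_ge0// ler_norm//.
rewrite mulrACA -expRD.
have -> : - (d * ow om z) + d / 2 * ow om z = - (d / 2 * ow om z) by field.
by rewrite le_eqVlt; apply/orP; left; apply/eqP; ring.
Qed.

Lemma dual_of_ee u z : dual_of u (ee (- z)) = tpn * u z.
Proof.
rewrite /dual_of; congr (_ * _); apply: csumE.
have := @is_csum_single R _ (fun y => fc (ee (- z)) y * u (- y)) (- z).
rewrite fc_ee eqxx mul1r opprK; apply => y hy.
by rewrite fc_ee eq_sym (negbTE hy) mul0r.
Qed.

Lemma mc_dual_of u : mc (dual_of u) =1 u.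
Proof. by move=> z; rewrite /mc dual_of_ee mulKf// tpn_neq0. Qed.

Lemma fun_as_dist_dual g : BL g -> inEdualom om (fun_as_dist g).
Proof.
move=> hg; have [K [k1 _]] := hg; rewrite /fun_as_dist; split.
  move=> f h a b /(inEomP wf sub)[bf _ _] /(inEomP wf sub)[bh _ _].
  rewrite (_ : (fun x => _) = fun x => a * (g x * f x) + b * (g x * h x)).
    by rewrite cintD ?cintZ//; [exact: BLM|exact: BLM|apply/BLZ/BLM|apply/BLZ/BLM].
  by apply/funext => x; ring.
move=> k; set lam := (k.+1%:R)^-1.
exists (cabs tpn * (2 * (`|K| * expR (lam * phistar om (0%:R / lam))))); split.
  by rewrite mulr_ge0 ?cabs_ge0// mulr_ge0// mulr_ge0 ?expR_ge0.
move=> f D sf pf hD; rewrite cint_mean cabsM -mulrA ler_wpM2l ?cabs_ge0//.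
rewrite -mulrA; apply: mean_le; first exact: BLM hg (BL_dseq [::] sf hD).
move=> x; rewrite cabsM -mulrA ler_pM ?cabs_ge0//.
  by apply: le_trans (k1 x) (ler_norm K).
by have := normle_dseq [::] x hD; rewrite mulrC.
Qed.

Lemma fun_as_dist_ee g z : fun_as_dist g (ee (- z)) = tpn * fc g z.
Proof. by rewrite /fun_as_dist cint_mean. Qed.

Lemma mc_fun g : mc (fun_as_dist g) =1 fc g.
Proof. by move=> z; rewrite /mc fun_as_dist_ee mulKf// tpn_neq0. Qed.

Lemma dual_mc_ext mu nu : inEdualom om mu -> inEdualom om nu -> mc mu =1 mc nu ->
  forall f, inEom om f -> mu f = nu f.
Proof.
move=> hmu hnu e; apply: dual_ext => // z.
by rewrite -(opprK z) !mcE e.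
Qed.

Lemma fastc_slow u : fastc om u -> slow u.
Proof.
move=> [d [C [d0 hC]]] e e0; exists C => z; apply: le_trans (hC z) _.
rewrite ler_wpM2l ?(fast_ge0 hC)// ler_expR.
have h := ow_ge0 wf z.
have := mulr_ge0 (ltW d0) h; have := mulr_ge0 (ltW e0) h; lra.
Qed.

Lemma bounded_slow u B : (forall z, cabs (u z) <= B) -> slow u.
Proof.
move=> h e e0; exists B => z; apply: le_trans (h z) _.
rewrite ler_peMr ?(le_trans (cabs_ge0 _) (h z))// -expR0 ler_expR mulr_ge0 ?(ltW e0)//.
exact: ow_ge0.
Qed.

End DualCoefficients.

(** * The operator in Fourier variables *)

Section OperatorCoefficients.
Variables (R : realType) (om : R -> R).
Hypotheses (wf : weight_function om) (sub : om_subadditive om).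
Variables (N : nat) (a b : 'I_N -> R -> R).
Hypotheses (ha : forall j, inE1_realom om (a j)) (hb : forall j, inE1_realom om (b j)).
Implicit Types (f g : 'rV[R]_N.+1 -> R[i]) (z y : 'rV[int]_N.+1) (k : 'rV[int]_1).
Implicit Types (u v : 'rV[int]_N.+1 -> R[i]).

Definition coef1 j (x : 'rV[R]_1) : R[i] := (a j (x ord0 ord0) +i* b j (x ord0 ord0))%C.
Definition coef j (x : 'rV[R]_N.+1) : R[i] := (a j (x ord0 ord0) +i* b j (x ord0 ord0))%C.
Definition cf j k : R[i] := fc (coef1 j) k.
Definition sh k : 'rV[int]_N.+1 := \row_i (if i == ord0 then k 0 0 else 0).
(** Fourier coefficients in [t] of the zeroth order term [i <xi, a + ib>]; they depend on the fibre
    of [z] only. *)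
Definition qc z k : R[i] := \sum_(j < N) 'i%C * (z 0 (lift ord0 j))%:~R * cf j k.

(* The Fourier side of [Lop a b f = g], for [u = fc f] and [v = fc g]. *)
Definition solves u v := forall z,
  is_csum (fun k => qc z k * u (z - sh k)) (v z - 'i%C * (z 0 0)%:~R * u z).

Lemma inEom_coef1 j : inEom om (coef1 j).
Proof.
rewrite (_ : coef1 j = fun x => (a j (x ord0 ord0) +i* 0)%C + 'i%C * (b j (x ord0 ord0) +i* 0)%C).
  apply: (inEomD wf sub); first exact: ha.
  apply: (inEomZ wf sub); exact: hb.
by apply/funext => x; apply: complex_ext; rewrite !ReImE /=; ring.
Qed.

Let trunc (x : 'rV[R]_N.+1) : 'rV[R]_1 := const_mx (x ord0 ord0).

Let coefE j x : coef j x = coef1 j (trunc x).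
Proof. by rewrite /coef /coef1 mxE. Qed.

Lemma sh0 k : sh k 0 0 = k 0 0. Proof. by rewrite mxE. Qed.
Lemma shS k j : sh k 0 (lift ord0 j) = 0. Proof. by rewrite mxE. Qed.
Lemma sh_inj : injective sh.
Proof.
move=> k l e; apply/rowP => i; rewrite (ord1 i).
by have := congr1 (fun z : 'rV[int]_N.+1 => z 0 0) e; rewrite !sh0.
Qed.

Lemma nz_split z : nz R z = `|z 0 0|%:~R + \sum_(j < N) `|z 0 (lift ord0 j)|%:~R.
Proof. by rewrite /nz big_ord_recl. Qed.

Lemma nz_sh k : nz R (sh k) = nz R k.
Proof.
rewrite nz_split sh0 [in RHS]/nz big_ord1 big1 ?addr0// => j _.
by rewrite shS normr0.
Qed.
Lemma ow_sh k : ow om (sh k) = ow om k. Proof. by rewrite /ow nz_sh. Qed.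

Let ee_trunc k x : ee k (trunc x) = ee (sh k) x.
Proof.
rewrite /ee; congr cis; rewrite /dot big_ord1 big_ord_recl big1 ?addr0.
  by rewrite !mxE.
by move=> j _; rewrite shS mul0r.
Qed.

Lemma subshS z k j : (z - sh k) 0 (lift ord0 j) = z 0 (lift ord0 j).
Proof. by rewrite mxE [X in _ + X]mxE shS subr0. Qed.
Lemma subsh0 z k : (z - sh k) 0 0 = z 0 0 - k 0 0.
Proof. by rewrite mxE [X in _ + X]mxE sh0. Qed.

Lemma qc_eq y z k : (forall j, y 0 (lift ord0 j) = z 0 (lift ord0 j)) -> qc y k = qc z k.
Proof. by move=> e; apply: eq_bigr => j _; rewrite e. Qed.

Lemma cf_weighted : exists d S, [/\ 0 < d, 0 < S &
  forall j, bsum (fun k => cabs (cf j k) * expR (d * ow om k)) S].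
Proof.
have /choice[p hp] : forall j, exists p : R * R, [/\ 0 < p.1, 0 < p.2 &
    bsum (fun k => cabs (cf j k) * expR (p.1 * ow om k)) p.2].
  move=> j; have /(inEomP wf sub)[_ _ hc] := inEom_coef1 j.
  by have [d [W h]] := fast_weighted wf hc; exists (d, W).
(* The two units keep both constants positive when [N = 0]. *)
exists (\big[Num.min/1]_j (p j).1), (1 + \sum_j (p j).2); split.
- apply: (big_ind (fun x => 0 < x)) => // [x y x0 y0|j _]; first by rewrite lt_min x0.
  by case: (hp j).
- by rewrite ltr_pwDl// sumr_ge0// => j _; case: (hp j) => _ /ltW.
move=> j s us; have [_ _ h] := hp j; apply: le_trans (_ : (p j).2 <= _); last first.
  rewrite (bigD1 j)//=.
  have : 0 <= \sum_(i | i != j) (p i).2.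
    by apply: sumr_ge0 => i _; case: (hp i) => _ /ltW.
  lra.
apply: le_trans (h s us); apply: ler_sum => k _.
rewrite ler_wpM2l ?cabs_ge0// ler_expR ler_wpM2r ?ow_ge0//.
by rewrite (bigD1 j)//= ge_min lexx.
Qed.

Lemma qc_weighted d S z : (forall j, bsum (fun k => cabs (cf j k) * expR (d * ow om k)) S) ->
  bsum (fun k => cabs (qc z k) * expR (d * ow om k))
    (S * \sum_(j < N) `|z 0 (lift ord0 j)|%:~R).
Proof.
move=> hS s us.
apply: le_trans (_ : \sum_(j < N) `|z 0 (lift ord0 j)|%:~R *
    \sum_(k <- s) cabs (cf j k) * expR (d * ow om k) <= _); last first.
  rewrite mulrC mulr_suml; apply: ler_sum => j _.
  by rewrite ler_wpM2l ?ler0z// hS.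
under [leRHS]eq_bigr do rewrite mulr_sumr.
rewrite exchange_big /=; apply: ler_sum => k _.
under [leRHS]eq_bigr do rewrite mulrA.
rewrite -mulr_suml ler_wpM2r ?expR_ge0//.
apply: le_trans (cabs_sum _ _) _; apply: ler_sum => j _.
by rewrite !cabsM cabsi mul1r cabs_int.
Qed.

Lemma ow_subsh z k : ow om z <= ow om (z - sh k) + ow om k.
Proof. by have := owB wf sub z (sh k); rewrite ow_sh. Qed.

(** Subadditivity gives [exp (- d ow (z - sh k)) <= exp (- d ow z) exp (d ow k)], and the last
    factor is absorbed by the weighted sum of the coefficients. *)
Lemma conv_bound d S A z u T :
  (forall j, bsum (fun k => cabs (cf j k) * expR (d * ow om k)) S) -> 0 <= S ->
  0 <= d -> 0 <= A -> (forall k, cabs (u (z - sh k)) <= A * expR (- (d * ow om (z - sh k)))) ->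
  is_csum (fun k => qc z k * u (z - sh k)) T ->
  cabs T <= S * nz R z * A * expR (- (d * ow om z)).
Proof.
move=> hS S0 d0 A0 hu hT; apply: (is_csum_le hT).
have p : 0 <= A * expR (- (d * ow om z)) by rewrite mulr_ge0 ?expR_ge0.
move=> s us; apply: le_trans (_ : \sum_(k <- s) A * expR (- (d * ow om z)) *
    (cabs (qc z k) * expR (d * ow om k)) <= _).
  apply: ler_sum => k _; rewrite cabsM [leRHS]mulrCA ler_wpM2l ?cabs_ge0//.
  apply: le_trans (hu k) _; rewrite -mulrA -expRD ler_wpM2l// ler_expR.
  have := ler_wpM2l d0 (ow_subsh z k); lra.
rewrite -mulr_sumr (_ : S * nz R z * A * _ = A * expR (- (d * ow om z)) * (S * nz R z)).
  rewrite ler_wpM2l//; apply: le_trans (qc_weighted z hS us) _.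
  by rewrite ler_wpM2l// nz_split lerDr ler0z.
ring.
Qed.

Lemma BL_coef j : BL (coef j).
Proof.
have /(inEomP wf sub)[[K [k1 k2]] _ _] := inEom_coef1 j.
exists K; split=> [x|x i h]; first by rewrite coefE.
have K0 : 0 <= K by exact: le_trans (cabs_ge0 _) (k1 0).
rewrite !coefE; case: (unliftP ord0 i) => [l ->|->].
  have -> : trunc (x + h *: 'e_(lift ord0 l)) = trunc x.
    by apply/rowP => m; rewrite !mxE /= mulr0 addr0.
  by rewrite subrr cabs0 mulr_ge0.
have -> : trunc (x + h *: 'e_ord0) = trunc x + h *: 'e_ord0.
  by apply/rowP => m; rewrite !mxE (ord1 m) !eqxx.
exact: k2.
Qed.

Lemma periodic_coef j : periodicT (coef j).
Proof.
have /(inEomP wf sub)[_ pf _] := inEom_coef1 j.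
move=> i x; rewrite !coefE; case: (unliftP ord0 i) => [l ->|->].
  by congr coef1; apply/rowP => m; rewrite !mxE /= mulr0 addr0.
by rewrite -[RHS](pf ord0); congr coef1; apply/rowP => m; rewrite !mxE (ord1 m) !eqxx.
Qed.

Lemma fc_ee_mul y f z : fc (fun x => ee y x * f x) z = fc f (z - y).
Proof.
by rewrite /fc; congr mean; apply/funext => x; rewrite opprB eeD; ring.
Qed.

(** Only the series of the coefficient is truncated. It converges uniformly, so boundedness of [f]
    suffices and no decay of [fc f] is used. *)
Lemma fc_coef j f z : BL f ->
  is_csum (fun k => cf j k * fc f (z - sh k)) (fc (fun x => coef j x * f x) z).
Proof.
move=> hf e e0; have [K [k1 _]] := hf.
have K0 : 0 <= K by exact: le_trans (cabs_ge0 _) (k1 0).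
have p0 : 0 < 2 * (K + 1) by lra.
have hE := inEom_coef1 j; have /(inEomP wf sub)[_ _ hc] := hE.
have [s0 hs0] := ser_approx wf hc (inEom_ser wf sub hE) (divr_gt0 e0 p0).
exists s0 => s us ss; have h := hs0 s us ss.
pose T x := \sum_(k <- s) cf j k * ee (sh k) x.
have hT : BL T by apply: BL_sum => k; apply: BLZ; exact: BL_ee.
have -> : \sum_(k <- s) cf j k * fc f (z - sh k) = fc (fun x => T x * f x) z.
  rewrite (_ : (fun x => T x * f x) = fun x => \sum_(k <- s) cf j k * (ee (sh k) x * f x)).
    rewrite fc_sum; last by move=> k; apply/BLZ/BLM => //; exact: BL_ee.
    apply: eq_bigr => k _; rewrite fcZ ?fc_ee_mul//; apply: BLM => //; exact: BL_ee.
  by apply/funext => x; rewrite /T mulr_suml; apply: eq_bigr => k _; rewrite mulrA.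
rewrite -fcB; [|apply: BLM => //; exact: BL_coef|exact: BLM].
have -> : e = 2 * (e / (2 * (K + 1)) * (K + 1)) by field; rewrite gt_eqF//; lra.
apply: fc_le.
  by apply: BLB; apply: BLM => //; exact: BL_coef.
move=> x; rewrite -mulrBl cabsM ler_pM ?cabs_ge0//; last first.
  by apply: le_trans (k1 x) _; lra.
rewrite coefE /T; have := h (trunc x).
by under eq_bigr do rewrite ee_trunc.
Qed.

Lemma LopE f x : Lop a b f x = pd ord0 f x + \sum_(j < N) coef j x * pd (lift ord0 j) f x.
Proof. by []. Qed.

Lemma BL_pd f i : inEom om f -> BL (pd i f).
Proof. by move=> /(inEom_pd wf sub i)/(inEomP wf sub)[]. Qed.

Lemma BL_Lop f : inEom om f -> BL (Lop a b f).
Proof.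
move=> hf; apply: BLD; first exact: BL_pd.
by apply: BL_sum => j; apply: BLM; [exact: BL_coef|exact: BL_pd].
Qed.

Lemma periodic_Lop f : inEom om f -> periodicT (Lop a b f).
Proof.
move=> [_ [pf _]] i x; rewrite !LopE (periodic_pd _ pf); congr (_ + _).
by apply: eq_bigr => j _; rewrite (periodic_pd _ pf) periodic_coef.
Qed.

Lemma fc_Lop f : inEom om f -> solves (fc f) (fc (Lop a b f)).
Proof.
move=> hf z.
have -> : fc (Lop a b f) z - 'i%C * (z 0 0)%:~R * fc f z =
    \sum_(j < N) fc (fun x => coef j x * pd (lift ord0 j) f x) z.
  rewrite (_ : Lop a b f = fun x => pd ord0 f x +
     \sum_(j < N) coef j x * pd (lift ord0 j) f x)//.
  rewrite fcD; [|exact: BL_pd|]; last first.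
    by apply: BL_sum => j; apply: BLM; [exact: BL_coef|exact: BL_pd].
  rewrite fc_sum; last by move=> j; apply: BLM; [exact: BL_coef|exact: BL_pd].
  by rewrite (fc_pd_E wf sub)// addrC addKr.
apply: eq_is_csum (is_csum_sum _ (fun j => fc_coef j z (BL_pd (lift ord0 j) hf))) => k.
rewrite /qc mulr_suml; apply: eq_bigr => j _.
rewrite (fc_pd_E wf sub)// subshS; ring.
Qed.

Lemma fast_Lop d S : 0 < d ->
  (forall j, bsum (fun k => cabs (cf j k) * expR (d * ow om k)) S) -> 0 < S ->
  exists2 B, 0 < B & forall f A, inEom om f -> fast om d A (fc f) ->
    fast om (d / 2) (B * A) (fc (Lop a b f)).
Proof.
move=> d0 hS S0; have d2 : 0 < d / 2 by lra.
have [C C0 hC] := poly_ow wf N.+1 1 d2.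
exists ((1 + S) * C); first by rewrite mulr_gt0// addr_gt0.
move=> f A hf hA z; have A0 := fast_ge0 hA.
have h1 := conv_bound hS (ltW S0) (ltW d0) A0 (fun k => hA (z - sh k)) (fc_Lop hf z).
have := cabsD (fc (Lop a b f) z - 'i%C * (z 0 0)%:~R * fc f z) ('i%C * (z 0 0)%:~R * fc f z).
rewrite subrK => h2; apply: le_trans h2 _.
have h3 : cabs ('i%C * (z 0 0)%:~R * fc f z) <= nz R z * (A * expR (- (d * ow om z))).
  rewrite (cabsM _ (fc f z)) (cabsM 'i%C) cabsi mul1r cabs_int.
  by rewrite ler_pM ?ler0z ?cabs_ge0 ?le_nz ?hA.
have h4 := hC z; rewrite expr1 in h4.
have E0 : 0 <= A * expR (- (d * ow om z)) by rewrite mulr_ge0 ?expR_ge0.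
apply: le_trans (_ : (1 + S) * ((1 + nz R z) * (A * expR (- (d * ow om z)))) <= _).
  have := mulr_ge0 (ltW S0) E0; have := nz_ge0 R z; nra.
rewrite -[(1 + S) * C * A]mulrA -[leRHS]mulrA ler_wpM2l ?addr_ge0// ?(ltW S0)//.
apply: le_trans (ler_wpM2r E0 h4) _.
have -> : - (d / 2 * ow om z) = d / 2 * ow om z + - (d * ow om z) by field.
by rewrite expRD le_eqVlt; apply/orP; left; apply/eqP; ring.
Qed.

Lemma inEom_Lop f : inEom om f -> inEom om (Lop a b f).
Proof.
move=> hf; apply/(inEomP wf sub); split; [exact: BL_Lop|exact: periodic_Lop|].
have /(inEomP wf sub)[_ _ [d [A [d0 hA]]]] := hf.
have [d1 [S [d10 S0 hS]]] := cf_weighted.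
pose d2 := Num.min d d1; have d20 : 0 < d2 by rewrite lt_min d0.
have hS2 j : bsum (fun k => cabs (cf j k) * expR (d2 * ow om k)) S.
  apply: bsum_le (hS j) => k; rewrite ler_wpM2l ?cabs_ge0// ler_expR ler_wpM2r ?ow_ge0//.
  by rewrite ge_min lexx orbT.
have [B B0 hB] := fast_Lop d20 hS2 S0.
exists (d2 / 2), (B * A); split; first lra.
by apply: hB => //; apply: (fast_mono wf _ (lexx A) hA); rewrite ge_min lexx.
Qed.

Lemma pd_lin f g i (p q : R[i]) x : inEom om f -> inEom om g ->
  pd i (fun x => p * f x + q * g x) x = p * pd i f x + q * pd i g x.
Proof.
move=> [sf _] [sg _].
have h1 := smooth_cder [::] i x sf; have h2 := smooth_cder [::] i x sg.
have h : cder (line (fun x => p * f x + q * g x) x i) 0 (p * pd i f x + q * pd i g x).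
  exact: cderD (cderZ p h1) (cderZ q h2).
by have /cder_pdP[] := h.
Qed.

Lemma Lop_lin f g (p q : R[i]) : inEom om f -> inEom om g ->
  Lop a b (fun x => p * f x + q * g x) = fun x => p * Lop a b f x + q * Lop a b g x.
Proof.
move=> hf hg; apply/funext => x; rewrite !LopE pd_lin//.
under eq_bigr do rewrite pd_lin// mulrDr.
rewrite big_split /= !mulrDr !mulr_sumr.
under [X in _ + _ + (X + _)]eq_bigr do rewrite mulrCA.
under [X in _ + _ + (_ + X)]eq_bigr do rewrite mulrCA.
by rewrite addrACA.
Qed.

Lemma dual_Lop mu : inEdualom om mu -> inEdualom om (fun f => - mu (Lop a b f)).
Proof.
move=> hmu; split.
  move=> f g p q hf hg; rewrite Lop_lin// hmu.1; try exact: inEom_Lop.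
  by ring.
move=> k; have l0 : 0 < (k.+1%:R)^-1 :> R by rewrite invr_gt0.
have [d [C [d0 C0 h]]] := fc_fast wf sub N.+1 l0.
have [d1 [S [d10 S0 hS]]] := cf_weighted.
pose d2 := Num.min d d1; have d20 : 0 < d2 by rewrite lt_min d0.
have hS2 j : bsum (fun k => cabs (cf j k) * expR (d2 * ow om k)) S.
  apply: bsum_le (hS j) => l; rewrite ler_wpM2l ?cabs_ge0// ler_expR ler_wpM2r ?ow_ge0//.
  by rewrite ge_min lexx orbT.
have [B B0 hB] := fast_Lop d20 hS2 S0.
(* The image under [Lop] decays at rate [d2 / 2]: one quarter of [d2] is spent on the norm of the
   step [m], one quarter on summation. *)
have d40 : 0 < d2 / 4 by lra.
have [m hm] := small_inv d40; have m0 : 0 < (m.+1%:R)^-1 :> R by rewrite invr_gt0.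
have [W W0 hW] := bsum_ow wf N.+1 d40.
have [M [M0 hM]] := hmu.2 m; set lam := (m.+1%:R)^-1 in hm hM m0.
exists (M * (expR (lam * om 1) * (B * C * W))); split.
  by rewrite mulr_ge0// mulr_ge0 ?expR_ge0// ltW// !mulr_gt0.
move=> f D sf pf hD; have D0 := normle_ge0 hD.
have hf : inEom om f by split => //; split => //; exists (k.+1%:R)^-1; split => //; exists D.
have hA : fast om d2 (C * D) (fc f).
  by apply: (fast_mono wf _ (lexx _) (h f D sf pf hD)); rewrite ge_min lexx.
have hL := inEom_Lop hf; have /(inEomP wf sub)[_ _ hc] := hL.
have hF := hB f _ hf hA.
have bs : bsum (fun z => cabs (fc (Lop a b f) z) * expR (lam * ow om z)) (B * (C * D) * W).
  have p : 0 <= B * (C * D) by rewrite !mulr_ge0// ltW.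
  apply: bsum_le (bsumZ p hW) => z.
  apply: le_trans (ler_wpM2r (expR_ge0 _) (hF z)) _.
  rewrite -[leLHS]mulrA -expRD ler_wpM2l// ler_expR.
  have := ler_wpM2r (ow_ge0 wf z) hm; lra.
have hn := ser_normle wf hc (inEom_ser wf sub hL) m0 bs.
have := hM _ _ hL.1 hL.2.1 hn; rewrite cabsN.
by congr (_ <= _); ring.
Qed.

Lemma Lop_unique f g : inEom om f -> inEom om g -> solves (fc f) (fc g) -> Lop a b f = g.
Proof.
move=> hf hg h; have /(inEomP wf sub)[bg pg _] := hg.
apply: fourier_unique; [exact: BL_Lop|exact: bg|exact: periodic_Lop|exact: pg|].
move=> z; exact: addIr (is_csum_inj (fc_Lop hf z) (h z)).
Qed.

(** Apply [mu] to the Fourier expansion of [Lop a b (ee (- z))]. Apart from the tau term, only the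
    frequencies [sh k - z] occur, with coefficient [- qc z k], and reindexing gives the convolution
    with the coefficients of [mu]. *)
Lemma dual_solves mu : inEdualom om mu ->
  solves (mc mu) (fun z => - (mc (fun f => mu (Lop a b f)) z)).
Proof.
move=> hmu z; rewrite /mc.
have hE := inEom_ee wf (- z); have hL := inEom_Lop hE.
have h1 := dual_ser wf sub hmu hL.
pose T y := fc (Lop a b (ee (- z))) y - 'i%C * (y 0 0)%:~R * fc (ee (- z)) y.
have hT y : is_csum (fun k => qc y k * fc (ee (- z)) (y - sh k)) (T y) by exact: fc_Lop.
have h2 : is_csum (fun y => T y * mu (ee y))
    (mu (Lop a b (ee (- z))) - 'i%C * (- z 0 0)%:~R * mu (ee (- z))).
  have h3 : is_csum (fun y => 'i%C * (y 0 0)%:~R * fc (ee (- z)) y * mu (ee y))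
      ('i%C * (- z 0 0)%:~R * mu (ee (- z))).
    have := @is_csum_single R _
      (fun y => 'i%C * (y 0 0)%:~R * fc (ee (- z)) y * mu (ee y)) (- z).
    rewrite fc_ee eqxx mulr1 mxE; apply => y hy.
    by rewrite fc_ee eq_sym (negbTE hy) mulr0 mul0r.
  by apply: eq_is_csum (is_csumD h1 (is_csumN h3)) => y; rewrite /T mulrBl.
have shiftinj : injective (fun k => sh k - z).
  by move=> k l /addIr /sh_inj.
have T0 y : (forall k, y != sh k - z) -> T y * mu (ee y) = 0.
  move=> hy; rewrite (_ : T y = 0) ?mul0r//; apply: is_csum_inj (hT y) _.
  apply: eq_is_csum (@is_csum0 R _) => k; rewrite fc_ee.
  case: eqVneq => [e|]; last by rewrite mulr0.
  by case/eqP: (hy k); rewrite e addrC subrK.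
have TE k : T (sh k - z) = - qc z k.
  apply: is_csum_inj (hT _) _.
  have := @is_csum_single R _ (fun l => qc (sh k - z) l * fc (ee (- z)) (sh k - z - sh l)) k.
  have -> : sh k - z - sh k = - z by rewrite addrAC subrr add0r.
  rewrite fc_ee eqxx [qc _ _ * _]mulr1.
  have -> : qc (sh k - z) k = - qc z k.
    rewrite /qc -sumrN; apply: eq_bigr => j _; rewrite mxE shS add0r mxE rmorphN /=; ring.
  apply=> l lk; rewrite fc_ee; case: eqVneq => [e|]; last by rewrite mulr0.
  have : sh k = sh l.
    apply/eqP; rewrite -subr_eq0; apply/eqP.
    have := congr1 (fun y => y + z) e; rewrite addNr => ->.
    by rewrite addrAC subrK.
  by move/sh_inj => e2; rewrite e2 eqxx in lk.
have := is_csumZ (- (tpn R N.+1)^-1) (is_csum_reindex shiftinj T0 h2).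
have -> : - (tpn R N.+1)^-1 * (mu (Lop a b (ee (- z))) - 'i%C * (- z 0 0)%:~R * mu (ee (- z))) =
  - ((tpn R N.+1)^-1 * mu (Lop a b (ee (- z)))) - 'i%C * (z 0 0)%:~R * ((tpn R N.+1)^-1 * mu (ee (- z))).
  by rewrite rmorphN /=; ring.
apply: eq_is_csum => k; rewrite TE opprB; ring.
Qed.

Lemma dist_solves mu g : inEdualom om mu ->
  (forall f, inEom om f -> - mu (Lop a b f) = fun_as_dist g f) -> solves (mc mu) (fc g).
Proof.
move=> hmu h z; have := dual_solves hmu z.
have -> : - mc (fun f => mu (Lop a b f)) z = fc g z.
  by rewrite -(mc_fun g z) /mc -h; [ring|exact: inEom_ee].
exact.
Qed.

Lemma solves_dist u g : slow om u -> BL g -> solves u (fc g) ->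
  forall f, inEom om f -> - dual_of u (Lop a b f) = fun_as_dist g f.
Proof.
move=> hu hg h; have hd := dual_of_dual wf sub hu.
apply: (dual_mc_ext wf sub (dual_Lop hd) (fun_as_dist_dual wf sub hg)) => z.
rewrite mc_fun; have := dual_solves hd z; have := h z.
have -> : (fun k => qc z k * mc (dual_of u) (z - sh k)) = (fun k => qc z k * u (z - sh k)).
  by apply/funext => k; rewrite mc_dual_of.
move=> h1 h2; transitivity (- mc (fun f => dual_of u (Lop a b f)) z).
  by rewrite /mc mulrN.
apply: (@addIr _ (- ('i%C * (z 0 0)%:~R * u z))); rewrite (is_csum_inj h1 h2).
by congr (_ - _ * _); rewrite mc_dual_of.
Qed.

Lemma solves_ker u : slow om u -> solves u (fun=> 0) ->
  forall f, inEom om f -> dual_of u (Lop a b f) = 0.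
Proof.
move=> hu h f hf; apply/eqP; rewrite -oppr_eq0; apply/eqP.
have hg : BL (fun _ : 'rV[R]_N.+1 => 0 : R[i]) by exact: BL_cst.
rewrite (solves_dist hu hg)//.
  rewrite /fun_as_dist (_ : (fun x => _) = fun x => 0 * ee 0 x); last first.
    by apply/funext => x; rewrite !mul0r.
  by rewrite cintZ ?mul0r//; exact: BL_ee.
move=> z; have -> : fc (fun _ : 'rV[R]_N.+1 => 0 : R[i]) z = 0.
  rewrite (_ : (fun _ => 0) = fun x : 'rV[R]_N.+1 => 0 * ee 0 x); last first.
    by apply/funext => x; rewrite mul0r.
  by rewrite fcZ ?mul0r//; exact: BL_ee.
exact: h.
Qed.

End OperatorCoefficients.

(** * Automatic decay in the tau direction *)

Section Bootstrap.
Variables (R : realType) (om : R -> R).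
Hypotheses (wf : weight_function om) (sub : om_subadditive om).
Implicit Types (t s : int) (k : 'rV[int]_1).

Definition aw t : R := om `|t|%:~R.

Lemma aw_ge0 t : 0 <= aw t. Proof. by apply: om_ge0 => //; rewrite ler0z. Qed.

Lemma ow_aw k : ow om k = aw (k 0 0).
Proof. by rewrite /ow /nz big_ord1. Qed.

Lemma aw_tri t s : aw t <= aw (t - s) + aw s.
Proof.
rewrite /aw; apply: le_trans (sub _ _); rewrite ?ler0z//.
apply: om_mono => //; rewrite ?ler0z// -intrD ler_int.
by have := ler_normD (t - s) s; rewrite subrK.
Qed.

Lemma awN t : aw (- t) = aw t. Proof. by rewrite /aw normrN. Qed.

(* The weights [exp (d * min (aw, 2 r - aw))] are submultiplicative like
   [exp (d * aw)], but decay at infinity: they give finite suprema for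
   coefficients of distributions, uniformly in r. *)
Lemma bootstrap (d Q L M B G : R) (q : 'rV[int]_1 -> R[i]) (v w : int -> R[i]) (l : R[i]) :
  0 <= d -> bsum (fun k => cabs (q k) * expR (d * ow om k)) Q -> cabs l <= L ->
  1 <= M -> 2 * (Q + L) <= M -> 0 <= B -> 0 <= G ->
  (exists C, forall t, cabs (v t) <= C * expR (d * aw t)) ->
  (forall t, `|t|%:~R < M -> cabs (v t) * expR (d * aw t) <= B) ->
  (forall t, cabs (w t) * expR (d * aw t) <= G) ->
  (forall t, is_csum (fun k => q k * v (t - k 0 0)) (w t - ('i%C * t%:~R - l) * v t)) ->
  forall t, cabs (v t) <= 2 * (B + G) * expR (- (d * aw t)).
Proof.
move=> d0 hQ hl M1 QM B0 G0 [C hC] hB hG heq t0.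
pose r := aw t0; pose p t := Num.min (aw t) (2 * r - aw t).
pose W t := expR (d * p t).
have W0 t : 0 < W t by exact: expR_gt0.
have Wle t : W t <= expR (d * aw t).
  by rewrite ler_expR ler_wpM2l// ge_min lexx.
(* Both [aw] and [- aw] change by at most [aw s] under a shift by [s], and a minimum inherits
   this. *)
have Wmod t s : W t <= W (t - s) * expR (d * aw s).
  rewrite -expRD ler_expR -mulrDr ler_wpM2l//.
  have h1 := aw_tri t s; have h2 := aw_tri (t - s) (- s).
  rewrite opprK subrK awN in h2; rewrite /p -lerBlDr le_min; apply/andP; split.
    by have : Num.min (aw t) (2 * r - aw t) <= aw t by [rewrite ge_min lexx]; lra.
  have : Num.min (aw t) (2 * r - aw t) <= 2 * r - aw t by rewrite ge_min lexx orbT.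
  lra.
pose A := [set W t * cabs (v t) | t in [set: int]].
have A0 : A !=set0 by exists (W 0 * cabs (v 0)), 0.
have C0 : 0 <= C.
  have := le_trans (cabs_ge0 _) (hC 0); by rewrite pmulr_lge0// expR_gt0.
(* The declining branch of the weight cancels the growth [C * expR (d * aw t)]; the resulting bound
   depends on [r], but serves only to make [V] finite. *)
have hA : has_ubound A.
  exists (C * expR (2 * r * d)) => _ [t _ <-].
  apply: le_trans (_ : expR (d * (2 * r - aw t)) * (C * expR (d * aw t)) <= _).
    rewrite ler_pM ?cabs_ge0 ?(ltW (W0 t))//.
    by rewrite ler_expR ler_wpM2l// ge_min lexx orbT.
  rewrite mulrCA -expRD ler_wpM2l// ler_expR; lra.
pose V := sup A.
have hV t : W t * cabs (v t) <= V by apply: ub_le_sup => //; exists t.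
have V0 : 0 <= V by apply: le_trans (hV 0); rewrite mulr_ge0 ?cabs_ge0// ltW.
have L0 : 0 <= L by exact: le_trans (cabs_ge0 _) hl.
have Q0 : 0 <= Q by exact: bsum_ge0 hQ.
(* For [|t| >= M] the convolution and the term in [l] are together at most [(Q + L) V], hence half
   of [M V]; finiteness of [V] then allows absorption. *)
have step t : W t * cabs (v t) <= B + G + V / 2.
  case: (ltP `|t|%:~R M) => tM.
    apply: le_trans (_ : B <= _); last lra.
    by apply: le_trans (hB t tM); rewrite mulrC ler_wpM2l ?cabs_ge0.
  have h1 : cabs (w t - ('i%C * t%:~R - l) * v t) * W t <= Q * V.
    rewrite -ler_pdivlMr//; apply: (is_csum_le (heq t)).
    have VW : 0 <= V / W t by rewrite divr_ge0// ltW.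
    have -> : Q * V / W t = V / W t * Q by rewrite -mulrA mulrC.
    apply: bsum_le (bsumZ VW hQ) => k.
    rewrite cabsM [leRHS]mulrCA ler_wpM2l ?cabs_ge0// mulrAC ler_pdivlMr// ow_aw.
    apply: le_trans (_ : cabs (v (t - k 0 0)) * (W (t - k 0 0) * expR (d * aw (k 0 0))) <= _).
      by rewrite ler_wpM2l ?cabs_ge0.
    by rewrite mulrA ler_wpM2r ?expR_ge0// mulrC.
  have h2 : cabs (w t) * W t <= G.
    by apply: le_trans (hG t); rewrite ler_wpM2l ?cabs_ge0.
  have h3 : `|t|%:~R * cabs (v t) <= cabs (w t - ('i%C * t%:~R - l) * v t) + cabs (w t) + L * cabs (v t).
    have e : 'i%C * t%:~R * v t = - (w t - ('i%C * t%:~R - l) * v t) + w t + l * v t by ring.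
    have -> : `|t|%:~R * cabs (v t) = cabs ('i%C * t%:~R * v t).
      by rewrite !cabsM cabsi mul1r cabs_int.
    rewrite e; apply: le_trans (cabsD _ _) _; rewrite cabsM lerD//.
      by apply: le_trans (cabsD _ _) _; rewrite cabsN.
    by rewrite ler_wpM2r ?cabs_ge0.
  have h4 := hV t; set X := W t * cabs (v t) in h4 *.
  have X0 : 0 <= X by rewrite mulr_ge0 ?cabs_ge0// ltW.
  have h5 : `|t|%:~R * X <= Q * V + G + L * X.
    have := ler_wpM2r (ltW (W0 t)) h3; rewrite /X; lra.
  have h6 : M * X <= M * (G + V / 2).
    apply: le_trans (_ : `|t|%:~R * X <= _); first by rewrite ler_wpM2r.
    apply: le_trans h5 _; have := ler_wpM2r V0 QM; have := ler_wpM2l L0 h4; nra.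
  have := h6; rewrite ler_pM2l; [lra|exact: lt_le_trans M1].
have hV2 : V <= B + G + V / 2.
  by apply: ge_sup => // _ [t _ <-].
have h := hV t0.
(* Both branches of the minimum equal [r] at [t0], where the weight is therefore the full
   exponential. *)
have Wt0 : W t0 = expR (d * aw t0).
  rewrite /W /p -/r (_ : 2 * r - r = r); last by ring.
  by rewrite minxx.
rewrite expRN ler_pdivlMr ?expR_gt0// -Wt0 mulrC; lra.
Qed.

(* Outside [|t| <= m (x + 1)] the term [i t v] dominates the zeroth order terms. *)
Lemma fiber_decay (S L : R) : 0 <= S -> 0 <= L -> exists m : nat,
  forall (d x H G : R) (q : 'rV[int]_1 -> R[i]) (v w : int -> R[i]) (l : R[i]),
  0 <= d -> 0 <= x -> 0 <= H -> 0 <= G ->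
  bsum (fun k => cabs (q k) * expR (d * ow om k)) (S * x) -> cabs l <= L ->
  (exists C, forall t, cabs (v t) <= C * expR (d * aw t)) ->
  (forall t, `|t|%:~R <= m%:R * (x + 1) -> cabs (v t) <= H) ->
  (forall t, cabs (w t) <= G * expR (- (d * aw t))) ->
  (forall t, is_csum (fun k => q k * v (t - k 0 0)) (w t - ('i%C * t%:~R - l) * v t)) ->
  forall t, cabs (v t) <=
    2 * (H * expR (d * (m%:R * (om x + om 1))) + G) * expR (- (d * aw t)).
Proof.
(* With this [m], the threshold [m (x + 1)] is at least 1 and at least [2 (S x + L)], as [bootstrap]
   requires; it depends on neither [d] nor the fibre. *)
move=> S0 L0; pose m := (Num.truncn (2 * S + 2 * L + 1)).+1; exists m.
have hm : 2 * S + 2 * L + 1 < m%:R by rewrite truncnS_gt//; lra.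
have m0 : 0 <= m%:R :> R by [].
move=> d x H G q v w l d0 x0 H0 G0 hq hl ap hH hG heq.
have x1 : 0 <= x + 1 by lra.
apply: (@bootstrap d (S * x) L (m%:R * (x + 1)) _ G q v w l d0 hq hl) => //.
- nra.
- nra.
- by rewrite mulr_ge0// expR_ge0.
- move=> t tM; rewrite ler_pM ?cabs_ge0 ?expR_ge0//; first by apply: hH; exact: ltW.
  rewrite ler_expR ler_wpM2l//.
  apply: le_trans (om_mono wf _ (ltW tM)) _; first by rewrite ler0z.
  apply: le_trans (om_natmul sub _ x1) _; rewrite ler_wpM2l// sub//.
- by move=> t; rewrite -ler_pdivlMr ?expR_gt0// -expRN.
Qed.

End Bootstrap.

Section Fibers.
Variables (R : realType) (om : R -> R).
Hypotheses (wf : weight_function om) (sub : om_subadditive om).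
Variable N : nat.
Implicit Types (z : 'rV[int]_N.+1) (t : int).

(** The point with first coordinate [t] on the fibre of [z]. Fibres are handled through their
    points, so xi needs no type of its own. *)
Definition setz t z : 'rV[int]_N.+1 := z + sh N (const_mx (t - z 0 0)).
Definition nx z : R := \sum_(j < N) `|z 0 (lift ord0 j)|%:~R.

Lemma setz0 t z : setz t z 0 0 = t.
Proof. by rewrite mxE sh0 mxE addrC subrK. Qed.
Lemma setzS t z j : setz t z 0 (lift ord0 j) = z 0 (lift ord0 j).
Proof. by rewrite mxE shS addr0. Qed.
Lemma row_split (z y : 'rV[int]_N.+1) : z 0 0 = y 0 0 ->
  (forall j, z 0 (lift ord0 j) = y 0 (lift ord0 j)) -> z = y.
Proof.
move=> h0 hS; apply/rowP => i; case: (unliftP ord0 i) => [j ->|->]; first exact: hS.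
exact: h0.
Qed.
Lemma setz_id z : setz (z 0 0) z = z.
Proof. by apply: row_split => [|j]; rewrite ?setz0 ?setzS. Qed.
Lemma setz_sh t z (k : 'rV[int]_1) : setz t z - sh N k = setz (t - k 0 0) z.
Proof.
by apply: row_split => [|j]; rewrite ?subsh0 ?subshS ?setz0 ?setzS.
Qed.
Lemma setz_setz t (s : int) z : setz t (setz s z) = setz t z.
Proof. by apply: row_split => [|j]; rewrite ?setz0 ?setzS. Qed.
Lemma nx_setz t z : nx (setz t z) = nx z.
Proof. by apply: eq_bigr => j _; rewrite setzS. Qed.
Lemma nx_ge0 z : 0 <= nx z.
Proof. by apply: sumr_ge0 => j _; rewrite ler0z. Qed.
Lemma nz_nx z : nz R z = `|z 0 0|%:~R + nx z.
Proof. exact: nz_split. Qed.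

Lemma ow_le_aw z : ow om z <= aw om (z 0 0) + om (nx z).
Proof. by rewrite /ow nz_nx; apply: sub; rewrite ?ler0z ?nx_ge0. Qed.
Lemma om_nx_le z : om (nx z) <= ow om z.
Proof. by apply: (om_mono wf (nx_ge0 z)); rewrite nz_nx lerDr ler0z. Qed.
Lemma aw_le_ow z : aw om (z 0 0) <= ow om z.
Proof. by apply: om_mono; rewrite ?ler0z// nz_nx lerDl nx_ge0. Qed.

End Fibers.

(** * Solvability implies hypoellipticity *)

Section SolvableHypoelliptic.
Variables (R : realType) (om : R -> R).
Hypotheses (wf : weight_function om) (sub : om_subadditive om).
Variables (N : nat) (a b : 'I_N -> R -> R).
Hypotheses (ha : forall j, inE1_realom om (a j)) (hb : forall j, inE1_realom om (b j)).
Implicit Types (z y : 'rV[int]_N.+1) (u v : 'rV[int]_N.+1 -> R[i]).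

Lemma fastc_realize (c : 'rV[int]_N.+1 -> R[i]) : fastc om c ->
  exists2 f : 'rV[R]_N.+1 -> R[i], inEom om f & fc f = c.
Proof.
move=> hc; have [W _ hW] := fast_bsum wf hc; have [f hf] := ser_exists hW.
by exists f; [exact (ser_inEom wf hc hf)|apply/funext; exact (fc_ser wf hc hf)].
Qed.

(** Slow growth supplies the a priori bounds of [fiber_decay]. The rate is the same on all fibres
    and only the constant depends on [K], so finitely many fibres together decay. *)
Lemma solves_fiber_decay u v : slow om u -> fastc om v -> solves a b u v ->
  exists2 d : R, 0 < d & forall K : R, exists C : R, forall z, nx R z <= K ->
    cabs (u z) <= C * expR (- (d * aw om (z 0 0))).
Proof.
move=> hu [dv [A [dv0 hA]]] hs; have A0 := fast_ge0 hA.
have [d1 [S [d10 S0 hS]]] := cf_weighted wf sub ha hb.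
pose d := Num.min d1 dv; have d0 : 0 < d by rewrite lt_min d10.
have dd1 : d <= d1 by rewrite ge_min lexx.
have ddv : d <= dv by rewrite ge_min lexx orbT.
have hS2 j : bsum (fun k => cabs (cf a b j k) * expR (d * ow om k)) S.
  apply: bsum_le (hS j) => k; rewrite ler_wpM2l ?cabs_ge0// ler_expR ler_wpM2r//.
  exact: ow_ge0.
have [m hm] := fiber_decay wf sub (ltW S0) (lexx 0).
have [C hC] := hu d d0.
have C0 : 0 <= C.
  have := le_trans (cabs_ge0 _) (hC 0); by rewrite pmulr_lge0// expR_gt0.
exists d => // K.
exists (2 * (C * expR (d * (om (m%:R * (K + 1)) + om K)) *
  expR (d * (m%:R * (om K + om 1))) + A)) => z zK.
have x0 := nx_ge0 R z.
have omK : om (nx R z) <= om K by exact: om_mono.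
have uz t : cabs (u (setz t z)) <= C * expR (d * (aw om t + om (nx R z))).
  apply: le_trans (hC _) _; rewrite ler_wpM2l// ler_expR ler_wpM2l ?(ltW d0)//.
  by have := ow_le_aw sub (setz t z); rewrite setz0 nx_setz.
pose H := C * expR (d * (om (m%:R * (K + 1)) + om K)).
have bound t : cabs (u (setz t z)) <= 2 * (H *
    expR (d * (m%:R * (om (nx R z) + om 1))) + A) * expR (- (d * aw om t)).
  apply: (hm d (nx R z) H A (qc a b z) (fun t => u (setz t z))
    (fun t => v (setz t z)) 0) => //; first exact: ltW.
  - by rewrite mulr_ge0 ?expR_ge0.
  - exact: qc_weighted.
  - by rewrite cabs0.
  - exists (C * expR (d * om (nx R z))) => s; apply: le_trans (uz s) _.
    by rewrite -mulrA -expRD -mulrDr addrC.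
  - move=> s ht; apply: le_trans (uz s) _.
    rewrite ler_wpM2l// ler_expR ler_wpM2l ?(ltW d0)// lerD//.
    have hK : m%:R * (nx R z + 1) <= m%:R * (K + 1) by rewrite ler_wpM2l// lerD2r.
    by apply: (om_mono wf _ (le_trans ht hK)); rewrite ler0z.
  - move=> s; apply: le_trans (hA _) _; rewrite ler_wpM2l// ler_expR lerN2.
    apply: le_trans (_ : d * ow om (setz s z) <= _).
      by rewrite ler_wpM2l ?(ltW d0)//; have := aw_le_ow wf (setz s z); rewrite setz0.
    by rewrite ler_wpM2r// ow_ge0.
  - move=> s; have := hs (setz s z); rewrite setz0 subr0.
    apply: eq_is_csum => k; rewrite setz_sh; congr (_ * _).
    by apply: qc_eq => j; rewrite setzS.
rewrite -{1}(setz_id z); apply: le_trans (bound _) _.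
rewrite ler_wpM2r ?expR_ge0// ler_pM2l// lerD2r ler_wpM2l ?mulr_ge0 ?expR_ge0//.
by rewrite ler_expR ler_wpM2l ?(ltW d0)// ler_wpM2l// lerD2r.
Qed.

Lemma fastc_of_fibers u (d K C : R) : 0 < d ->
  (forall z, nx R z <= K -> cabs (u z) <= C * expR (- (d * aw om (z 0 0)))) ->
  (forall z, K < nx R z -> u z = 0) -> fastc om u.
Proof.
move=> d0 h1 h2; exists d, (`|C| * expR (d * om K)); split => // z.
case: (leP (nx R z) K) => zK; last first.
  by rewrite h2// cabs0 mulr_ge0 ?mulr_ge0 ?expR_ge0.
apply: le_trans (h1 z zK) _.
apply: le_trans (_ : `|C| * expR (- (d * aw om (z 0 0))) <= _).
  by rewrite ler_wpM2r ?expR_ge0// ler_norm.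
rewrite -mulrA -expRD ler_wpM2l// ler_expR.
have h3 := ow_le_aw sub z; have h4 := om_mono wf (nx_ge0 R z) zK.
have : d * ow om z <= d * (aw om (z 0 0) + om K) by rewrite ler_wpM2l ?(ltW d0)//; lra.
lra.
Qed.

(** Unions of fibres: restriction of coefficients to them commutes with the operator. *)
Definition saturated (P : pred 'rV[int]_N.+1) :=
  forall y z, (forall j, y 0 (lift ord0 j) = z 0 (lift ord0 j)) -> P y = P z.

Lemma saturated_nx (K : R) : saturated (fun z => nx R z <= K).
Proof. by move=> y z e; rewrite /nx; under eq_bigr do rewrite e. Qed.

Definition restrict (P : pred 'rV[int]_N.+1) u z := if P z then u z else 0.

Lemma solves_restrict P u v : saturated P -> solves a b u v ->
  solves a b (restrict P u) (restrict P v).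
Proof.
move=> hP hs z; have e k : P (z - sh N k) = P z by apply: hP => j; rewrite subshS.
rewrite /restrict; case: ifP => Pz.
  by apply: eq_is_csum (hs z) => k; rewrite e Pz.
rewrite mulr0 subrr; apply: eq_is_csum (@is_csum0 R _) => k.
by rewrite e Pz mulr0.
Qed.

Lemma slow_restrict P u : slow om u -> slow om (restrict P u).
Proof.
move=> h e e0; have [C hC] := h e e0; exists C => z; rewrite /restrict; case: ifP => // _.
rewrite cabs0; apply: le_trans (hC z); exact: cabs_ge0.
Qed.

(** If [g] were outside the range, a neighbourhood of [g] would miss it. But the part of [g] on the
    fibres with [|xi| <= K] is the image of the truncated [u], which lies in E, and for large [K]
    the difference is in the neighbourhood. *)
Lemma closed_range_solution u (g : 'rV[R]_N.+1 -> R[i]) :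
  Defs.closedE om (fun g => exists f, inEom om f /\ g = Lop a b f) ->
  slow om u -> inEom om g -> solves a b u (fc g) ->
  exists f, inEom om f /\ g = Lop a b f.
Proof.
move=> hcl hu hg hs; apply: contrapT => ng.
have [U [[_ hU] hUA]] := hcl g hg ng.
have /(inEomP wf sub)[bg pg hc] := hg.
have [d d0 hdec] := solves_fiber_decay hu hc hs.
have [d1 [W [d10 W0 hW]]] := fast_weighted wf hc.
have [k hk] := small_inv d10.
have l0 : 0 < (k.+1%:R)^-1 :> R by rewrite invr_gt0.
have [eps [e0 hball]] := hU k; set lam := (k.+1%:R)^-1 in hk l0 hball.
have hWl : bsum (fun z => cabs (fc g z) * expR (lam * ow om z)) W.
  apply: bsum_le hW => z; rewrite ler_wpM2l ?cabs_ge0// ler_expR ler_wpM2r//.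
  exact: ow_ge0.
have w0 z : 0 <= cabs (fc g z) * expR (lam * ow om z).
  by rewrite mulr_ge0 ?cabs_ge0 ?expR_ge0.
have [s0 [us0 hs0]] := bsum_tail w0 hWl (divr_gt0 e0 (expR_gt0 (lam * om 1))).
(* A crude bound for [nx] on the finite set [s0]: every frequency cut off lies outside [s0], where
   the weighted sum of [g] is small. *)
pose K := \sum_(z <- s0) nx R z.
pose P z := nx R z <= K.
have Ps0 z : z \in s0 -> P z.
  move=> zs; rewrite /P /K (bigD1_seq z)//= lerDl; apply: sumr_ge0 => y _; exact: nx_ge0.
have hP : saturated P by exact: saturated_nx.
have [C hC] := hdec K.
have fuK : fastc om (restrict P u).
  apply: (fastc_of_fibers (u := restrict P u) d0 (K := K) (C := C)) => z zK.
    by rewrite /restrict /P zK; exact: hC.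
  by rewrite /restrict /P leNgt zK.
have fvK : fastc om (restrict P (fc g)) by exact: fastc_cond.
have [f hf ef] := fastc_realize fuK; have [gK hgK egK] := fastc_realize fvK.
have LfgK : Lop a b f = gK.
  apply: (Lop_unique wf sub ha hb hf hgK); rewrite ef egK; exact: solves_restrict.
pose h x := gK x + -1 * g x.
have hh : inEom om h by apply: (inEomD wf sub) => //; exact: (inEomZ wf sub).
have /(inEomP wf sub)[bh ph hch] := hh.
have fch z : fc h z = if P z then 0 else - fc g z.
  have /(inEomP wf sub)[bgK _ _] := hgK.
  rewrite /h fcD//; last exact: BLZ.
  by rewrite fcZ// egK /restrict; case: ifP => _; ring.
have bsh : bsum (fun z => cabs (fc h z) * expR (lam * ow om z)) (eps / expR (lam * om 1)).
  move=> s us; rewrite (bigID P) /= [X in X + _]big1 ?add0r; last first.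
    by move=> z Pz; rewrite fch Pz cabs0 mul0r.
  rewrite (eq_bigr (fun z => cabs (fc g z) * expR (lam * ow om z))); last first.
    by move=> z /negbTE Pz; rewrite fch Pz cabsN.
  rewrite -big_filter; apply: hs0; first exact: filter_uniq.
  by move=> z; rewrite mem_filter => /andP[nP _]; apply: contra nP; exact: Ps0.
have hn := ser_normle wf hch (inEom_ser wf sub hh) l0 bsh.
rewrite mulrC divfK ?gt_eqF ?expR_gt0// in hn.
have Uh : U h := hball h hh.1 hh.2.1 hn.
apply: (hUA h hh Uh); exists f; split => //.
by rewrite LfgK; apply/funext => x; rewrite /h; ring.
Qed.

Lemma left_kernel (F : fieldType) m (M : 'M[F]_(m.+1, m)) :
  exists2 x : 'rV[F]_m.+1, x != 0 & x *m M = 0.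
Proof.
have hk : kermx M != 0.
  by rewrite -mxrank_eq0 mxrank_ker subn_eq0 -ltnNge ltnS rank_leq_col.
have [i hi] : exists i, row i (kermx M) != 0.
  apply: contrapT => h; move/eqP: hk; apply; apply/row_matrixP => i; rewrite row0.
  by apply/eqP; apply: contrapT => hi; apply: h; exists i; exact/negP.
exists (row i (kermx M)) => //.
by rewrite -row_mul mulmx_ker row0.
Qed.

(** Otherwise choose [m + 1] fibres on which [u] is nonzero. The restrictions of [u] to them are
    kernel elements, combinations of [m] functionals, hence linearly dependent; testing the relation
    on a character of one fibre isolates one restriction and kills its coefficient. *)
Lemma kernel_finite_fibers u :
  (exists (m : nat) (v : 'I_m -> ('rV[R]_N.+1 -> R[i]) -> R[i]),
    forall mu, inEdualom om mu -> (forall f, inEom om f -> mu (Lop a b f) = 0) ->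
      exists c : 'I_m -> R[i],
        forall f, inEom om f -> mu f = \sum_(l < m) c l * v l f) ->
  slow om u -> solves a b u (fun=> 0) ->
  exists K : R, forall z, K < nx R z -> u z = 0.
Proof.
move=> [m [v hv]] hu hs; apply: contrapT => hno.
have /choice[Z hZ] : forall K : R, exists z, K < nx R z /\ u z != 0.
  move=> K; apply: contrapT => h; apply: hno; exists K => z Kz.
  by apply/eqP; apply: contrapT => uz; apply: h; exists z; split => //; exact/negP.
pose zs := fix zs i := if i is j.+1 then Z (nx R (zs j)) else Z 0.
have zs_lt i j : (i < j)%N -> nx R (zs i) < nx R (zs j).
  elim: j => // j IH; rewrite ltnS leq_eqVlt => /predU1P[->|/IH h].
    by case: (hZ (nx R (zs j))).
  by apply: lt_trans h _; case: (hZ (nx R (zs j))).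
have zs_neq i j : i != j -> nx R (zs i) != nx R (zs j).
  by rewrite neq_ltn => /orP[/zs_lt/lt_eqF->//|/zs_lt/gt_eqF->].
have uzs i : u (zs i) != 0 by case: i => [|i]; [case: (hZ 0)|case: (hZ (nx R (zs i)))].
pose P i y := [forall j, y 0 (lift ord0 j) == (zs i) 0 (lift ord0 j)].
have satP i : saturated (P i) by move=> y z e; apply: eq_forallb => j; rewrite e.
have P_diag i : P i (zs i) by apply/forallP => j.
have P_off i j : i != j -> P i (zs j) = false.
  move=> ij; apply/negbTE/negP => /forallP h; move: (zs_neq i j ij) => /eqP; apply.
  by apply: eq_bigr => l _; rewrite (eqP (h l)).
have sl i : slow om (restrict (P i) u) by exact: slow_restrict.
have dl i : inEdualom om (dual_of (restrict (P i) u)).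
  exact: (dual_of_dual wf sub (sl i)).
have kl i : forall f, inEom om f -> dual_of (restrict (P i) u) (Lop a b f) = 0.
  apply: (solves_ker wf sub ha hb (sl i)).
  have := solves_restrict (satP i) hs; congr solves.
  by apply/funext => z; rewrite /restrict if_same.
have /choice[c hc] : forall i : 'I_m.+1, exists c : 'I_m -> R[i],
    forall f, inEom om f -> dual_of (restrict (P i) u) f = \sum_(l < m) c l * v l f.
  by move=> i; exact: hv (dl i) (kl i).
have [x x0 xM] := left_kernel (\matrix_(i < m.+1, l < m) c i l).
move/eqP: x0; apply; apply/rowP => i0; rewrite mxE.
pose f : 'rV[R]_N.+1 -> R[i] := ee (- zs i0).
have hf : inEom om f by exact: inEom_ee.
have e1 : \sum_(i < m.+1) x 0 i * dual_of (restrict (P i) u) f = 0.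
  under eq_bigr do rewrite hc// mulr_sumr.
  rewrite exchange_big big1//= => l _.
  set M := \matrix_(i, l) c i l in xM.
  transitivity ((x *m M) 0 l * v l f); last by rewrite xM mxE mul0r.
  by rewrite mxE mulr_suml; apply: eq_bigr => i _; rewrite mxE mulrA.
move: e1; rewrite (bigD1 i0)//= big1 ?addr0; last first.
  move=> i ii0; rewrite /f dual_of_ee /restrict P_off ?mulr0//.
rewrite /f dual_of_ee /restrict P_diag => /eqP; rewrite mulf_eq0 => /orP[/eqP//|].
by rewrite mulf_eq0 (negbTE (tpn_neq0 _ _)) (negbTE (uzs _)).
Qed.

Theorem solvable_hypoelliptic :
  strongly_solvable om a b -> globally_hypoelliptic om a b.
Proof.
move=> [hcl hker] mu hmu [g [hg hmug]].
have hu := mc_slow wf hmu.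
have hs := dist_solves wf sub ha hb hmu hmug.
have [f [hf gLf]] := closed_range_solution hcl hu hg hs.
have /(inEomP wf sub)[bf pf hcf] := hf.
pose u z := mc mu z + -1 * fc f z.
have su : slow om u.
  move=> e e0; have [C hC] := hu e e0.
  have [D hD] := fastc_slow wf hcf e0.
  exists (C + D) => z; apply: le_trans (cabsD _ _) _; rewrite mulN1r cabsN mulrDl.
  exact: lerD.
have ku : solves a b u (fun=> 0).
  move=> z; have h1 := hs z; have h2 := fc_Lop wf sub ha hb hf z.
  have -> : 0 - 'i%C * (z 0 0)%:~R * u z =
      (fc g z - 'i%C * (z 0 0)%:~R * mc mu z) +
      (-1) * (fc (Lop a b f) z - 'i%C * (z 0 0)%:~R * fc f z).
    by rewrite -gLf /u; ring.
  apply: eq_is_csum (is_csumD h1 (is_csumZ (-1) h2)) => k; rewrite /u; ring.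
have [K hK] := kernel_finite_fibers hker su ku.
have f0 : fastc om (fun _ : 'rV[int]_N.+1 => 0 : R[i]).
  by apply: (@fast_finite _ _ _ [::]).
have [d d0 hdec] := solves_fiber_decay su f0 ku; have [C hC] := hdec K.
have fu := fastc_of_fibers d0 hC hK.
have fmu : fastc om (mc mu).
  by apply: fastc_eq (fastcD wf fu hcf) => z; rewrite /u; ring.
have [h hh eh] := fastc_realize fmu.
exists h; split => //.
have /(inEomP wf sub)[bh _ _] := hh.
apply: (dual_mc_ext wf sub hmu (fun_as_dist_dual wf sub bh)) => z.
by rewrite mc_fun eh.
Qed.

End SolvableHypoelliptic.

(** * Periodic linear equations on a fibre *)

Section TimeFunctions.
Variables (R : realType) (N : nat).
Implicit Types (p q : R -> R[i]) (x : 'rV[R]_N.+1).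

(** Functions on the circle are viewed on the whole torus, so that one Fourier theory serves both;
    their coefficients live on the axis [tz]. *)
Definition tf p x : R[i] := p (x ord0 ord0).
Definition tper p := forall t, p (t + 2 * pi) = p t.
Definition tz (t : int) : 'rV[int]_N.+1 := setz t 0.

Let coord0 x h : (x + h *: ('e_ord0 : 'rV[R]_N.+1)) ord0 ord0 = x ord0 ord0 + h.
Proof. by rewrite !mxE eqxx /= mulr1. Qed.
Let coordS x h (j : 'I_N) : (x + h *: 'e_(lift ord0 j)) ord0 ord0 = x ord0 ord0.
Proof. by rewrite !mxE /= mulr0 addr0. Qed.

Lemma tf_BL p K L : (forall t, cabs (p t) <= K) ->
  (forall t h, cabs (p (t + h) - p t) <= L * `|h|) -> BL (tf p).
Proof.
move=> hK hL; have K0 : 0 <= K by exact: le_trans (cabs_ge0 _) (hK 0).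
have L0 : 0 <= L by have := le_trans (cabs_ge0 _) (hL 0 1); rewrite normr1 mulr1.
exists (K + L); split=> [x|x i h].
  by apply: le_trans (hK _) _; rewrite lerDl.
rewrite /tf; case: (unliftP ord0 i) => [j ->|->].
  by rewrite coordS subrr cabs0 mulr_ge0// addr_ge0.
by rewrite coord0; apply: le_trans (hL _ _) _; rewrite ler_wpM2r// lerDr.
Qed.

Lemma tf_BL_cder p p' K L : (forall t, cabs (p t) <= K) -> (forall t, cabs (p' t) <= L) ->
  (forall t, cder p t (p' t)) -> BL (tf p).
Proof.
move=> hK hL hd; apply: (@tf_BL _ K (2 * L)) => // t h.
wlog h0 : t h / 0 <= h.
  move=> H; case: (leP 0 h) => [/H//|h0].
  have := H (t + h) (- h); rewrite addrK cabsC normrN; apply; lra.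
have th : t <= t + h by rewrite lerDl.
have := @cder_lip R p p' t (t + h) L th (fun s _ => hd s) (fun s _ => hL s).
by rewrite (addrC t) addrK ger0_norm// (addrC h).
Qed.

Lemma tf_lip p : BL (tf p) -> exists K, (forall t, cabs (p t) <= K) /\
  forall t h, cabs (p (t + h) - p t) <= K * `|h|.
Proof.
move=> [K [k1 k2]]; exists K; split=> [t|t h].
  by have := k1 (const_mx t); rewrite /tf mxE.
by have := k2 (const_mx t) ord0 h; rewrite /tf coord0 mxE.
Qed.

Lemma tf_periodic p : tper p -> periodicT (tf p).
Proof.
move=> hp i x; rewrite /tf; case: (unliftP ord0 i) => [j ->|->].
  by rewrite coordS.
by rewrite coord0 hp.
Qed.

Lemma tf_cder0 p d x : cder p (x ord0 ord0) d -> cder (line (tf p) x ord0) 0 d.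
Proof.
move=> h; have {}h : cder p (0 + x ord0 ord0) d by rewrite add0r.
by apply: cder_ext (cder_shift h) => s; rewrite /line /tf coord0 addrC.
Qed.

Lemma fc_tf_off p (z : 'rV[int]_N.+1) j : BL (tf p) -> tper p -> z 0 (lift ord0 j) != 0 -> fc (tf p) z = 0.
Proof.
move=> hp pp zj.
have := @fc_pd R N.+1 (tf p) (fun=> 0) (lift ord0 j) z hp (tf_periodic pp) (BL_cst _ 0) _.
have h x : cder (line (tf p) x (lift ord0 j)) 0 0.
  by apply: cder_ext (cder_cst (tf p x) 0) => s; rewrite /line /tf coordS.
move=> /(_ h).
have -> : fc (fun _ : 'rV[R]_N.+1 => 0 : R[i]) z = 0.
  rewrite (_ : (fun _ => 0) = fun x : 'rV[R]_N.+1 => 0 * ee 0 x); last first.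
    by apply/funext => x; rewrite mul0r.
  by rewrite fcZ ?mul0r//; exact: BL_ee.
move/esym/eqP; rewrite mulf_eq0 => /orP[|/eqP //].
rewrite mulf_eq0 intr_eq0 (negbTE zj) orbF => /eqP h0.
by have := cabsi R; rewrite h0 cabs0 => /esym/eqP; rewrite oner_eq0.
Qed.

Lemma tz_sh t : tz t = sh N (const_mx t).
Proof. by apply: row_split => [|j]; rewrite ?setz0 ?setzS ?sh0 ?shS mxE. Qed.

Lemma nz_tz t : nz R (tz t) = `|t|%:~R.
Proof. by rewrite tz_sh nz_sh /nz big_ord1 mxE. Qed.

Lemma tz_off (z : 'rV[int]_N.+1) : (forall t, z != tz t) -> exists j, z 0 (lift ord0 j) != 0.
Proof.
move=> h; apply: contrapT => hj; case/eqP: (h (z 0 0)).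
apply: row_split => [|j]; rewrite ?setz0// setzS mxE.
by apply/eqP; apply: contrapT => zj; apply: hj; exists j; exact/negP.
Qed.

Lemma tz_inj : injective tz.
Proof. by move=> s t /(congr1 (fun z : 'rV[int]_N.+1 => z 0 0)); rewrite !setz0. Qed.

End TimeFunctions.

Section TimeSeries.
Variables (R : realType) (om : R -> R).
Hypotheses (wf : weight_function om) (sub : om_subadditive om).
Variable N : nat.
Implicit Types (p q : R -> R[i]).

Definition tc p (t : int) : R[i] := fc (tf (N := N) p) (tz N t).

Lemma ow_tz t : ow om (tz N t) = aw om t.
Proof. by rewrite /ow nz_tz. Qed.

Lemma tc_le p K t : BL (tf (N := N) p) -> (forall s, cabs (p s) <= K) -> cabs (tc p t) <= 2 * K.
Proof. by move=> hp hK; apply: (fc_le _ hp) => x; exact: hK. Qed.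

Lemma bsum_aw (e : R) : 0 < e -> exists2 W, 0 < W & bsum (fun t : int => expR (- (e * aw om t))) W.
Proof.
move=> e0; have [W W0 hW] := bsum_ow wf 1 e0; exists W => // s us.
have inj : injective (fun t : int => const_mx t : 'rV[int]_1).
  by move=> t r /(congr1 (fun z : 'rV[int]_1 => z 0 0)); rewrite !mxE.
have := bsum_inj inj hW us; congr (_ <= _); apply: eq_bigr => t _.
by rewrite ow_aw mxE.
Qed.

(** All frequencies off the axis vanish, so the Fourier series is a sum over tau alone and its
    constant [W] does not depend on the fibre. *)
Lemma tf_sup p d A W : BL (tf (N := N) p) -> tper p -> 0 < d ->
  bsum (fun t : int => expR (- (d * aw om t))) W ->
  (forall t, cabs (tc p t) <= A * expR (- (d * aw om t))) ->
  forall s, cabs (p s) <= A * W.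
Proof.
move=> hp pp d0 hW hA s.
have A0 : 0 <= A.
  have := le_trans (cabs_ge0 _) (hA 0); by rewrite pmulr_lge0// expR_gt0.
have off z : (forall t, z != tz N t) -> fc (tf p) z = 0.
  by move=> /tz_off[j]; exact: fc_tf_off.
have hc : fastc om (fc (tf (N := N) p)).
  exists d, A; split => // z; case: (pselect (exists t, z = tz N t)) => [[t ->]|nt].
    by rewrite ow_tz; exact: hA.
  rewrite off ?cabs0 ?mulr_ge0 ?expR_ge0// => t; apply/eqP => e.
  by apply: nt; exists t.
have := ser_fc wf hp (tf_periodic pp) hc (const_mx s).
have zero z : (forall t, z != tz N t) -> fc (tf (N := N) p) z * ee z (const_mx s) = 0.
  by move=> /off ->; rewrite mul0r.
move=> /(is_csum_reindex (@tz_inj N) zero) h.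
have -> : p s = tf (N := N) p (const_mx s) by rewrite /tf mxE.
apply: (is_csum_le h); apply: bsum_le (bsumZ A0 hW) => t.
by rewrite cabsM cabs_ee mulr1; exact: hA.
Qed.

End TimeSeries.

Section OdeCoefficients.
Variables (R : realType) (om : R -> R).
Hypotheses (wf : weight_function om) (sub : om_subadditive om).
Variables (N : nat) (a b : 'I_N -> R -> R).
Hypotheses (ha : forall j, inE1_realom om (a j)) (hb : forall j, inE1_realom om (b j)).

Definition gam (z : 'rV[int]_N.+1) (t : R) : R[i] :=
  \sum_(j < N) (z 0 (lift ord0 j))%:~R * (a j t +i* b j t)%C.

Lemma coefs_lip : exists K : R, forall j t h,
  [/\ `|a j t| <= K, `|b j t| <= K, `|a j (t + h) - a j t| <= K * `|h|
    & `|b j (t + h) - b j t| <= K * `|h|].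
Proof.
have /choice[K hK] : forall j, exists K : R, (forall t, cabs (a j t +i* b j t)%C <= K) /\
    forall t h, cabs ((a j (t + h) +i* b j (t + h))%C - (a j t +i* b j t)%C) <= K * `|h|.
  by move=> j; have [K h] := tf_lip (p := fun t => (a j t +i* b j t)%C) (BL_coef wf sub ha hb j); exists K.
have K0 j : 0 <= K j by exact: le_trans (cabs_ge0 _) ((hK j).1 0).
exists (\sum_j K j) => j t h; have [h1 h2] := hK j.
have le : K j <= \sum_j K j by rewrite (bigD1 j)//= lerDl; apply: sumr_ge0.
have le2 : K j * `|h| <= (\sum_j K j) * `|h| by rewrite ler_wpM2r.
split.
- exact: le_trans (le_trans (Re_le_cabs _) (h1 t)) le.
- exact: le_trans (le_trans (Im_le_cabs _) (h1 t)) le.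
- exact: le_trans (le_trans (Re_le_cabs _) (h2 t h)) le2.
- exact: le_trans (le_trans (Im_le_cabs _) (h2 t h)) le2.
Qed.

Lemma coef_tper j : tper (fun t => (a j t +i* b j t)%C).
Proof.
move=> t; have := periodic_coef wf sub ha hb j ord0 (const_mx t).
by rewrite /coef !mxE /= mulr1.
Qed.

Lemma BL_gam z : BL (tf (N := N) (gam z)).
Proof.
by apply: BL_sum => j; apply: BLZ; exact: (BL_coef wf sub ha hb j).
Qed.

(** Compute the coefficient of [u'] twice: as [i t] times that of [u], and from the differential
    equation. *)
Lemma ode_coef z (u F : R -> R[i]) : BL (tf (N := N) u) -> tper u -> BL (tf (N := N) F) ->
  (forall t, cder u t (F t - 'i%C * gam z t * u t)) ->
  forall t, is_csum (fun k => qc a b z k * tc N u (t - k 0 0))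
    (tc N F t - 'i%C * t%:~R * tc N u t).
Proof.
move=> hu pu hF hd t.
pose u' s := F s - 'i%C * gam z s * u s.
have hgu : BL (fun x => 'i%C * (tf (N := N) (gam z) x * tf u x)).
  by apply: BLZ; apply: BLM => //; exact: BL_gam.
have hu' : BL (tf (N := N) u').
  rewrite (_ : tf u' = fun x => tf F x - 'i%C * (tf (gam z) x * tf u x)); first exact: BLB.
  by apply/funext => x; rewrite /tf /u' mulrA.
have h1 : tc N u' t = 'i%C * t%:~R * tc N u t.
  rewrite /tc (fc_pd (f := tf u) (i := ord0))//; last first.
  - by move=> x; apply: tf_cder0; exact: hd.
  - exact: tf_periodic.
  by rewrite setz0.
have h2 : tc N u' t = tc N F t - \sum_(j < N) 'i%C * (z 0 (lift ord0 j))%:~R *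
    fc (fun x => coef a b j x * tf (N := N) u x) (tz N t).
  rewrite /tc (_ : tf u' = fun x => tf F x - \sum_(j < N)
    'i%C * (z 0 (lift ord0 j))%:~R * (coef a b j x * tf u x)).
    have hj j : BL (fun x => 'i%C * (z 0 (lift ord0 j))%:~R * (coef a b j x * tf u x)).
      by apply/BLZ/BLM => //; exact: (BL_coef wf sub ha hb j).
    rewrite fcB//; last exact: BL_sum.
    rewrite fc_sum//; congr (_ - _); apply: eq_bigr => j _; rewrite fcZ//.
    by apply: BLM => //; exact: (BL_coef wf sub ha hb j).
  apply/funext => x; rewrite /tf /u' /gam; congr (_ - _).
  rewrite mulr_sumr mulr_suml; apply: eq_bigr => j _; rewrite /coef; ring.
have -> : tc N F t - 'i%C * t%:~R * tc N u t = \sum_(j < N)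
    'i%C * (z 0 (lift ord0 j))%:~R * fc (fun x => coef a b j x * tf (N := N) u x) (tz N t).
  by rewrite -h1 h2 opprB addrC subrK.
apply: eq_is_csum (is_csum_sum _ (fun j => is_csumZ ('i%C * (z 0 (lift ord0 j))%:~R)
  (fc_coef wf sub ha hb j (tz N t) hu))) => k.
rewrite /qc mulr_suml; apply: eq_bigr => j _.
have -> : tz N t - sh N k = tz N (t - k 0 0) by exact: setz_sh.
exact: mulrA.
Qed.

End OdeCoefficients.

Section ComplexPrimitives.
Variable R : realType.
Implicit Types (u v : R -> R[i]).

Definition ccont u := continuous (fun t => complex.Re (u t)) /\
  continuous (fun t => complex.Im (u t)).

Lemma ccont_cder u (u' : R -> R[i]) : (forall t, cder u t (u' t)) -> ccont u.
Proof.
by move=> h; split=> t; [exact: rder_continuous (h t).1|exact: rder_continuous (h t).2].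
Qed.

Lemma ccont_lip u K : (forall t h, cabs (u (t + h) - u t) <= K * `|h|) -> ccont u.
Proof.
move=> h; split; apply: (@lip_continuous _ _ K) => t s; apply: le_trans (h t s).
  by rewrite -cReN -cReD; exact: Re_le_cabs.
by rewrite -cImN -cImD; exact: Im_le_cabs.
Qed.

Lemma ccontM u v : ccont u -> ccont v -> ccont (fun t => u t * v t).
Proof.
move=> [u1 u2] [v1 v2]; split.
  rewrite (_ : (fun t => _) = fun t => complex.Re (u t) * complex.Re (v t) -
    complex.Im (u t) * complex.Im (v t)); last by apply/funext => s; rewrite cReM.
  by move=> t; apply: cvgB; apply: cvgM; [exact: u1|exact: v1|exact: u2|exact: v2].
rewrite (_ : (fun t => _) = fun t => complex.Re (u t) * complex.Im (v t) +
  complex.Im (u t) * complex.Re (v t)); last by apply/funext => s; rewrite cImM.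
by move=> t; apply: cvgD; apply: cvgM; [exact: u1|exact: v2|exact: u2|exact: v1].
Qed.

Lemma cprimitive u : ccont u -> exists U : R -> R[i], forall t, cder U t (u t).
Proof.
move=> [h1 h2]; have [P hP] := primitive_exists h1; have [Q hQ] := primitive_exists h2.
by exists (fun t => (P t +i* Q t)%C) => t; split => /=.
Qed.

End ComplexPrimitives.

(** * Integrating factor, monodromy and periodic solutions *)

Section OdeSolutions.
Variables (R : realType) (om : R -> R).
Hypotheses (wf : weight_function om) (sub : om_subadditive om).
Variables (N : nat) (a b : 'I_N -> R -> R).
Hypotheses (ha : forall j, inE1_realom om (a j)) (hb : forall j, inE1_realom om (b j)).

Definition is_primitive (f P : R -> R) := (forall t, rder P t (f t)) /\
  forall t, P (t + 2 * pi) = P t + 2 * pi * mean2pi f.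

Lemma periodic_primitive (f : R -> R) : continuous f -> (forall t, f (t + 2 * pi) = f t) ->
  exists P, is_primitive f P.
Proof.
move=> cf pf; have [P hP] := primitive_exists cf; exists P; split => // t.
have d s : rder (fun s => P (s + 2 * pi) - P s) s 0.
  by rewrite -(subrr (f s)); apply: rderB => //; apply: rder_shift; rewrite -pf.
have := is_derive_0_is_cst t 0 d; rewrite /= add0r.
rewrite /mean2pi -/(perint f) (perintE cf hP) mulrA divff ?mul1r; first lra.
by rewrite gt_eqF// twopi_gt0.
Qed.

Lemma coef_primitives : exists PA PB : 'I_N -> R -> R,
  forall j, is_primitive (a j) (PA j) /\ is_primitive (b j) (PB j).
Proof.
have [K hK] := coefs_lip wf sub ha hb.
have per j t := coef_tper wf sub ha hb j t.
have /choice[PA hA] : forall j, exists P, is_primitive (a j) P.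
  move=> j; apply: periodic_primitive.
    by apply: (@lip_continuous _ _ K) => t h; case: (hK j t h).
  by move=> t; case: (per j t).
have /choice[PB hB] : forall j, exists P, is_primitive (b j) P.
  move=> j; apply: periodic_primitive.
    by apply: (@lip_continuous _ _ K) => t h; case: (hK j t h).
  by move=> t; case: (per j t).
by exists PA, PB.
Qed.

Variables PA PB : 'I_N -> R -> R.
Hypothesis hPA : forall j, is_primitive (a j) (PA j).
Hypothesis hPB : forall j, is_primitive (b j) (PB j).
Variable z : 'rV[int]_N.+1.

Definition comb (f : 'I_N -> R) : R := \sum_(j < N) (z 0 (lift ord0 j))%:~R * f j.
Definition Az t : R := comb (fun j => PA j t).
Definition Bz t : R := comb (fun j => PB j t).
Definition c0 : R[i] := (comb (fun j => mean2pi (a j)) +i* comb (fun j => mean2pi (b j)))%C.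
(** This is [i] times a primitive of [gam], so [cexp (wz t)] is the integrating factor. *)
Definition wz t : R[i] := (- Bz t +i* Az t)%C.
(** The factor by which solutions of [u' = - i gam u] are multiplied over one period. *)
Definition monodromy : R[i] := cexp (- ((2 * pi)%:C%C * 'i%C * c0)).

Lemma comb_rder (P f : 'I_N -> R -> R) t : (forall j, rder (P j) t (f j t)) ->
  rder (fun s => comb (fun j => P j s)) t (comb (fun j => f j t)).
Proof.
move=> h; rewrite /comb; elim: (index_enum _) => [|j r IH].
  rewrite big_nil; apply: rder_ext (rder_cst 0 t) => s; by rewrite big_nil.
rewrite big_cons; apply: rder_ext (rderD (rderZ _ (h j)) IH) => s; by rewrite big_cons.
Qed.

Lemma gamE t : gam a b z t = (comb (fun j => a j t) +i* comb (fun j => b j t))%C.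
Proof.
rewrite /gam; apply: complex_ext; rewrite ?Re_sum ?Im_sum /=; apply: eq_bigr => j _;
  by rewrite -(rmorph_int (real_complex R)) ?cReZ ?cImZ.
Qed.

Lemma rder_Bz t : rder Bz t (comb (fun j => b j t)).
Proof. by apply: comb_rder => j; case: (hPB j). Qed.
Lemma rder_Az t : rder Az t (comb (fun j => a j t)).
Proof. by apply: comb_rder => j; case: (hPA j). Qed.

Lemma cder_wz t : cder wz t ('i%C * gam a b z t).
Proof.
rewrite gamE; split; rewrite !ReImE /=.
  by apply: rder_eq (rderN (rder_Bz t)) _; ring.
by apply: rder_eq (rder_Az t) _; ring.
Qed.

Lemma Az_shift t : Az (t + 2 * pi) = Az t + 2 * pi * complex.Re c0.
Proof.
rewrite /Az /= /comb mulr_sumr -big_split; apply: eq_bigr => j _ /=.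
by case: (hPA j) => _ ->; ring.
Qed.
Lemma Bz_shift t : Bz (t + 2 * pi) = Bz t + 2 * pi * complex.Im c0.
Proof.
rewrite /Bz /= /comb mulr_sumr -big_split; apply: eq_bigr => j _ /=.
by case: (hPB j) => _ ->; ring.
Qed.
Lemma wz_shift t : wz (t + 2 * pi) = wz t + (2 * pi)%:C%C * 'i%C * c0.
Proof.
rewrite /wz Az_shift Bz_shift; apply: complex_ext; rewrite !ReImE /=; ring.
Qed.

Lemma Bz_lip : exists K, 0 <= K /\ forall s t, `|Bz t - Bz s| <= K * `|t - s|.
Proof.
have [K hK] := coefs_lip wf sub ha hb.
exists (\sum_(j < N) `|(z 0 (lift ord0 j))%:~R| * `|K|); split.
  by apply: sumr_ge0 => j _; rewrite mulr_ge0.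
move=> s t; wlog st : s t / s <= t.
  move=> H; case: (leP s t) => [/H//|/ltW/H]; by rewrite distrC (distrC s).
rewrite (ger0_norm (_ : 0 <= t - s)) ?subr_ge0//.
apply: (rder_lip st (fun r _ => rder_Bz r)) => r _.
apply: le_trans (ler_norm_sum _ _ _) _; apply: ler_sum => j _.
rewrite normrM ler_wpM2l//; case: (hK j r 0) => _ h _ _.
exact: le_trans h (ler_norm K).
Qed.

Section Inhomogeneous.
Variable F : R -> R[i].
Hypotheses (hF : BL (tf (N := N) F)) (pF : tper F).

Lemma ode_primitive : exists G : R -> R[i], forall t, cder G t (cexp (wz t) * F t).
Proof.
apply: cprimitive; apply: ccontM.
  by apply: ccont_cder => t; apply: cder_cexp; exact: cder_wz.
by have [K [_ hK]] := tf_lip hF; apply: ccont_lip hK.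
Qed.

Variable G : R -> R[i].
Hypothesis hG : forall t, cder G t (cexp (wz t) * F t).

(* Solves [u' = (1 - monodromy) F - i gam u]: multiplying the right-hand side by [1 - monodromy] makes
   a periodic solution exist without any division. *)
Definition sol t : R[i] := cexp (- wz t) * (G t - G (t - 2 * pi)).

Let E_shift t : cexp (wz (t - 2 * pi)) = monodromy * cexp (wz t).
Proof.
have {2}-> : t = t - 2 * pi + 2 * pi by rewrite subrK.
rewrite wz_shift -cexpD; congr cexp; ring.
Qed.

Let pF' t : F (t - 2 * pi) = F t.
Proof. by rewrite -{2}(subrK (2 * pi) t) pF. Qed.

Let dG' t : cder (fun s => G (s - 2 * pi)) t (monodromy * (cexp (wz t) * F t)).
Proof.
apply: cder_shift; have := hG (t - 2 * pi); rewrite E_shift pF'.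
by rewrite mulrA.
Qed.

Lemma sol_cder t : cder sol t ((1 - monodromy) * F t - 'i%C * gam a b z t * sol t).
Proof.
apply: cder_eq (cderM (cder_cexp (cderN (cder_wz t))) (cderB (hG t) (dG' t))) _.
have := cexpN (wz t); rewrite /sol.
move: (cexp (- wz t)) (cexp (wz t)) (G t) (G _) => e1 e2 g1 g2 e.
have -> : e1 * (e2 * F t - monodromy * (e2 * F t)) = (1 - monodromy) * F t * (e1 * e2) by ring.
rewrite e; ring.
Qed.

Lemma sol_per : tper sol.
Proof.
(* A shift by one period multiplies the derivative of [G] by the monodromy, hence [G] itself up to a
   constant, which cancels in the difference defining [sol]. *)
have const : forall s t, G (s - 2 * pi) - monodromy * G s = G (t - 2 * pi) - monodromy * G t.
  apply: cder_const => s.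
  by apply: cder_eq (cderB (dG' s) (cderZ monodromy (hG s))) _; rewrite subrr.
move=> t; rewrite /sol addrK.
have e : monodromy * (G (t + 2 * pi) - G t) = G t - G (t - 2 * pi).
  have := const (t + 2 * pi) t; rewrite addrK => e; rewrite mulrBr.
  have -> : monodromy * G (t + 2 * pi) = G t - (G (t - 2 * pi) - monodromy * G t).
    by rewrite -e; ring.
  ring.
rewrite wz_shift opprD cexpD -/monodromy -mulrA; congr (_ * _); exact: e.
Qed.

(** The value at [t] involves [F] on the preceding period only, so what matters is how much [Bz] can
    rise up to [t]. The constant is the period times the factor 2 of [cder_lip]. *)
Lemma sol_le t K : (forall s, t - 2 * pi <= s <= t -> expR (Bz t - Bz s) * cabs (F s) <= K) ->
  cabs (sol t) <= 4 * pi * K.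
Proof.
move=> hK; have p := twopi_gt0 R.
have tt : t - 2 * pi <= t by lra.
have := @cder_lip R (fun s => cexp (- wz t) * G s)
  (fun s => cexp (- wz t) * (cexp (wz s) * F s)) (t - 2 * pi) t K tt
  (fun s _ => cderZ (cexp (- wz t)) (hG s)).
rewrite -mulrBr => H; apply: le_trans (H _) _.
  move=> s hs; apply: le_trans (hK s hs).
  by rewrite (cabsM (cexp (- wz t))) (cabsM (cexp (wz s))) !cabs_cexp /= opprK mulrA -expRD.
by rewrite le_eqVlt; apply/orP; left; apply/eqP; ring.
Qed.

Lemma sol_BL : BL (tf (N := N) sol).
Proof.
have [KB [KB0 hKB]] := Bz_lip; have [KF [hKF _]] := tf_lip hF.
have KF0 : 0 <= KF by exact: le_trans (cabs_ge0 _) (hKF 0).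
have [Kg [hKg _]] := tf_lip (BL_gam wf sub ha hb z).
pose M := 4 * pi * (expR (KB * (2 * pi)) * KF).
have hM t : cabs (sol t) <= M.
  apply: sol_le => s /andP[s1 s2]; rewrite ler_pM ?expR_ge0 ?cabs_ge0// ler_expR.
  apply: le_trans (ler_norm _) _; apply: le_trans (hKB s t) _.
  by rewrite ler_wpM2l// ger0_norm; lra.
pose u' t := (1 - monodromy) * F t - 'i%C * gam a b z t * sol t.
apply: (@tf_BL_cder R N sol u' M (cabs (1 - monodromy) * KF + Kg * M) hM _ sol_cder) => t.
rewrite /u'; apply: le_trans (cabsB _ _) _.
rewrite (cabsM _ (F t)) (cabsM _ (sol t)) (cabsM 'i%C) cabsi mul1r.
by rewrite lerD// ?ler_wpM2l ?cabs_ge0// ler_pM ?cabs_ge0.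
Qed.

End Inhomogeneous.

End OdeSolutions.

(** * Necessity of the conditions *)

Section LatticeNorms.
Variables (R : realType) (om : R -> R).
Hypotheses (wf : weight_function om) (sub : om_subadditive om).
Variable n : nat.
Implicit Types z : 'rV[int]_n.

Definition n2 z : R := Num.sqrt (\sum_i (z 0 i)%:~R ^+ 2).

Lemma n2_ge0 z : 0 <= n2 z. Proof. exact: sqrtr_ge0. Qed.

Lemma le_n2 z i : `|z 0 i|%:~R <= n2 z.
Proof.
rewrite intr_norm -sqrtr_sqr /n2 ler_sqrt ?sumr_ge0// => [|j _]; last exact: sqr_ge0.
rewrite (bigD1 i)//= lerDl; apply: sumr_ge0 => j _; exact: sqr_ge0.
Qed.

Lemma nz_le_n2 z : nz R z <= n%:R * n2 z.
Proof.
rewrite mulr_natl -[n in _ *+ n]card_ord -sumr_const; apply: ler_sum => i _; exact: le_n2.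
Qed.

Lemma n2_le_nz z : n2 z <= nz R z.
Proof.
rewrite -[leRHS]ger0_norm ?nz_ge0// -sqrtr_sqr /n2 ler_sqrt ?sqr_ge0//.
rewrite /nz; elim: (index_enum _) => [|i r IH]; first by rewrite !big_nil expr0n.
rewrite !big_cons.
have -> : (z 0 i)%:~R ^+ 2 = `|z 0 i|%:~R ^+ 2 :> R.
  by rewrite intr_norm real_normK ?num_real.
have h1 : 0 <= `|z 0 i|%:~R :> R by rewrite ler0z.
have h2 : 0 <= \sum_(j <- r) `|z 0 j|%:~R :> R by apply: sumr_ge0 => j _; rewrite ler0z.
move: (\sum_(j <- r) `|z 0 j|%:~R) (`|z 0 i|%:~R) h1 h2 IH => x y; nra.
Qed.

Lemma om_n2_le z : om (n2 z) <= ow om z.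
Proof. exact: om_mono (n2_ge0 z) (n2_le_nz z). Qed.

Lemma ow_le_n2 z : ow om z <= n.+1%:R * om (n2 z).
Proof.
apply: le_trans (om_natmul sub n (n2_ge0 z)); apply: om_mono => //; first exact: nz_ge0.
by apply: le_trans (nz_le_n2 z) _; rewrite ler_wpM2r ?n2_ge0// ler_nat.
Qed.

Lemma box_seq (K : nat) : exists s : seq 'rV[int]_n, forall z,
  (forall i, (absz (z 0%R i) <= K)%N) -> z \in s.
Proof.
pose dec (f : {ffun 'I_n -> 'I_K.*2.+1}) : 'rV[int]_n := \row_i ((f i)%:Z - K%:Z).
exists (map dec (enum {: {ffun 'I_n -> 'I_K.*2.+1}})) => z hz; apply/mapP.
exists [ffun i => inord (absz (z 0 i + K%:Z))]; first by rewrite mem_enum.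
apply/rowP => i; rewrite mxE ffunE; have := hz i => h.
have p : 0 <= z 0 i + K%:Z by lia.
by rewrite inordK; move: (z 0 i) h p => t h p; lia.
Qed.

(** A ball contains finitely many lattice points, over which a minimum of positive values is
    taken. *)
Lemma bounded_below (f : 'rV[int]_n -> R) (P : pred 'rV[int]_n) (Y : R) :
  (forall z, P z -> 0 < f z) ->
  exists2 c, 0 < c & forall z, P z -> nz R z <= Y -> c <= f z.
Proof.
move=> hf; have [s hs] := box_seq (Num.truncn Y).
have [c c0 hc] : exists2 c, 0 < c & forall z, z \in s -> P z -> c <= f z.
  elim: s {hs} => [|y s [c c0 IH]]; first by exists 1.
  case: (boolP (P y)) => Py; last first.
    exists c => // z; rewrite inE => /predU1P[->|zs]; first by rewrite (negbTE Py).
    exact: IH.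
  exists (Num.min c (f y)); first by rewrite lt_min c0 hf.
  move=> z; rewrite inE => /predU1P[->|zs] Pz; first by rewrite ge_min lexx orbT.
  by rewrite ge_min IH.
exists c => // z Pz zY; apply: hc => //; apply: hs => i.
rewrite -ltnS -(ltr_nat R); apply: le_lt_trans (truncnS_gt Y).
by apply: le_trans zY; apply: le_trans (le_nz R z i); rewrite -abszE -pmulrn.
Qed.

End LatticeNorms.

Section PeriodicBounds.
Variable R : realType.

Lemma intr_lt1 (t : int) : `|t|%:~R < 1 :> R -> t = 0.
Proof. by rewrite -[1]/(1%:~R) ltr_int; lia. Qed.

Lemma per_int (T : Type) (f : R -> T) (k : int) t :
  (forall t, f (t + 2 * pi) = f t) -> f (t + 2 * pi * k%:~R) = f t.
Proof.
move=> pf; have pn (m : nat) s : f (s + 2 * pi * m%:R) = f s.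
  elim: m => [|m IH]; first by rewrite mulr0 addr0.
  by rewrite -(natr1 m) mulrDr mulr1 addrA pf.
case: k => k; first exact: pn.
by rewrite NegzE rmorphN /= -pmulrn mulrN -(pn k.+1) subrK.
Qed.

Lemma per_bounded (f : R -> R) K : (forall t, f (t + 2 * pi) = f t) -> 0 <= K ->
  (forall s t, `|f t - f s| <= K * `|t - s|) -> forall t, `|f t| <= `|f 0| + K * pi.
Proof.
move=> pf K0 hf t; have [k hk] := nearest_period t.
have e : f (t - 2 * pi * k%:~R) = f t.
  by have := per_int (- k) t pf; rewrite rmorphN /= mulrN.
have := hf 0 (t - 2 * pi * k%:~R); rewrite e subr0 => h.
have := ler_normD (f t - f 0) (f 0); rewrite subrK.
have := ler_wpM2l K0 hk; lra.
Qed.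

End PeriodicBounds.

(** * Necessity of the Diophantine condition *)

Section EdcNecessity.
Variables (R : realType) (om : R -> R).
Hypotheses (wf : weight_function om) (sub : om_subadditive om).
Variables (N : nat) (a b : 'I_N -> R -> R).
Hypotheses (ha : forall j, inE1_realom om (a j)) (hb : forall j, inE1_realom om (b j)).
Implicit Types z : 'rV[int]_N.+1.

Definition symb z : R[i] := (z 0 0)%:~R + c0 a b z.

Lemma fiber_comb (y z : 'rV[int]_N.+1) (f : 'I_N -> R) :
  (forall j, y 0 (lift ord0 j) = z 0 (lift ord0 j)) -> comb y f = comb z f.
Proof. by move=> e; apply: eq_bigr => j _; rewrite e. Qed.

Lemma c0_setz t z : c0 a b (setz t z) = c0 a b z.
Proof. by rewrite /c0; congr (_ +i* _)%C; apply: fiber_comb => j; rewrite setzS. Qed.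

(** The homogeneous solution [cexp (- wz)] is multiplied by the monodromy over a period. The factor
    [cexp (i symb t)] corrects this, because tau is an integer, at the price of the error
    [i symb p]. Division by the supremum of the modulus normalises. *)
Lemma approx_kernel PA PB z : (forall j, is_primitive (a j) (PA j)) ->
  (forall j, is_primitive (b j) (PB j)) ->
  exists p : R -> R[i], [/\ tper p, BL (tf (N := N) p),
    forall t, cder p t ('i%C * symb z * p t - 'i%C * gam a b z t * p t),
    forall t, cabs (p t) <= 1 & exists t, 2^-1 <= cabs (p t)].
Proof.
move=> hPA hPB.
pose w t := - wz PA PB z t + 'i%C * symb z * t%:C%C.
pose v t := cexp (w t).
have dw t : cder w t (- ('i%C * gam a b z t) + 'i%C * symb z).
  apply: cderD; first by apply: cderN; exact: cder_wz.
  by apply: cder_eq (cderZ _ (cder_real (rder_id t))) _; rewrite mulr1.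
have dv t : cder v t ('i%C * symb z * v t - 'i%C * gam a b z t * v t).
  apply: cder_eq (cder_cexp (dw t)) _; rewrite /v; ring.
have pv : tper v.
  move=> t; rewrite /v.
  have -> : w (t + 2 * pi) = w t + 'i%C * (2 * pi * (z 0 0)%:~R)%:C%C.
    rewrite /w (wz_shift hPA hPB) /symb.
    have -> : (t + 2 * pi)%:C%C = t%:C%C + (2 * pi)%:C%C :> R[i] by exact: rmorphD.
    have -> : (2 * pi * (z 0 0)%:~R)%:C%C = (2 * pi)%:C%C * (z 0 0)%:~R :> R[i].
      by rewrite -(rmorph_int (real_complex R)) -rmorphM.
    ring.
  by rewrite cexpD -cis_cexp cis_2pi_int mulr1.
pose f t := Bz PB z t - comb z (fun j => mean2pi (b j)) * t.
have vE t : cabs (v t) = expR (f t).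
  rewrite /v cabs_cexp /w /symb; congr expR; rewrite !ReImE /= /f.
  rewrite -(rmorph_int (real_complex R)) /=; ring.
have [K [K0 hK]] := Bz_lip wf sub ha hb hPB z.
pose c := comb z (fun j => mean2pi (b j)).
have fper t : f (t + 2 * pi) = f t.
  by rewrite /f (Bz_shift a hPB) /=; ring.
have flip s t : `|f t - f s| <= (K + `|c|) * `|t - s|.
  have -> : f t - f s = (Bz PB z t - Bz PB z s) + - c * (t - s) by rewrite /f -/c; ring.
  apply: le_trans (ler_normD _ _) _; rewrite mulrDl lerD//.
  by rewrite normrM normrN.
have fb := per_bounded fper (addr_ge0 K0 (normr_ge0 c)) flip.
set M := `|f 0| + _ in fb.
pose A := [set cabs (v t) | t in [set: R]].
have A0 : A !=set0 by exists (cabs (v 0)), 0.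
have hA : has_ubound A.
  exists (expR M) => _ [t _ <-]; rewrite vE ler_expR.
  exact: le_trans (ler_norm _) (fb t).
have V0 : 0 < sup A.
  apply: lt_le_trans (_ : cabs (v 0) <= _); first by rewrite vE expR_gt0.
  by apply: ub_le_sup => //; exists 0.
have V2 : 0 < sup A / 2 by lra.
have [_ [t0 _ <-] ht0] := sup_adherent V2 (conj A0 hA).
pose r : R[i] := ((sup A)^-1)%:C%C.
have rE t : cabs (r * v t) = cabs (v t) / sup A.
  by rewrite cabsM cabsR ger0_norm ?invr_ge0 ?(ltW V0)// mulrC.
have p1 t : cabs (r * v t) <= 1.
  by rewrite rE ler_pdivrMr// mul1r; apply: ub_le_sup => //; exists t.
have dp t : cder (fun t => r * v t) t
    ('i%C * symb z * (r * v t) - 'i%C * gam a b z t * (r * v t)).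
  by apply: cder_eq (cderZ r (dv t)) _; ring.
have [Kg [hKg _]] := tf_lip (BL_gam wf sub ha hb z).
exists (fun t => r * v t); split => //.
- by move=> t; rewrite pv.
- apply: (@tf_BL_cder R N _ _ 1 (cabs (symb z) + Kg) p1 _ dp) => t.
  apply: le_trans (cabsB _ _) _.
  rewrite (cabsM ('i%C * symb z)) (cabsM 'i%C (symb z)) (cabsM ('i%C * gam _ _ _ _)).
  rewrite (cabsM 'i%C (gam _ _ _ _)) cabsi !mul1r.
  have := p1 t; have := hKg t; have := cabs_ge0 (symb z); have := cabs_ge0 (gam a b z t).
  have := cabs_ge0 (r * v t).
  move: (cabs (r * v t)) (cabs (gam a b z t)) (cabs (symb z)) => P Q S; nra.
- by exists t0; rewrite rE ler_pdivlMr//; lra.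
Qed.

Lemma symb_le : exists K : R, forall z, cabs (c0 a b z) <= K * nx R z.
Proof.
pose K := \sum_(j < N) (`|mean2pi (a j)| + `|mean2pi (b j)|).
have Kj j : `|mean2pi (a j)| + `|mean2pi (b j)| <= K.
  by rewrite /K (bigD1 j)//= lerDl; apply: sumr_ge0 => i _; rewrite addr_ge0.
exists K => z; apply: le_trans (cabs_le_ReIm _) _ => /=.
apply: le_trans (_ : \sum_(j < N) `|z 0 (lift ord0 j)|%:~R * (`|mean2pi (a j)| + `|mean2pi (b j)|) <= _).
  under eq_bigr do rewrite mulrDr.
  rewrite big_split /=; apply: lerD; apply: le_trans (ler_norm_sum _ _ _) _;
    by apply: ler_sum => j _; rewrite normrM -intr_norm.
by rewrite mulrC mulr_suml; apply: ler_sum => j _; rewrite ler_wpM2l ?ler0z.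
Qed.

(** A fibre may contain several bad points but carries one equation, so one tau is chosen per fibre.
    On a fibre without bad points the default choice is not bad, which is how such fibres are
    recognised. *)
Lemma fiber_rep (bad : pred 'rV[int]_N.+1) : exists rep : 'rV[int]_N.+1 -> 'rV[int]_N.+1,
  [/\ forall y z : 'rV[int]_N.+1, (forall j, y 0 (lift ord0 j) = z 0 (lift ord0 j)) -> rep y = rep z,
      forall z, bad z -> bad (rep z) &
      forall z j, rep z 0 (lift ord0 j) = z 0 (lift ord0 j)].
Proof.
pose tau z := xget 0 [set t : int | bad (setz t z)].
exists (fun z => setz (tau z) z); split.
- move=> y z e; have es t : setz t y = setz t z.
    by apply: row_split => [|j]; rewrite ?setz0 ?setzS.
  have te : tau y = tau z.
    by congr xget; apply/funext => t; rewrite /mkset es.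
  by rewrite te es.
- move=> z bz; apply: (@xgetPex _ 0 [set t : int | bad (setz t z)]).
  by exists (z 0 0); rewrite /= setz_id.
- by move=> z j; rewrite setzS.
Qed.

(** The almost-solutions on the bad fibres form a bounded, hence slow, family with fast image. By
    hypoellipticity it decays, while each member has supremum at least one half: this bounds [|xi|]
    on bad points, which are then finitely many. *)
Theorem hypoelliptic_EDC : globally_hypoelliptic om a b ->
  EDC1 om (fun j => mean2pi (a j)) (fun j => mean2pi (b j)).
Proof.
move=> hyp eps eps0.
pose bad z := (z != 0) && (cabs (symb z) < expR (- (eps * om (n2 R z)))).
have bad_lt1 z : bad z -> cabs (symb z) < 1.
  move=> /andP[_ h]; apply: lt_le_trans h _; rewrite -expR0 ler_expR oppr_le0.
  by rewrite mulr_ge0 ?(ltW eps0)// om_ge0// n2_ge0.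
have [PA [PB hP]] := coef_primitives wf sub ha hb.
have hPA j := (hP j).1; have hPB j := (hP j).2.
have /choice[p hp] : forall z, exists p : R -> R[i], [/\ tper p, BL (tf (N := N) p),
    forall t, cder p t ('i%C * symb z * p t - 'i%C * gam a b z t * p t),
    forall t, cabs (p t) <= 1 & exists t, 2^-1 <= cabs (p t)].
  by move=> z; exact: approx_kernel hPA hPB.
have [rep [rep_fib rep_bad repS]] := fiber_rep bad.
have nx_rep z : nx R (rep z) = nx R z.
  by apply: eq_bigr => j _; rewrite repS.
have [u uE] : exists u : 'rV[int]_N.+1 -> R[i], forall z,
    u z = if bad (rep z) then tc N (p (rep z)) (z 0 0) else 0.
  by exists (fun z => if bad (rep z) then tc N (p (rep z)) (z 0 0) else 0).
have [v vE] : exists v : 'rV[int]_N.+1 -> R[i], forall z, v z = 'i%C * symb (rep z) * u z.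
  by exists (fun z => 'i%C * symb (rep z) * u z).
have u_le z : cabs (u z) <= 2.
  rewrite uE; case: ifP => _; last by rewrite cabs0.
  have [_ h2 _ h4 _] := hp (rep z).
  by have := tc_le (z 0 0) h2 h4; rewrite mulr1.
have ode z t : is_csum (fun k => qc a b (rep z) k * tc N (p (rep z)) (t - k 0 0))
    (0 - ('i%C * t%:~R - 'i%C * symb (rep z)) * tc N (p (rep z)) t).
  have [h1 h2 h3 _ _] := hp (rep z).
  have hF : BL (tf (N := N) (fun t => 'i%C * symb (rep z) * p (rep z) t)) by exact: BLZ.
  have := ode_coef wf sub ha hb h2 h1 hF h3 t.
  have -> : tc N (fun t => 'i%C * symb (rep z) * p (rep z) t) t =
      'i%C * symb (rep z) * tc N (p (rep z)) t.
    exact: (@fcZ R N.+1 ('i%C * symb (rep z)) (tf (p (rep z))) (tz N t) h2).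
  by congr is_csum; ring.
have solv : solves a b u v.
  move=> z; have usub k : u (z - sh N k) =
      if bad (rep z) then tc N (p (rep z)) (z 0 0 - k 0 0) else 0.
    by rewrite uE (rep_fib _ z) ?subsh0// => j; rewrite subshS.
  rewrite vE uE; case: ifPn => bz.
    have := ode z (z 0 0); rewrite sub0r mulrBl opprB.
    by apply: eq_is_csum => k; rewrite usub bz; congr (_ * _); apply: qc_eq => j.
  rewrite (mulr0 ('i%C * symb _)) (mulr0 ('i%C * _)) subrr.
  apply: eq_is_csum (@is_csum0 R _) => k.
  by rewrite usub (negbTE bz) mulr0.
have [d1 [S [d10 S0 hS]]] := cf_weighted wf sub ha hb.
have [m hm] := fiber_decay wf sub (ltW S0) (@ler01 R).
(* [N.+2] is the cost of replacing the Euclidean norm by the l1 norm in dimension [N + 1]. *)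
pose e1 := eps / N.+2%:R; have e10 : 0 < e1 by rewrite divr_gt0.
(* The loss [exp (d m omega (|xi|))] of [fiber_decay] uses at most half of the smallness of the
   symbol. *)
pose d := Num.min d1 (e1 / 2 / m.+1%:R).
have d0 : 0 < d by rewrite lt_min d10 !divr_gt0.
have dm : d * m%:R <= e1 / 2.
  have : d <= e1 / 2 / m.+1%:R by rewrite ge_min lexx orbT.
  rewrite ler_pdivlMr// -natr1; lra.
have hS2 j : bsum (fun k => cabs (cf a b j k) * expR (d * ow om k)) S.
  apply: bsum_le (hS j) => k; rewrite ler_wpM2l ?cabs_ge0// ler_expR ler_wpM2r//.
    exact: ow_ge0.
  by rewrite ge_min lexx.
have bad_om z : bad (rep z) -> cabs (symb (rep z)) <= expR (- (e1 * om (nx R z))).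
  move=> /andP[_ /ltW h]; apply: le_trans h _; rewrite ler_expR lerN2.
  rewrite /e1 mulrAC ler_pdivrMr// -mulrA ler_pM2l// mulrC -nx_rep.
  exact: le_trans (om_nx_le wf (rep z)) (ow_le_n2 wf sub (rep z)).
have fv : fastc om v.
  pose d' := Num.min (e1 / 2) d; have d'0 : 0 < d' by rewrite lt_min d0 divr_gt0.
  exists d', (4 * expR (d * (m%:R * om 1))); split => // z.
  have C0 : 0 <= 4 * expR (d * (m%:R * om 1)) * expR (- (d' * ow om z)).
    by rewrite !mulr_ge0 ?expR_ge0.
  rewrite vE uE; case: ifPn => bz; last by rewrite (mulr0 ('i%C * _)) cabs0.
  have [h1 h2 _ h4 _] := hp (rep z).
  have bnd : cabs (tc N (p (rep z)) (z 0 0)) <=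
      2 * (2 * expR (d * (m%:R * (om (nx R z) + om 1))) + 0) * expR (- (d * aw om (z 0 0))).
    apply: (hm d (nx R z) 2 0 (qc a b (rep z)) (tc N (p (rep z))) (fun=> 0)
      ('i%C * symb (rep z)) (ltW d0) (nx_ge0 R z)) => //.
    - have := qc_weighted (rep z) hS2; rewrite -/(nx R (rep z)) nx_rep; exact.
    - by rewrite cabsM cabsi mul1r; exact: ltW (bad_lt1 _ bz).
    - exists 2 => t; apply: le_trans (tc_le t h2 h4) _.
      by rewrite mulr1 ler_peMr// -expR0 ler_expR mulr_ge0 ?(ltW d0)// (aw_ge0 wf).
    - by move=> t _; have := tc_le t h2 h4; rewrite mulr1.
    - by move=> t; rewrite cabs0 mul0r.
  rewrite (cabsM _ (tc _ _ _)) (cabsM 'i%C) cabsi mul1r.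
  apply: le_trans (ler_pM (cabs_ge0 _) (cabs_ge0 _) (bad_om z bz) bnd) _.
  rewrite addr0.
  have -> : expR (- (e1 * om (nx R z))) * (2 * (2 * expR (d * (m%:R * (om (nx R z) + om 1)))) *
      expR (- (d * aw om (z 0 0)))) =
    4 * (expR (- (e1 * om (nx R z))) * expR (d * (m%:R * (om (nx R z) + om 1))) *
      expR (- (d * aw om (z 0 0)))) by ring.
  rewrite -[leRHS]mulrA ler_pM2l// -!expRD ler_expR.
  have x0 : 0 <= om (nx R z) by rewrite om_ge0// nx_ge0.
  have y0 := aw_ge0 wf (z 0 0).
  have h5 := ler_wpM2r x0 dm.
  have h6 : d' * ow om z <= d' * (aw om (z 0 0) + om (nx R z)).
    by rewrite ler_wpM2l ?(ltW d'0)//; exact: ow_le_aw.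
  have h7 : d' * om (nx R z) <= e1 / 2 * om (nx R z).
    by rewrite ler_wpM2r// ge_min lexx.
  have h8 : d' * aw om (z 0 0) <= d * aw om (z 0 0).
    by rewrite ler_wpM2r// ge_min lexx orbT.
  lra.
have [g hg eg] := fastc_realize wf fv.
have /(inEomP wf sub)[bg _ _] := hg.
have su : slow om u by exact: bounded_slow u_le.
have hdist : forall f, inEom om f -> - dual_of u (Lop a b f) = fun_as_dist g f.
  by apply: (solves_dist wf sub ha hb su bg); rewrite eg.
have [h [hh eh]] := hyp _ (dual_of_dual wf sub su) (ex_intro _ g (conj hg hdist)).
have fcu z : fc h z = u z.
  by rewrite -(mc_fun h) -(mc_dual_of u) /mc eh//; exact: inEom_ee.
have /(inEomP wf sub)[_ _ [dl [A [dl0 hA]]]] := hh.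
have dl2 : 0 < dl / 2 by lra.
have [W W0 hW] := bsum_aw wf dl2.
have A0 := fast_ge0 hA.
have [Cg Cg0 hCg] := om_growth1 wf dl2.
have badx z : bad z -> nx R z <= 2 * A * W * Cg.
  move=> /rep_bad bz; have [h1 h2 _ _ [t0 ht0]] := hp (rep z).
  have tcb t : cabs (tc N (p (rep z)) t) <=
      A * expR (- (dl / 2 * om (nx R z))) * expR (- (dl / 2 * aw om t)).
    have := hA (setz t z); rewrite fcu uE (rep_fib (setz t z) z); last first.
      by move=> j; rewrite setzS.
    rewrite bz setz0 => H; apply: le_trans H _; rewrite -mulrA -expRD ler_wpM2l//.
    rewrite ler_expR.
    have := om_nx_le wf (setz t z); have := aw_le_ow wf (setz t z).
    rewrite setz0 nx_setz => k1 k2.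
    have := ler_wpM2l (ltW dl2) k1; have := ler_wpM2l (ltW dl2) k2; lra.
  have := tf_sup wf h2 h1 dl2 hW tcb t0 => k.
  have k2 := le_trans ht0 k.
  have k3 := hCg _ (nx_ge0 R z).
  rewrite expRN mulrAC ler_pdivlMr ?expR_gt0// in k2.
  have := ler_wpM2l (ltW Cg0) k2; lra.
(* On the fibre [xi = 0] the symbol is a nonzero integer, of modulus at least 1, so no point of it
   is bad. *)
have nx_bad z : bad z -> 1 <= nx R z.
  move=> bz; have /andP[z0 _] := bz; case: (leP 1 (nx R z)) => // hx.
  have zS j : z 0 (lift ord0 j) = 0.
    have : `|z 0 (lift ord0 j)|%:~R <= nx R z.
      by rewrite /nx (bigD1 j)//= lerDl; apply: sumr_ge0 => i _; rewrite ler0z.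
    by move=> hj; apply: (@intr_lt1 R); exact: le_lt_trans hx.
  have z00 : z 0 0 != 0.
    apply: contra z0 => /eqP z00; apply/eqP; apply: row_split => [|j]; rewrite mxE//.
  have := bad_lt1 z bz; rewrite /symb.
  have -> : c0 a b z = 0.
    by rewrite /c0 /comb !big1// => j _; rewrite zS mul0r.
  by rewrite addr0 cabs_int => /intr_lt1 e; rewrite e eqxx in z00.
(* The symbol is linear: a zero would make all positive multiples of [z] bad, with [|xi|] unbounded,
   against [badx]. *)
have symb_neq0 z : z != 0 -> 0 < cabs (symb z).
  move=> z0; apply: cabs_gt0; apply/eqP => s0.
  have bk (k : nat) : bad (k.+1%:Z *: z).
    rewrite /bad; have -> : k.+1%:Z *: z != 0.
      apply: contra z0 => /eqP e; apply/eqP/rowP => i.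
      have := congr1 (fun w : 'rV[int]_N.+1 => w 0 i) e.
      by rewrite /= !mxE => /eqP; rewrite mulf_eq0 => /orP[//|/eqP].
    rewrite /=.
    have -> : symb (k.+1%:Z *: z) = k.+1%:R * symb z.
      rewrite /symb /c0 /comb mulrDr mxE rmorphM /= -pmulrn; congr (_ + _).
      have cc (f : 'I_N -> R) : \sum_(j < N) ((k.+1%:Z *: z) 0 (lift ord0 j))%:~R * f j =
          k.+1%:R * \sum_(j < N) (z 0 (lift ord0 j))%:~R * f j.
        rewrite mulr_sumr; apply: eq_bigr => j _.
        by rewrite mxE rmorphM /= -pmulrn mulrA.
      rewrite !cc -(rmorph_nat (real_complex R)).
      by apply: complex_ext; rewrite ?cReZ ?cImZ.
    by rewrite s0 mulr0 cabs0 expR_gt0.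
  have b1 := bk 0%N; rewrite scale1r in b1; have x1 := nx_bad z b1.
  pose k := Num.truncn (2 * A * W * Cg).
  have := badx _ (bk k).
  have -> : nx R (k.+1%:Z *: z) = k.+1%:R * nx R z.
    rewrite /nx mulr_sumr; apply: eq_bigr => j _.
    by rewrite mxE normrM rmorphM /= -pmulrn.
  have := truncnS_gt (2 * A * W * Cg); rewrite -/k => h1 h2.
  have k0 : 0 <= k.+1%:R :> R by [].
  have := ler_wpM2l k0 x1; lra.
have [K hK] := symb_le.
pose X := 2 * A * W * Cg.
(* At a bad point the symbol is less than 1, so tau is at most [1 + |K| X] in modulus: bad points
   lie in this ball. *)
have [c c0' hc] := bounded_below (P := fun z => z != 0) (1 + `|K| * X + X) symb_neq0.
exists (Num.min 1 c); split; first by rewrite lt_min ltr01.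
move=> t xi hne.
pose z : 'rV[int]_N.+1 := \row_i (if unlift ord0 i is Some j then xi j else t).
have z0E : z 0 0 = t by rewrite mxE unlift_none.
have zSE j : z 0 (lift ord0 j) = xi j by rewrite mxE liftK.
have zn0 : z != 0.
  apply/eqP => e; case: hne => [t0|[j xj]].
    by move: t0; rewrite -z0E e mxE eqxx.
  by move: xj; rewrite -zSE e mxE eqxx.
have -> : Num.sqrt (t%:~R ^+ 2 + \sum_(j < N) (xi j)%:~R ^+ 2) = n2 R z.
  by rewrite /n2 big_ord_recl z0E; under [in RHS]eq_bigr do rewrite zSE.
have -> : ((t%:~R + \sum_(j < N) (xi j)%:~R * mean2pi (a j)) +i*
   (\sum_(j < N) (xi j)%:~R * mean2pi (b j)))%C = symb z.
  rewrite /symb /c0 /comb z0E -(rmorph_int (real_complex R)).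
  by apply: complex_ext; rewrite !ReImE /= ?add0r; [congr (_ + _)|]; apply: eq_bigr => j _; rewrite zSE.
have E1 : expR (- (eps * om (n2 R z))) <= 1.
  rewrite -expR0 ler_expR oppr_le0 mulr_ge0 ?(ltW eps0)// om_ge0// n2_ge0//.
have E0 := expR_gt0 (- (eps * om (n2 R z))).
case: (ltP (cabs (symb z)) (expR (- (eps * om (n2 R z))))) => hz; last first.
  apply: le_trans hz; rewrite -[leRHS]mul1r ler_pM2r// ge_min lexx//.
have bz : bad z by rewrite /bad zn0.
apply: le_trans (_ : c <= _).
  apply: le_trans (_ : c * expR (- (eps * om (n2 R z))) <= _).
    by rewrite ler_pM2r// ge_min lexx orbT.
  by rewrite -[leRHS]mulr1 ler_pM2l.
apply: hc => //; rewrite nz_nx.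
have hX := badx z bz; rewrite -/X in hX.
have h1 := hK z; have h2 := ltW (bad_lt1 z bz).
have h3 : `|z 0 0|%:~R <= cabs (symb z) + cabs (c0 a b z).
  rewrite -(@cabs_int R) (_ : (z 0 0)%:~R = symb z - c0 a b z); last by rewrite /symb addrK.
  exact: cabsB.
have h4 : K * nx R z <= `|K| * X.
  apply: le_trans (_ : `|K| * nx R z <= _); last by rewrite ler_wpM2l.
  by rewrite ler_wpM2r ?nx_ge0// ler_norm.
lra.
Qed.

End EdcNecessity.

(** * A rise of the primitive of the imaginary part, and its multiples *)

Section SignNecessity.
Variables (R : realType) (om : R -> R).
Hypotheses (wf : weight_function om) (sub : om_subadditive om).
Variables (N : nat) (a b : 'I_N -> R -> R).
Hypotheses (ha : forall j, inE1_realom om (a j)) (hb : forall j, inE1_realom om (b j)).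
Variables PA PB : 'I_N -> R -> R.
Hypothesis hPA : forall j, is_primitive (a j) (PA j).
Hypothesis hPB : forall j, is_primitive (b j) (PB j).
Variable z : 'rV[int]_N.+1.

Let mult (k : nat) : 'rV[int]_N.+1 := k.+1%:Z *: z.
Let B := Bz PB z.
Let A := Az PA z.
Let al0 := comb z (fun j => mean2pi (a j)).
Let be0 := comb z (fun j => mean2pi (b j)).

Lemma comb_mult k (f : 'I_N -> R) : comb (mult k) f = k.+1%:R * comb z f.
Proof.
rewrite /comb mulr_sumr; apply: eq_bigr => j _.
by rewrite mxE rmorphM /= -pmulrn mulrA.
Qed.

Let wz_mult k s : wz PA PB (mult k) s = (- (k.+1%:R * B s) +i* (k.+1%:R * A s))%C.
Proof. by rewrite /wz /Bz /Az !comb_mult. Qed.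

Hypothesis be0_le0 : be0 <= 0.
Variable t1 : R.
Hypothesis pos1 : 0 < comb z (fun j => b j t1).

Let A_shift t : A (t + 2 * pi) = A t + 2 * pi * al0.
Proof. exact: (Az_shift b hPA). Qed.
Let B_shift t : B (t + 2 * pi) = B t + 2 * pi * be0.
Proof. exact: (Bz_shift a hPB). Qed.

Let KB : exists2 K : R, 0 < K & forall s t, `|B t - B s| <= K * `|t - s|.
Proof.
have [K [K0 hK]] := Bz_lip wf sub ha hb hPB z; exists (K + 1); first by rewrite ltr_wpDl.
by move=> s t; apply: le_trans (hK s t) _; rewrite ler_wpM2r// lerDl.
Qed.

Let rises : exists s t, [/\ t - 2 * pi <= s, s <= t & 0 < B t - B s].
Proof.
have [K [_ hK]] := tf_lip (BL_gam wf sub ha hb z).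
have K0 : 0 <= K by have := le_trans (cabs_ge0 _) (hK 0 1); rewrite normr1 mulr1.
pose beta t := comb z (fun j => b j t).
have hbeta t h : `|beta (t + h) - beta t| <= K * `|h|.
  apply: le_trans (hK t h); rewrite !gamE.
  by apply: le_trans (Im_le_cabs _); rewrite cImD cImN.
have p0 := twopi_gt0 R.
pose d := Num.min (2 * pi) (beta t1 / (2 * (K + 1))).
have d0 : 0 < d by rewrite lt_min p0 divr_gt0// mulr_gt0// ltr_wpDl.
have dp : d <= 2 * pi by rewrite ge_min lexx.
have dK : K * d <= beta t1 / 2.
  have : d <= beta t1 / (2 * (K + 1)) by rewrite ge_min lexx orbT.
  by rewrite ler_pdivlMr; nra.
exists t1, (t1 + d); split; [lra|lra|].
have td : t1 <= t1 + d by lra.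
have [c /andP[c1 c2] ->] := rder_MVT td (fun s _ => rder_Bz hPB z s).
apply: mulr_gt0; last lra.
have := hbeta t1 (c - t1); have ct : 0 <= c - t1 by lra.
rewrite (addrC t1) subrK (ger0_norm ct).
rewrite ler_norml => /andP[h _].
have : K * (c - t1) <= K * d by rewrite ler_wpM2l//; lra.
have : 0 < beta t1 by []. rewrite -/(beta c); lra.
Qed.

Let M := sup [set r | exists s t, [/\ t - 2 * pi <= s, s <= t & r = B t - B s]].

Let M_has_sup : has_sup [set r | exists s t, [/\ t - 2 * pi <= s, s <= t & r = B t - B s]].
Proof.
split; first by have [s [t [h1 h2 _]]] := rises; exists (B t - B s), s, t.
have [K K0 hK] := KB; exists (K * (2 * pi)) => _ [s [t [h1 h2 ->]]].
apply: le_trans (ler_norm _) _; apply: le_trans (hK s t) _.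
by rewrite ler_pM2l// ger0_norm; lra.
Qed.

Let M_ub s t : t - 2 * pi <= s -> s <= t -> B t - B s <= M.
Proof. by move=> h1 h2; apply: ub_le_sup; [case: M_has_sup|exists s, t]. Qed.

Let M_gt0 : 0 < M.
Proof. by have [s [t [h1 h2 h3]]] := rises; apply: lt_le_trans h3 (M_ub h1 h2). Qed.

Section Frequency.
Variable k : nat.
Let n : R := k.+1%:R.
Let n0 : 0 < n. Proof. by []. Qed.
Let n1 : 1 <= n. Proof. by rewrite ler1n. Qed.

(** An error [1 / (k + 1)] in the rise costs only a factor [exp (-1)] at frequency [k + 1], so the
    maximum need not be attained. *)
Lemma near_max : exists s t, [/\ t - 2 * pi <= s, s <= t & M - (k.+1%:R)^-1 <= B t - B s].
Proof.
have p : 0 < n^-1 by rewrite invr_gt0.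
by have [_ [s [t [h1 h2 ->]]] h3] := sup_adherent p M_has_sup; exists s, t; split => //; exact: ltW.
Qed.

Let phase : exists m : int, `|n * al0 - m%:~R| <= 1 / 2.
Proof.
have [m hm] := nearest_period (2 * pi * (n * al0)); exists m.
have p := twopi_gt0 R; have pp := pi_gt0 R.
rewrite -(ler_pM2l p) -{1}(gtr0_norm p) -normrM mulrBr.
by apply: le_trans hm _; lra.
Qed.

(* [F] oscillates so that [cexp (wz s) * F s] has almost constant phase on a period, with modulus
   largest where [B] is smallest; no cancellation then occurs in the integral defining [sol]. *)
Lemma phase_fun : exists F : R -> R[i], exists l rho : R,
  [/\ [/\ tper F, BL (tf (N := N) F) & forall t, cabs (F t) <= expR (- (n * M))],
   forall t, cder F t (('i%C * l%:C%C) * F t - 'i%C * gam a (fun _ _ => 0) (mult k) t * F t),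
   `|l| <= 1, `|rho| <= 1 / 2 &
   forall s, cexp (wz PA PB (mult k) s) * F s =
     (expR (- (n * B s) - n * M))%:C%C * cis (rho * s)].
Proof.
have [m hm] := phase; pose rho := n * al0 - m%:~R.
pose th s := - (n * A s) + rho * s.
have dth s : rder th s (- (n * comb z (fun j => a j s)) + rho).
  apply: rderD; first by apply: rderN; apply: rderZ; exact: rder_Az.
  by apply: rder_ext (rder_affine rho 0 s) => t; rewrite addr0.
pose F s := (expR (- (n * M)))%:C%C * cis (th s).
have cF s : cabs (F s) = expR (- (n * M)).
  by rewrite cabsM cabs_cis mulr1 cabsR ger0_norm// expR_ge0.
have pF : tper F.
  move=> s; rewrite /F; congr (_ * _).
  have -> : th (s + 2 * pi) = th s + 2 * pi * (- m)%:~R.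
    by rewrite /th A_shift rmorphN /= /rho; ring.
  by rewrite cisD cis_2pi_int mulr1.
(* [F] itself solves a fibre equation, with the imaginary part replaced by 0; its decay in tau will
   come from [fiber_decay]. *)
have dF s : cder F s (('i%C * rho%:C%C) * F s - 'i%C * gam a (fun _ _ => 0) (mult k) s * F s).
  apply: cder_eq (cderZ _ (cder_cis (dth s))) _; rewrite gamE !comb_mult.
  have -> : comb z (fun=> 0 : R) = 0 by rewrite /comb big1// => j _; rewrite mulr0.
  rewrite /F mulr0 -/n.
  have -> : (- (n * comb z (fun j => a j s)) + rho)%:C%C =
    rho%:C%C - (n * comb z (fun j => a j s) +i* 0)%C :> R[i].
    by apply: complex_ext; rewrite !ReImE /=; ring.
  ring.
have [K hK] := coefs_lip wf sub ha hb.
have bd : exists L, forall s, `|- (n * comb z (fun j => a j s)) + rho| <= L.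
  exists (n * (\sum_(j < N) `|(z 0 (lift ord0 j))%:~R| * `|K|) + `|rho|) => s.
  apply: le_trans (ler_normD _ _) _; rewrite lerD2r normrN normrM (gtr0_norm n0) ler_pM2l//.
  apply: le_trans (ler_norm_sum _ _ _) _; apply: ler_sum => j _.
  rewrite normrM ler_wpM2l//; case: (hK j s 0) => h _ _ _.
  exact: le_trans h (ler_norm K).
have [L hL] := bd.
exists F, rho, rho; split => //; first split => //.
- have dF2 s : cder F s ('i%C * (- (n * comb z (fun j => a j s)) + rho)%:C%C * F s).
    apply: cder_eq (cderZ _ (cder_cis (dth s))) _; rewrite /F; ring.
  apply: (@tf_BL_cder R N F _ (expR (- (n * M))) (L * expR (- (n * M))) _ _ dF2) => s.
    by rewrite cF.
  rewrite (cabsM _ (F s)) (cabsM 'i%C) cabsi mul1r cabsR cF ler_wpM2r ?expR_ge0//.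
- by move=> t; rewrite cF.
- by apply: le_trans hm _; lra.
- move=> s; rewrite wz_mult /cexp /= -/n /F.
  have -> : cis (rho * s) = cis (n * A s) * cis (th s).
    by rewrite -cisD /th; congr cis; ring.
  have -> : (expR (- (n * B s) - n * M))%:C%C =
     (expR (- (n * B s)))%:C%C * (expR (- (n * M)))%:C%C :> R[i].
    by rewrite expRD rmorphM.
  ring.
Qed.

End Frequency.

Let KM : exists K eta : R, [/\ forall s t, `|B t - B s| <= K * `|t - s|, 0 < K, 0 < eta, eta <= pi &
  K * eta <= M / 2].
Proof.
have [K K0 hK] := KB; have pp := pi_gt0 R; exists K, (Num.min (M / (2 * K)) pi).
have eta0 : 0 < M / (2 * K) by rewrite divr_gt0 ?mulr_gt0.
split=> //; rewrite ?lt_min ?ge_min ?pp ?lexx ?orbT ?eta0//.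
have : Num.min (M / (2 * K)) pi <= M / (2 * K) by rewrite ge_min lexx.
by rewrite ler_pdivlMr ?mulr_gt0//; lra.
Qed.

(** A rise of [M / 2] takes a time of at least [eta]. As the mean is nonpositive,
    [B (t - 2 * pi) >= B t], so [s] also keeps this distance from the left end of the window. The
    phase there stays away from a right angle. *)
Let margins K eta s t : (forall s t, `|B t - B s| <= K * `|t - s|) -> 0 < K -> K * eta <= M / 2 ->
  t - 2 * pi <= s -> s <= t -> M / 2 <= B t - B s -> t - 2 * pi + eta <= s /\ s + eta <= t.
Proof.
move=> hK K0 h h1 h2 h3; split.
  have := B_shift (t - 2 * pi); rewrite subrK => e.
  have p := twopi_gt0 R; have q : 2 * pi * be0 <= 0 by rewrite mulr_ge0_le0// ltW.
  have := hK s (t - 2 * pi); have d : t - 2 * pi - s <= 0 by lra.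
  rewrite (ler0_norm d) => /(le_trans (ler_norm _)) l.
  suff : K * eta <= K * (- (t - 2 * pi - s)) by rewrite ler_pM2l//; lra.
  lra.
have := hK s t; have d : 0 <= t - s by lra.
rewrite (ger0_norm d) => /(le_trans (ler_norm _)) l.
suff : K * eta <= K * (t - s) by rewrite ler_pM2l//; lra.
lra.
Qed.

Let Re_rotate (rho t s x : R) : complex.Re (cis (- (rho * t)) * (x%:C%C * cis (rho * s))) =
  x * cos (rho * (s - t)).
Proof.
have -> : cis (- (rho * t)) * (x%:C%C * cis (rho * s)) = x%:C%C * cis (rho * (s - t)).
  rewrite mulrCA -cisD; congr (_ * cis _); ring.
by rewrite cReM /=; ring.
Qed.

(** Upper bound: no rise exceeds [M], so the factor [exp (- n M)] compensates. Lower bound, with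
    [n = k + 1]: after rotation the integrand has nonnegative real part on the whole period, and an
    interval of length of order [1 / n] after a near-minimum of [B] already contributes order
    [1 / n]. *)
Lemma waves : exists c m : R, [/\ 0 < c, 0 < m & forall k : nat, exists F U : R -> R[i], exists l : R,
  [/\ [/\ tper F, BL (tf (N := N) F) & forall t, cabs (F t) <= expR (- (k.+1%:R * m))],
   forall t, cder F t (('i%C * l%:C%C) * F t - 'i%C * gam a (fun _ _ => 0) (mult k) t * F t),
   `|l| <= 1,
   [/\ tper U, BL (tf (N := N) U), forall t, cabs (U t) <= 4 * pi &
     forall t, cder U t ((1 - monodromy a b (mult k)) * F t - 'i%C * gam a b (mult k) t * U t)] &
   2 <= k.+1%:R * m -> exists t, c / k.+1%:R <= cabs (U t)]].
Proof.
have [K [eta [hK K0 eta0 eta_pi eta_M]]] := KM; have pp := pi_gt0 R.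
(* On the interval kept for the lower bound the phase is at most [pi / 2 - eta / 4] in modulus, by
   [margins] and [|rho| <= 1 / 2]; this is the least cosine. *)
pose c1 := cos (pi / 2 - eta / 4) : R.
have c10 : 0 < c1 by apply: cos_gt0_pihalf; lra.
pose c2 := Num.min (eta / 2) 1.
have c20 : 0 < c2 by rewrite lt_min ltr01 divr_gt0.
have c2e : c2 <= eta / 2 by rewrite ge_min lexx.
have c21 : c2 <= 1 by rewrite ge_min lexx orbT.
exists (expR (- (1 + K)) * c1 * c2), M; split=> [|//|k]; first by rewrite !mulr_gt0 ?expR_gt0.
 have [F [l [rho [[pF hF bF] dF hl hr GF]]]] := phase_fun k.
have [G hG] := ode_primitive hPA hPB (mult k) hF.
have n0 : 0 < k.+1%:R :> R by [].
have n1 : 1 <= k.+1%:R :> R by rewrite ler1n.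
have BE s : Bz PB (mult k) s = k.+1%:R * B s by rewrite /Bz comb_mult.
exists F, (sol PA PB (mult k) G), l; split => //.
  split; [exact: (sol_per hPA hPB pF hG)|exact: (sol_BL wf sub ha hb hPA hPB hF pF hG)| |exact: (sol_cder hPA hPB pF hG)].
  move=> t; rewrite -[leRHS]mulr1; apply: (sol_le hG) => s /andP[h1 h2].
  apply: le_trans (ler_wpM2l (expR_ge0 _) (bF s)) _.
  rewrite -expRD -[leRHS]expR0 ler_expR !BE.
  by have := ler_wpM2l (ltW n0) (M_ub h1 h2); lra.
move=> nM; have [s0 [t0 [h1 h2 h3]]] := near_max k; exists t0.
have nM2 : M / 2 <= B t0 - B s0.
  have q : (k.+1%:R : R)^-1 <= M / 2 by rewrite -div1r ler_pdivrMr//; lra.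
  apply: (le_trans _ h3); rewrite [leLHS](_ : _ = M - M / 2); last lra.
  by rewrite lerD2l lerN2.
have [m1 m2] := margins hK K0 eta_M h1 h2 nM2.
pose n : R := k.+1%:R; rewrite -/n in n0 n1 h3 BE bF GF nM *.
(* Rotating by the phase at the middle of the window leaves a phase within [pi / 2] on all of it. *)
pose H s := complex.Re (cis (- (rho * (t0 - pi))) * G s).
pose H' s := expR (- (n * B s) - n * M) * cos (rho * (s - (t0 - pi))).
have dH s : rder H s (H' s).
  have [d _] := cderZ (cis (- (rho * (t0 - pi)))) (hG s).
  by apply: rder_eq d _; rewrite /H' GF Re_rotate.
have ar s e : 0 <= e -> `|s - (t0 - pi)| <= pi - e -> `|rho * (s - (t0 - pi))| <= pi / 2 - e / 2.
  move=> e0 h; rewrite normrM; apply: le_trans (ler_pM _ _ hr h) _; rewrite ?normr_ge0//; lra.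
have H'0 s : t0 - 2 * pi <= s <= t0 -> 0 <= H' s.
  move=> /andP[q1 q2]; rewrite /H' mulr_ge0 ?expR_ge0// cos_ge0_pihalf//.
  rewrite -ler_norml; apply: le_trans (ar s 0 _ _) _; rewrite // ?ler_norml; lra.
(* Over a time [r] the product [n B] varies by at most [K], and [r] stays within half of the margin
   [eta]. *)
pose r := c2 / n.
have r0 : 0 < r by rewrite divr_gt0.
have re : r <= eta / 2.
  by apply: le_trans c2e; rewrite /r ler_pdivrMr// ler_peMr// ltW.
have rn : n * r <= 1 by rewrite /r mulrC divfK ?gt_eqF.
have HH : expR (- (n * B s0) - K - n * M) * c1 * r <= H t0 - H (t0 - 2 * pi).
  have a1 : H (t0 - 2 * pi) <= H s0.
    by apply: (rder_ge0 h1 (fun s _ => dH s)) => s /andP[q1 q2]; apply: H'0; lra.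
  have a2 : H (s0 + r) <= H t0.
    apply: (rder_ge0 _ (fun s _ => dH s)); first lra.
    by move=> s /andP[q1 q2]; apply: H'0; lra.
  have sr : s0 <= s0 + r by lra.
  have [s /andP[q1 q2] e] := rder_MVT sr (fun s _ => dH s).
  have : expR (- (n * B s0) - K - n * M) * c1 * r <= H' s * (s0 + r - s0).
    rewrite (addrC s0 r) addrK ler_pM2r// /H' ler_pM ?expR_ge0//; first exact: ltW.
      rewrite ler_expR.
      have := hK s0 s; have d : 0 <= s - s0 by lra.
      rewrite (ger0_norm d) => /(le_trans (ler_norm _)) q.
      have : n * (B s - B s0) <= K.
        apply: (@le_trans _ _ (n * (K * (s - s0)))); first by rewrite ler_pM2l.
        by rewrite mulrCA ger_pMr//; apply: le_trans rn; rewrite ler_pM2l//; lra.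
      lra.
    have as_ : `|rho * (s - (t0 - pi))| <= pi / 2 - eta / 2 / 2.
      by apply: ar; rewrite ?ler_norml; lra.
    rewrite -(cos_norm (rho * _)) /c1 leNgt ltr_cos -?leNgt ?in_itv /= ?normr_ge0/=; [|lra..].
    by apply: le_trans as_ _; lra.
  by move: e; rewrite /=; lra.
have HG : H t0 - H (t0 - 2 * pi) <= cabs (G t0 - G (t0 - 2 * pi)).
  have -> : cabs (G t0 - G (t0 - 2 * pi)) =
      cabs (cis (- (rho * (t0 - pi))) * G t0 - cis (- (rho * (t0 - pi))) * G (t0 - 2 * pi)).
    by rewrite -mulrBr cabsM cabs_cis mul1r.
  by apply: le_trans (le_trans (ler_norm _) (Re_le_cabs _)); rewrite cReD cReN.
rewrite /sol cabsM cabs_cexp !ReImE /= BE opprK.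
apply: (@le_trans _ _ (expR (n * B t0) * (expR (- (n * B s0) - K - n * M) * c1 * r))); last first.
  by rewrite ler_pM2l ?expR_gt0//; exact: le_trans HH HG.
have -> : expR (- (1 + K)) * c1 * c2 / n = expR (- (1 + K)) * (c1 * r) by rewrite /r !mulrA.
have -> : expR (n * B t0) * (expR (- (n * B s0) - K - n * M) * c1 * r) =
  expR (n * B t0 + (- (n * B s0) - K - n * M)) * (c1 * r) by rewrite (expRD (n * B t0)) !mulrA.
rewrite ler_pM2r ?(mulr_gt0 c10 r0)// ler_expR.
have : n * (M - n^-1) <= n * (B t0 - B s0) by rewrite ler_pM2l.
rewrite mulrBr divff ?gt_eqF//; lra.
Qed.

End SignNecessity.

Section NoSignChange.
Variables (R : realType) (om : R -> R).
Hypotheses (wf : weight_function om) (sub : om_subadditive om).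
Variables (N : nat) (a b : 'I_N -> R -> R).
Hypotheses (ha : forall j, inE1_realom om (a j)) (hb : forall j, inE1_realom om (b j)).

Lemma inE1_realom0 : inE1_realom om (fun _ : R => 0 : R).
Proof.
have := inEomZ wf sub 0 (inEom_ee wf (0 : 'rV[int]_1)).
by congr inEom; apply/funext => x; rewrite mul0r.
Qed.

Lemma cabs_monodromy (z : 'rV[int]_N.+1) :
  cabs (monodromy a b z) = expR (2 * pi * comb z (fun j => mean2pi (b j))).
Proof. by rewrite /monodromy cabs_cexp !ReImE /=; congr expR; ring. Qed.

(** The data have size [exp (- n M)] on the fibre of [n z], fast because
    [omega (n |xi|) <= n omega (|xi|)]; the solutions are bounded but at least [c / n] somewhere,
    against the decay that hypoellipticity would impose. *)
Theorem hypoelliptic_no_rise (z : 'rV[int]_N.+1) (t1 : R) : globally_hypoelliptic om a b ->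
  comb z (fun j => mean2pi (b j)) <= 0 -> comb z (fun j => b j t1) <= 0.
Proof.
move=> hyp be0; rewrite leNgt; apply/negP => pos1.
have [PA [PB hP]] := coef_primitives wf sub ha hb.
have hPA j := (hP j).1; have hPB j := (hP j).2.
have [c [M [c0 M0 hw]]] := waves wf sub ha hb hPA hPB be0 pos1.
have /choice[F hF] := hw; have /choice[U hU] := hF; have /choice[l hl] := hU.
move=> {hw hF hU}.
pose mult (k : nat) : 'rV[int]_N.+1 := k.+1%:Z *: z.
have [j0 zj0] : exists j, z 0 (lift ord0 j) != 0.
  apply: contrapT => h; move: pos1; rewrite /comb big1 ?ltxx// => j _.
  case: (eqVneq (z 0 (lift ord0 j)) 0) => [->|zj]; first by rewrite mul0r.
  by case: h; exists j.
(* Recovers [k] from the fibre of [mult k], which is [k + 1] times [z]; [P] then tells whether the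
   fibre is really of this kind. *)
pose idx (y : 'rV[int]_N.+1) := (absz (y 0%R (lift ord0 j0)) %/ absz (z 0%R (lift ord0 j0))).-1.
pose P (y : 'rV[int]_N.+1) := [forall j, y 0 (lift ord0 j) == mult (idx y) 0 (lift ord0 j)].
have fibP y : P y -> forall j, y 0 (lift ord0 j) = mult (idx y) 0 (lift ord0 j).
  by move=> /forallP h j; exact/eqP.
have idx_fib (y y' : 'rV[int]_N.+1) : (forall j, y 0 (lift ord0 j) = y' 0 (lift ord0 j)) ->
    idx y = idx y' /\ P y = P y'.
  move=> e; have ei : idx y = idx y' by rewrite /idx e.
  by split => //; rewrite /P ei; apply: eq_forallb => j; rewrite e.
have idx_mult k : idx (mult k) = k.
  by rewrite /idx mxE abszM mulnK// absz_gt0.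
have P_mult k : P (mult k) by apply/forallP => j; rewrite idx_mult.
have sub_fib (y : 'rV[int]_N.+1) k j : (y - sh N k) 0 (lift ord0 j) = y 0 (lift ord0 j).
  exact: subshS.
have [u uE] : exists u : 'rV[int]_N.+1 -> R[i], forall y,
    u y = if P y then tc N (U (idx y)) (y 0 0) else 0.
  by exists (fun y => if P y then tc N (U (idx y)) (y 0 0) else 0).
have [v vE] : exists v : 'rV[int]_N.+1 -> R[i], forall y,
    v y = if P y then (1 - monodromy a b (mult (idx y))) * tc N (F (idx y)) (y 0 0) else 0.
  by exists (fun y => if P y then (1 - monodromy a b (mult (idx y))) * tc N (F (idx y)) (y 0 0) else 0).
have pp := pi_gt0 R.
have u_le y : cabs (u y) <= 2 * (4 * pi).
  rewrite uE; case: ifP => _; last by rewrite cabs0; lra.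
  by have [_ _ _ [_ h2 h4 _] _] := hl (idx y); exact: tc_le.
have solv : solves a b u v.
  move=> y; rewrite vE uE; case: ifPn => Py; last first.
    rewrite (mulr0 ('i%C * _)) subrr; apply: eq_is_csum (@is_csum0 R _) => k.
    by rewrite uE (idx_fib _ y _).2// (negbTE Py) mulr0.
  have [[f1 f2 _] _ _ [h1 h2 _ h3] _] := hl (idx y).
  have hF : BL (tf (N := N) (fun t => (1 - monodromy a b (mult (idx y))) * F (idx y) t)).
    exact: BLZ.
  have := ode_coef wf sub ha hb h2 h1 hF h3 (y 0 0).
  have -> : tc N (fun t => (1 - monodromy a b (mult (idx y))) * F (idx y) t) (y 0 0) =
      (1 - monodromy a b (mult (idx y))) * tc N (F (idx y)) (y 0 0).
    exact: (@fcZ R N.+1 _ (tf (F (idx y))) (tz N (y 0 0)) f2).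
  apply: eq_is_csum => k.
  have [e1 e2] := idx_fib (y - sh N k) y (sub_fib y k).
  rewrite uE e2 Py e1 subsh0; congr (_ * _); apply: qc_eq => j.
  by rewrite -fibP.
have h00 : forall j : 'I_N, inE1_realom om ((fun (_ : 'I_N) (_ : R) => 0 : R) j).
  by move=> _; exact: inE1_realom0.
have [d1 [S [d10 S0 hS]]] := cf_weighted wf sub ha h00.
have [m hm] := fiber_decay wf sub (ltW S0) (@ler01 R).
have x0 := nx_ge0 R z; have ox0 := om_ge0 wf x0.
(* Makes [e1 omega (n |xi|)] at most half of [n M]. One such share pays the loss in [fiber_decay],
   the other is the decay in xi of [v]. *)
pose e1 := M / 2 / (om (nx R z) + 1).
have e10 : 0 < e1 by rewrite !divr_gt0// ltr_wpDl.
pose d := Num.min d1 (e1 / m.+1%:R).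
have d0 : 0 < d by rewrite lt_min d10 divr_gt0.
have dm : d * m%:R <= e1.
  have : d <= e1 / m.+1%:R by rewrite ge_min lexx orbT.
  rewrite ler_pdivlMr// -natr1; lra.
have hS2 j : bsum (fun k => cabs (cf a (fun _ _ => 0) j k) * expR (d * ow om k)) S.
  apply: bsum_le (hS j) => k; rewrite ler_wpM2l ?cabs_ge0// ler_expR ler_wpM2r//.
    exact: ow_ge0.
  by rewrite ge_min lexx.
have nx_mult k : nx R (mult k) = k.+1%:R * nx R z.
  rewrite /nx mulr_sumr; apply: eq_bigr => j _.
  by rewrite mxE normrM rmorphM /= -pmulrn.
have nx_P y : P y -> nx R y = nx R (mult (idx y)).
  by move=> Py; apply: eq_bigr => j _; rewrite fibP.
have om_mult k : e1 * om (nx R (mult k)) <= k.+1%:R * M / 2.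
  rewrite nx_mult; apply: le_trans (ler_wpM2l (ltW e10) (om_natmul sub k x0)) _.
  rewrite mulrCA -mulrA ler_pM2l// /e1 mulrAC ler_pdivrMr ?ltr_wpDl//.
  by rewrite ler_pM2l ?divr_gt0//; lra.
have fv : fastc om v.
  pose d' := Num.min e1 d; have d'0 : 0 < d' by rewrite lt_min d0 e10.
  exists d', (8 * expR (d * (m%:R * om 1))); split => // y.
  have C0 : 0 <= 8 * expR (d * (m%:R * om 1)) * expR (- (d' * ow om y)).
    by rewrite !mulr_ge0 ?expR_ge0.
  rewrite vE; case: ifPn => Py; last by rewrite cabs0.
  have [[h1 h2 h4] hd hl1 _ _] := hl (idx y).
  pose n : R := (idx y).+1%:R; rewrite -/n in h4.
  have tF t : cabs (tc N (F (idx y)) t) <= 2 * expR (- (n * M)) by exact: tc_le.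
  have bnd : cabs (tc N (F (idx y)) (y 0 0)) <=
      2 * (2 * expR (- (n * M)) * expR (d * (m%:R * (om (nx R (mult (idx y))) + om 1))) + 0) *
        expR (- (d * aw om (y 0 0))).
    apply: (hm d (nx R (mult (idx y))) (2 * expR (- (n * M))) 0
      (qc a (fun _ _ => 0) (mult (idx y))) (tc N (F (idx y))) (fun=> 0)
      ('i%C * (l (idx y))%:C%C) (ltW d0) (nx_ge0 R _)) => //.
    - exact: qc_weighted.
    - by rewrite cabsM cabsi mul1r cabsR.
    - exists (2 * expR (- (n * M))) => t; apply: le_trans (tF t) _.
      rewrite ler_peMr ?mulr_ge0 ?expR_ge0//.
      by rewrite -[leLHS]expR0 ler_expR mulr_ge0 ?(ltW d0)// (aw_ge0 wf).
    - by move=> t; rewrite cabs0 mul0r.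
    - move=> t; have hG : BL (tf (N := N) (fun t => 'i%C * (l (idx y))%:C%C * F (idx y) t)).
        exact: BLZ.
      have := ode_coef wf sub ha h00 h2 h1 hG hd t.
      have -> : tc N (fun t => 'i%C * (l (idx y))%:C%C * F (idx y) t) t =
          'i%C * (l (idx y))%:C%C * tc N (F (idx y)) t.
        exact: (@fcZ R N.+1 _ (tf (F (idx y))) (tz N t) h2).
      by congr is_csum; ring.
  have mono2 : cabs (1 - monodromy a b (mult (idx y))) <= 2.
    apply: le_trans (cabsB _ _) _; rewrite cabs1 cabs_monodromy.
    suff : expR (2 * pi * comb (mult (idx y)) (fun j => mean2pi (b j))) <= 1 by lra.
    rewrite -[leRHS]expR0 ler_expR comb_mult mulrCA mulr_ge0_le0// mulr_ge0_le0//; lra.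
  rewrite (cabsM _ (tc _ _ _)).
  apply: le_trans (ler_pM (cabs_ge0 _) (cabs_ge0 _) mono2 bnd) _.
  rewrite addr0.
  have -> : 2 * (2 * (2 * expR (- (n * M)) *
       expR (d * (m%:R * (om (nx R (mult (idx y))) + om 1)))) * expR (- (d * aw om (y 0 0)))) =
    8 * (expR (- (n * M)) * expR (d * (m%:R * (om (nx R (mult (idx y))) + om 1))) *
      expR (- (d * aw om (y 0 0)))) by ring.
  rewrite -[leRHS]mulrA ler_pM2l// -!expRD ler_expR.
  have q0 : 0 <= om (nx R (mult (idx y))) by rewrite om_ge0// nx_ge0.
  have y0 := aw_ge0 wf (y 0 0).
  have h5 := ler_wpM2r q0 dm.
  have h6 : d' * ow om y <= d' * (aw om (y 0 0) + om (nx R (mult (idx y)))).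
    by rewrite ler_wpM2l ?(ltW d'0)// -nx_P//; exact: ow_le_aw.
  have h7 : d' * om (nx R (mult (idx y))) <= e1 * om (nx R (mult (idx y))).
    by rewrite ler_wpM2r// ge_min lexx.
  have h8 : d' * aw om (y 0 0) <= d * aw om (y 0 0).
    by rewrite ler_wpM2r// ge_min lexx orbT.
  have h9 := om_mult (idx y); rewrite -/n in h9.
  clear -h5 h6 h7 h8 h9; lra.
have [g hg eg] := fastc_realize wf fv.
have /(inEomP wf sub)[bg _ _] := hg.
have su : slow om u by exact: bounded_slow u_le.
have hdist : forall f, inEom om f -> - dual_of u (Lop a b f) = fun_as_dist g f.
  by apply: (solves_dist wf sub ha hb su bg); rewrite eg.
have [h [hh eh]] := hyp _ (dual_of_dual wf sub su) (ex_intro _ g (conj hg hdist)).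
have fcu y : fc h y = u y.
  by rewrite -(mc_fun h) -(mc_dual_of u) /mc eh//; exact: inEom_ee.
have /(inEomP wf sub)[_ _ [dl [A [dl0 hA]]]] := hh.
have A0 := fast_ge0 hA.
have dl2 : 0 < dl / 2 by lra.
have [W W0 hW] := bsum_aw wf dl2.
(* The square is needed because the solutions are only bounded below by [c / n]: the decay must beat
   [1 / n]. *)
have [Cg Cg0 hCg] := om_growth wf 2 dl2.
have sup_le k s : cabs (U k s) <= A * expR (- (dl / 2 * om (nx R (mult k)))) * W.
  have [_ _ _ [h1 h2 _ _] _] := hl k.
  apply: (tf_sup wf h2 h1 dl2 hW) => t.
  have := hA (setz t (mult k)); rewrite fcu uE.
  have [-> ->] := idx_fib (setz t (mult k)) (mult k) (setzS _ _).
  rewrite P_mult idx_mult setz0 => hk; apply: le_trans hk _.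
  rewrite -mulrA -expRD ler_wpM2l// ler_expR.
  have q1 := aw_le_ow wf (setz t (mult k)); have q2 := om_nx_le wf (setz t (mult k)).
  rewrite setz0 in q1; rewrite nx_setz in q2.
  have q3 := ler_wpM2l (ltW dl2) q1; have q4 := ler_wpM2l (ltW dl2) q2.
  clear -q3 q4; lra.
have x1 : 1 <= nx R z.
  rewrite /nx (bigD1 j0)//= -[leLHS]addr0 lerD//.
    by rewrite -[1]/(1%:~R) ler_int -gtz0_ge1 normr_gt0.
  by apply: sumr_ge0 => j _; rewrite ler0z.
(* Large enough for the contradiction [A W Cg < n c] and for the threshold [2 <= n M] of the lower
   bound. *)
pose k := Num.truncn (A * W * Cg / c + 2 / M).
have kn : A * W * Cg / c + 2 / M < k.+1%:R by exact: truncnS_gt.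
have k1 : A * W * Cg < k.+1%:R * c.
  by rewrite -ltr_pdivrMr//; apply: le_lt_trans kn; rewrite lerDl divr_ge0// ltW.
have k2 : 2 <= k.+1%:R * M.
  rewrite -ler_pdivrMr//; apply: le_trans (ltW kn).
  by rewrite lerDr divr_ge0 ?mulr_ge0// ltW.
have [_ _ _ _ /(_ k2)[s hs]] := hl k.
have n0 : 0 < k.+1%:R :> R by [].
have hg2 : (1 + k.+1%:R) ^+ 2 <= Cg * expR (dl / 2 * om (nx R (mult k))).
  apply: le_trans (hCg _ (ltW n0)) _; rewrite ler_pM2l// ler_expR ler_pM2l//.
  by apply: om_mono => //; rewrite nx_mult ler_peMr.
have := le_trans hs (sup_le k s).
rewrite expRN mulrAC ler_pdivlMr ?expR_gt0// mulrAC ler_pdivrMr// => hx.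
have hy := ler_wpM2l (ltW c0) hg2.
have hz := ler_wpM2r (ltW Cg0) hx.
have AW : 0 <= A * W by rewrite mulr_ge0// ltW.
move: hy hz k1 n0; rewrite expr2.
move: (expR _) (k.+1%:R : R) => E n.
clear -c0 Cg0 AW => hy hz k1 n0.
have q : c * n * n <= c * ((1 + n) * (1 + n)) by rewrite -mulrA ler_pM2l//; nra.
have r : c * n * n <= A * W * Cg * n by nra.
rewrite ler_pM2r// in r; lra.
Qed.

End NoSignChange.

Section HalfPlanes.
Variable R : realType.

(* Taking for [q] the floor of [- p m1 / m2] keeps [p m1 + q m2] bounded while [p (x1 m2 - x2 m1)]
   tends to infinity. *)
Let half_planes_pos (m1 m2 x1 x2 : R) : 0 < m2 ->
  (forall p q : int, p%:~R * m1 + q%:~R * m2 <= 0 -> p%:~R * x1 + q%:~R * x2 <= 0) ->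
  x1 * m2 = x2 * m1.
Proof.
move=> m20 h; apply/eqP; rewrite -subr_eq0; apply/negPn/negP => D0.
set D := _ - _ in D0.
have [p hp] : exists p : int, `|x2| * m2 < p%:~R * D.
  have : 0 < `|D| by rewrite normr_gt0.
  have := truncnS_gt (`|x2| * m2 / `|D|); set k := Num.truncn _ => hk D1.
  rewrite ltr_pdivrMr// in hk.
  case: (ltrgt0P D) => Ds; last by rewrite Ds eqxx in D0.
    by exists k.+1%:Z; rewrite -pmulrn; rewrite (gtr0_norm Ds) in hk.
  by exists (- k.+1%:Z); rewrite rmorphN /= -pmulrn mulNr -mulrN; rewrite (ltr0_norm Ds) in hk.
pose q := Num.floor (- (p%:~R * m1) / m2).
have q1 : p%:~R * m1 + q%:~R * m2 <= 0.
  have := floor_le_tmp (- (p%:~R * m1) / m2); rewrite -/q ler_pdivlMr//; lra.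
have q2 : - m2 <= p%:~R * m1 + q%:~R * m2.
  have := ltW (floorD1_gt (- (p%:~R * m1) / m2)); rewrite -/q rmorphD /= ler_pdivrMr//; lra.
have := h p q q1.
have -> : (p%:~R * x1 + q%:~R * x2 <= 0) = (m2 * (p%:~R * x1 + q%:~R * x2) <= 0).
  by rewrite pmulr_rle0.
have -> : m2 * (p%:~R * x1 + q%:~R * x2) = p%:~R * D + x2 * (p%:~R * m1 + q%:~R * m2).
  by rewrite /D; ring.
have : - (`|x2| * m2) <= x2 * (p%:~R * m1 + q%:~R * m2).
  rewrite lerNl; apply: le_trans (ler_norm _) _; rewrite normrN normrM ler_wpM2l//.
  by rewrite ler_norml q2 /=; lra.
lra.
Qed.

Lemma half_planes (m1 m2 x1 x2 : R) : m2 != 0 ->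
  (forall p q : int, p%:~R * m1 + q%:~R * m2 <= 0 -> p%:~R * x1 + q%:~R * x2 <= 0) ->
  x1 * m2 = x2 * m1.
Proof.
rewrite neq_lt => /orP[m20|m20] h; last exact: half_planes_pos.
have m20' : 0 < - m2 by rewrite oppr_gt0.
have := half_planes_pos m20' (x1 := x1) (x2 := - x2) (m1 := m1); rewrite mulrN mulNr.
move=> H; apply: oppr_inj; apply: H => p q.
by have := h p (- q); rewrite rmorphN /= !mulNr !mulrN.
Qed.

End HalfPlanes.

Section SignConditions.
Variables (R : realType) (om : R -> R).
Hypotheses (wf : weight_function om) (sub : om_subadditive om).
Variables (N : nat) (a b : 'I_N -> R -> R).
Hypotheses (ha : forall j, inE1_realom om (a j)) (hb : forall j, inE1_realom om (b j)).
Hypothesis hyp : globally_hypoelliptic om a b.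

Let m (j : 'I_N) := mean2pi (b j).

Let half_space (n : 'I_N -> int) (t : R) :
  \sum_j (n j)%:~R * m j <= 0 -> \sum_j (n j)%:~R * b j t <= 0.
Proof.
pose z : 'rV[int]_N.+1 := \row_i (if unlift ord0 i is Some j then n j else 0).
have e (f : 'I_N -> R) : \sum_j (n j)%:~R * f j = comb z f.
  by apply: eq_bigr => j _; rewrite mxE liftK.
rewrite !e; exact: (hypoelliptic_no_rise wf sub ha hb t hyp).
Qed.

Let half1 j (p : int) (t : R) : p%:~R * m j <= 0 -> p%:~R * b j t <= 0.
Proof.
have e (f : 'I_N -> R) : \sum_k (if k == j then p else 0)%:~R * f k = p%:~R * f j.
  rewrite (bigD1 j)//= eqxx big1 ?addr0// => k /negbTE->; exact: mul0r.
by have := @half_space (fun k => if k == j then p else 0) t; rewrite !e.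
Qed.

Let half2 i j (p q : int) (t : R) : i != j ->
  p%:~R * m i + q%:~R * m j <= 0 -> p%:~R * b i t + q%:~R * b j t <= 0.
Proof.
move=> ij; have ji : (j == i) = false by rewrite eq_sym (negbTE ij).
have e (f : 'I_N -> R) : \sum_k (if k == i then p else if k == j then q else 0)%:~R * f k =
    p%:~R * f i + q%:~R * f j.
  rewrite (bigD1 i)//= eqxx (bigD1 j) ?ji//= eqxx big1 ?addr0//.
  by move=> k /andP[/negbTE-> /negbTE->]; exact: mul0r.
by have := @half_space (fun k => if k == i then p else if k == j then q else 0) t; rewrite !e.
Qed.

Let half_neg j t : m j <= 0 -> b j t <= 0.
Proof. by have := half1 (j := j) (p := 1) t; rewrite mulr1z !mul1r. Qed.

Let half_pos j t : 0 <= m j -> 0 <= b j t.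
Proof. by have := half1 (j := j) (p := -1) t; rewrite mulrN1z !mulN1r !oppr_le0. Qed.

Theorem hypoelliptic_no_sign_change j : ~ changes_sign (b j).
Proof.
move=> [[t ht] [s hs]]; case: (leP (m j) 0) => h.
  by have := half_neg t h; rewrite leNgt ht.
by have := half_pos s (ltW h); rewrite leNgt hs.
Qed.

(** If some mean is nonzero, every [b j] is proportional to that function with the ratio of the
    means, by [half_planes] at each time. If all means vanish, both sign implications apply and [b]
    is zero. *)
Theorem hypoelliptic_span : span_dim_le1 b.
Proof.
case: (pselect (exists j, m j != 0)) => [[j0 hj0]|h0]; last first.
  exists (fun=> 0) => j; exists 0 => t; rewrite mul0r.
  have mj : m j = 0 by apply/eqP; apply: contrapT => h; apply: h0; exists j; exact/negP.
  by apply: le_anti; rewrite half_neg ?half_pos ?mj.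
exists (b j0) => j; exists (m j / m j0) => t.
case: (eqVneq j j0) => [->|jj0]; first by rewrite divff ?mul1r.
have := @half_planes R (m j) (m j0) (b j t) (b j0 t) hj0 (fun p q => @half2 j j0 p q t jj0).
by move=> e; rewrite mulrAC [m j * _]mulrC -e mulfK.
Qed.

End SignConditions.

(** * Sufficiency of the conditions *)

Section CircleDistance.
Variable R : realType.

(** For [cos x <= 1 / 2] the real part is at least one half, enough since [pi <= 4]. Otherwise the
    cosine is at least one half on all of [[0, x]], and the sine is at least [x / 2]. *)
Lemma cis_sub1_ge (x : R) : `|x| <= pi -> `|x| / 8 <= cabs (cis x - 1).
Proof.
wlog x0 : x / 0 <= x.
  move=> H; case: (leP 0 x) => [/H//|xl] h.
  have := H (- x); rewrite oppr_ge0 (ltW xl) normrN => /(_ isT h); congr (_ <= _).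
  rewrite /cabs; congr Num.sqrt; rewrite !ReImE /= cosN sinN; ring.
rewrite ger0_norm// => xpi; have p4 : pi <= 4 :> R by have := @pihalf_lt2 R; lra.
case: (leP (1 / 2) (cos x)) => hc; last first.
  apply: le_trans (Re_le_cabs _); rewrite !ReImE /= ler0_norm; lra.
have [c /andP[c0 c1]] := @rder_MVT R sin cos 0 x x0 (fun s _ => is_derive_sin s).
rewrite sin0 !subr0 => e.
apply: le_trans (Im_le_cabs _); rewrite !ReImE /= subr0.
have : cos x <= cos c.
  by rewrite leNgt ltr_cos -?leNgt// in_itv /= ?x0 ?c0 //=; exact: le_trans c1 _.
move=> cc; have : 1 / 2 * x <= sin x by rewrite e ler_wpM2r//; exact: le_trans hc cc.
move=> h; apply: le_trans (ler_norm _); lra.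
Qed.

(** The distance to 1 bounds the radial defect [1 - exp (- s)], and after a radial projection the
    angle. The radial defect is linear in [s] only for bounded [s], hence the minimum. *)
Lemma polar_sub1_ge (s x : R) : 0 <= s -> `|x| <= pi ->
  Num.min (1 / 2) ((s + `|x|) / 32) <= cabs (1 - (expR (- s))%:C%C * cis x).
Proof.
move=> s0 hx; set r := expR (- s); set D := cabs _.
have r0 : 0 < r by exact: expR_gt0.
have r1 : r <= 1 by rewrite /r -[leRHS]expR0 ler_expR oppr_le0.
have D1 : 1 - r <= D.
  have := cabsD (1 - r%:C%C * cis x) (r%:C%C * cis x).
  rewrite subrK cabs1 (cabsM r%:C%C) cabs_cis mulr1 cabsR gtr0_norm// -/D; lra.
have D2 : `|x| / 8 <= 2 * D.
  apply: le_trans (cis_sub1_ge hx) _.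
  have -> : cis x - 1 = - (1 - r%:C%C * cis x) + (1 - r)%:C%C * cis x.
    by rewrite rmorphB rmorph1; ring.
  apply: le_trans (cabsD _ _) _.
  by rewrite cabsN (cabsM (1 - r)%:C%C) cabs_cis mulr1 cabsR ger0_norm -/D; lra.
have rs : r * (1 + s) <= 1.
  by have := expR_ge1Dx s; have := expRN s; rewrite -/r => -> h; rewrite mulrC ler_pdivrMr ?expR_gt0// mul1r.
case: (leP 1 s) => s1.
  by rewrite ge_min; apply/orP; left; nra.
rewrite ge_min; apply/orP; right.
have : s / 2 <= 1 - r by nra.
lra.
Qed.

End CircleDistance.

Section Sufficiency.
Variables (R : realType) (om : R -> R).
Hypotheses (wf : weight_function om) (sub : om_subadditive om).
Variables (N : nat) (a b : 'I_N -> R -> R).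
Hypotheses (ha : forall j, inE1_realom om (a j)) (hb : forall j, inE1_realom om (b j)).
Implicit Types (z : 'rV[int]_N.+1).
Hypothesis edc : EDC1 om (fun j => mean2pi (a j)) (fun j => mean2pi (b j)).

Lemma symb_ge (eps : R) : 0 < eps -> exists2 C : R, 0 < C & forall z, z != 0 ->
  C * expR (- (eps * om (n2 R z))) <= cabs (symb a b z).
Proof.
move=> e0; have [C [C0 hC]] := edc e0; exists C => // z z0.
have hz : z 0 0 != 0 \/ exists j, z 0 (lift ord0 j) != 0.
  apply: contrapT => h; move/eqP: z0; apply; apply: row_split => [|j]; rewrite mxE;
    apply/eqP; apply: contrapT => /negP hz; apply: h; [by left|by right; exists j].
have := hC (z 0 0) (fun j => z 0 (lift ord0 j)) hz.
have -> : Num.sqrt ((z 0 0)%:~R ^+ 2 + \sum_(j < N) (z 0 (lift ord0 j))%:~R ^+ 2) = n2 R z.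
  by rewrite /n2 big_ord_recl.
congr (_ <= cabs _); rewrite /symb /c0 /comb -(rmorph_int (real_complex R)).
by apply: complex_ext; rewrite !ReImE /= ?add0r.
Qed.

Definition xpart_neq0 z := [exists j, z 0 (lift ord0 j) != 0].

(** The monodromy depends on the fibre only, so the Diophantine condition may be used at the point
    of the fibre whose tau brings the real part of the symbol closest to 0; there the symbol is
    comparable with the logarithm of the monodromy. *)
Lemma monodromy_ge (e : R) : 0 < e -> exists2 c : R, 0 < c & forall z, xpart_neq0 z ->
  comb z (fun j => mean2pi (b j)) <= 0 ->
  c * expR (- (e * om (nx R z))) <= cabs (1 - monodromy a b z).
Proof.
move=> e0; have [K hK] := symb_le a b.
pose m := Num.truncn `|K|; have mK : `|K| <= m.+1%:R by exact/ltW/truncnS_gt.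
(* The chosen tau is at most [(m + 1) (|xi| + 1)] in modulus, so omega of the full frequency is at
   most [m + 2] times omega of [|xi|], up to a constant. *)
pose eps := e / (m.+1%:R + 1); have m1 : 0 < m.+1%:R + 1 :> R by rewrite ltr_wpDl.
have eps0 : 0 < eps by rewrite divr_gt0.
have [C C0 hC] := symb_ge eps0.
exists (Num.min (1 / 2) (C * expR (- (eps * (m.+1%:R * om 1))) / 32)).
  by rewrite lt_min !divr_gt0 ?mulr_gt0 ?expR_gt0.
move=> z zx be0; have x0 := nx_ge0 R z; have ox0 := om_ge0 wf x0.
have pp := pi_gt0 R; have p2 := @pi_ge2 R.
pose al := complex.Re (c0 a b z); pose be := complex.Im (c0 a b z).
have [k hk] := nearest_period (2 * pi * al).
pose y := setz (- k) z.
have y0 : y != 0.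
  have /existsP[j hj] := zx; apply: contra hj => /eqP yE.
  by rewrite -(setzS (- k) z j) -/y yE mxE.
have hy := hC y y0.
have sy : symb a b y = ((al - k%:~R) +i* be)%C.
  rewrite /symb c0_setz setz0 -(rmorph_int (real_complex R)).
  by apply: complex_ext; rewrite !ReImE /= ?rmorphN /al /be /=; ring.
have mE : monodromy a b z = (expR (- (- (2 * pi * be))))%:C%C * cis (- (2 * pi * (al - k%:~R))).
  rewrite /monodromy.
  have -> : - ((2 * pi)%:C%C * 'i%C * c0 a b z) =
    'i%C * (2 * pi * k%:~R * -1)%:C%C + (2 * pi * be +i* - (2 * pi * (al - k%:~R)))%C.
    by apply: complex_ext; rewrite !ReImE /= /al /be /=; ring.
  by rewrite cexpD -cis_cexp mulrN1 -mulrN -rmorphN cis_2pi_int mul1r /cexp /= opprK.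
have tx : `|- (2 * pi * (al - k%:~R))| <= pi by rewrite normrN mulrBr.
have s0 : 0 <= - (2 * pi * be).
  by rewrite oppr_ge0 mulr_ge0_le0// mulr_ge0// ltW.
have := polar_sub1_ge s0 tx; rewrite -mE; apply: le_trans.
have E1 : expR (- (e * om (nx R z))) <= 1.
  by rewrite -[leRHS]expR0 ler_expR oppr_le0 mulr_ge0// ltW.
have E0 := expR_gt0 (- (e * om (nx R z))).
rewrite le_min; apply/andP; split.
  apply: le_trans (_ : 1 / 2 * expR (- (e * om (nx R z))) <= _).
    by rewrite ler_pM2r// ge_min lexx.
  lra.
apply: le_trans (_ : C * expR (- (eps * (m.+1%:R * om 1))) / 32 * expR (- (e * om (nx R z))) <= _).
  by rewrite ler_pM2r// ge_min lexx orbT.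
rewrite mulrAC ler_pM2r ?invr_gt0//.
have sle : cabs (symb a b y) <= - (2 * pi * be) + `|- (2 * pi * (al - k%:~R))|.
  apply: le_trans (cabs_le_ReIm _) _; rewrite sy /= normrN normrM (gtr0_norm (mulr_gt0 _ pp))//.
  have be0' : be <= 0 by [].
  rewrite (ler0_norm be0').
  have q := normr_ge0 (al - k%:~R); nra.
apply: le_trans sle; apply: le_trans hy.
rewrite -mulrA -expRD ler_pM2l// ler_expR.
have kle : `|- k|%:~R <= m.+1%:R * (nx R z + 1).
  rewrite normrN intr_norm.
  have h1 : `|k%:~R - al| <= 1 / 2.
    rewrite -(ler_pM2l (mulr_gt0 (ltr0n R 2) pp)) -{1}(gtr0_norm (mulr_gt0 (ltr0n R 2) pp)) -normrM.
    by rewrite mulrBr distrC; lra.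
  have h2 : `|al| <= m.+1%:R * nx R z.
    apply: le_trans (Re_le_cabs _) _; apply: le_trans (hK z) _.
    by rewrite ler_wpM2r//; apply: le_trans (ler_norm _) mK.
  have := ler_normD (k%:~R - al) al; rewrite subrK.
  have : 1 <= m.+1%:R :> R by rewrite ler1n.
  lra.
have owy : om (n2 R y) <= m.+1%:R * (om (nx R z) + om 1) + om (nx R z).
  apply: le_trans (om_n2_le wf y) _; apply: le_trans (ow_le_aw sub y) _.
  rewrite nx_setz lerD2r setz0 /aw.
  apply: le_trans (om_mono wf _ kle) _; first by rewrite ler0z.
  apply: le_trans (om_natmul sub m _) _; first by rewrite addr_ge0.
  by rewrite ler_wpM2l// sub.
have := ler_wpM2l (ltW eps0) owy.
have : eps * ((m.+1%:R + 1) * om (nx R z)) = e * om (nx R z).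
  by rewrite mulrA /eps divfK// gt_eqF.
lra.
Qed.

End Sufficiency.

Section FiberFunctions.
Variables (R : realType) (om : R -> R).
Hypotheses (wf : weight_function om) (sub : om_subadditive om).
Variable N : nat.
Implicit Types (z y : 'rV[int]_N.+1).

Lemma xpartP z : ~~ xpart_neq0 z -> forall j, z 0 (lift ord0 j) = 0.
Proof. by move=> /existsPn h j; have := h j; rewrite negbK => /eqP. Qed.

Lemma xpart_fib y z : (forall j, y 0 (lift ord0 j) = z 0 (lift ord0 j)) ->
  xpart_neq0 y = xpart_neq0 z.
Proof. by move=> e; apply: eq_existsb => j; rewrite e. Qed.

(** The fibre of [z] is transported to the tau axis, whose series defines a function of [t]
    alone. *)
Lemma fiber_fun (c : 'rV[int]_N.+1 -> R[i]) z : fastc om c ->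
  exists p : R -> R[i], [/\ tper p, BL (tf (N := N) p) & forall t, tc N p t = c (setz t z)].
Proof.
move=> [d [A [d0 hA]]].
pose c' y := if xpart_neq0 y then 0 else c (setz (y 0 0) z).
have fc' : fastc om c'.
  apply: (fastc_of_fibers (K := 0) (C := A) wf sub d0) => y hy; rewrite /c'; last first.
    case: ifPn => // xy; move: hy; rewrite /nx big1 ?ltxx// => j _.
    by rewrite (xpartP xy) normr0.
  case: ifP => _; first by rewrite cabs0 mulr_ge0 ?expR_ge0// (fast_ge0 hA).
  apply: le_trans (hA _) _; rewrite ler_wpM2l ?(fast_ge0 hA)// ler_expR lerN2 ler_pM2l//.
  by have := aw_le_ow wf (setz (y 0 0) z); rewrite setz0.
have [W _ hW] := fast_bsum wf fc'; have [f hf] := ser_exists hW.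
pose p t := f (t *: 'e_ord0).
have pE : tf p = f.
  apply/funext => x; rewrite /tf /p; apply: (is_csum_inj (hf _)).
  apply: eq_is_csum (hf x) => y; rewrite /c'; case: ifPn => xy; first by rewrite !mul0r.
  congr (_ * cis _); rewrite /dot !big_ord_recl !big1 => [|j _|j _].
  - by rewrite !mxE !eqxx mulr1.
  - by rewrite (xpartP xy) mul0r.
  - by rewrite (xpartP xy) mul0r.
exists p; split; last first.
- move=> t; rewrite /tc pE (fc_ser wf fc' hf) /c' (_ : xpart_neq0 _ = false) ?setz0//.
  by apply/existsP => -[j]; rewrite setzS mxE eqxx.
- by rewrite pE; exact: (ser_BL wf fc' hf).
- by move=> t; rewrite /p scalerDl (ser_periodic hf).
Qed.

(** Half of the rate sums over tau, the other half stays as decay in xi, with constants common to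
    all fibres. *)
Lemma fiber_fun_sup (c : 'rV[int]_N.+1 -> R[i]) : fastc om c ->
  exists d A W : R, [/\ 0 < d, fast om d A c, 0 < W & forall z, exists p : R -> R[i],
    [/\ tper p, BL (tf (N := N) p), forall t, tc N p t = c (setz t z) &
     forall t, cabs (p t) <= A * expR (- (d / 2 * om (nx R z))) * W]].
Proof.
move=> hc; have [d [A [d0 hA]]] := hc; have d2 : 0 < d / 2 by lra.
have [W W0 hW] := bsum_aw wf d2; exists d, A, W; split => // z.
have [p [h1 h2 h3]] := fiber_fun z hc; exists p; split => //.
apply: (tf_sup wf h2 h1 d2 hW) => t; rewrite h3; apply: le_trans (hA _) _.
rewrite -mulrA -expRD ler_wpM2l ?(fast_ge0 hA)// ler_expR.
have q1 := aw_le_ow wf (setz t z); have q2 := om_nx_le wf (setz t z).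
rewrite setz0 in q1; rewrite nx_setz in q2.
have := ler_wpM2l (ltW d2) q1; have := ler_wpM2l (ltW d2) q2; lra.
Qed.

End FiberFunctions.

Section FiberSolutions.
Variables (R : realType) (om : R -> R).
Hypotheses (wf : weight_function om) (sub : om_subadditive om).
Variables (N : nat) (a b : 'I_N -> R -> R).
Hypotheses (ha : forall j, inE1_realom om (a j)) (hb : forall j, inE1_realom om (b j)).
Hypothesis nosign : forall j, ~ changes_sign (b j).
Hypothesis span1 : span_dim_le1 b.
Hypothesis edc : EDC1 om (fun j => mean2pi (a j)) (fun j => mean2pi (b j)).
Implicit Types (z y : 'rV[int]_N.+1).

(** Every combination is a multiple of the common function [g], which has one sign as soon as some
    [b j] is a nonzero multiple of it. *)
Lemma comb_signed z : (forall t, comb z (fun j => b j t) <= 0) \/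
  (forall t, 0 <= comb z (fun j => b j t)).
Proof.
have [g /choice[c hc]] := span1.
pose k := comb z c.
have kE t : comb z (fun j => b j t) = k * g t.
  by rewrite /k /comb mulr_suml; apply: eq_bigr => j _; rewrite hc mulrA.
case: (eqVneq k 0) => [k0|kn]; first by left => t; rewrite kE k0 mul0r.
have [j cj] : exists j, c j != 0.
  apply: contrapT => h; case/negP: kn; apply/eqP; rewrite /k /comb big1// => j _.
  case: (eqVneq (c j) 0) => [->|cj]; first by rewrite mulr0.
  by case: h; exists j.
have sg : (forall t, g t <= 0) \/ (forall t, 0 <= g t).
  apply: contrapT => /not_orP[/existsNP[t ht] /existsNP[s hs]].
  apply: (nosign (j := j)); move/negP: ht; move/negP: hs; rewrite -!ltNge => hs ht.
  have bt := hc j t; have bs := hc j s.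
  by case: (ltrgt0P (c j)) cj => // cs _; split; [exists t|exists s|exists s|exists t]; nra.
have ks := kn; rewrite neq_lt in ks.
by case: sg => hg; case/orP: ks => ks; [right|left|left|right] => t; rewrite kE; have := hg t; nra.
Qed.

Variables PA PB : 'I_N -> R -> R.
Hypothesis hPA : forall j, is_primitive (a j) (PA j).
Hypothesis hPB : forall j, is_primitive (b j) (PB j).

Lemma monodromyN z : monodromy a b (- z) * monodromy a b z = 1.
Proof.
have cN (f : 'I_N -> R) : comb (- z) f = - comb z f.
  by rewrite /comb -sumrN; apply: eq_bigr => j _; rewrite mxE rmorphN mulNr.
have e : c0 a b (- z) = - c0 a b z by rewrite /c0 !cN.
by rewrite /monodromy e -cexpD mulrN opprK addrC addNr cexp0.
Qed.

Lemma xpartN z : xpart_neq0 (- z) = xpart_neq0 z.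
Proof. by apply: eq_existsb => j; rewrite mxE oppr_eq0. Qed.

Lemma nxN z : nx R (- z) = nx R z.
Proof. by apply: eq_bigr => j _; rewrite mxE normrN. Qed.

(** [r] bounds the exponential factor in [sol_le]. For a nonpositive combination [r = 1]. For a
    nonnegative one [r] is the modulus of the monodromy, possibly huge, but [1 - monodromy] at [z]
    equals in modulus that at [- z] times [r], so the quotient is as good as in the first case. *)
Lemma sol_monodromy (e : R) : 0 < e -> exists2 c : R, 0 < c & forall z, xpart_neq0 z ->
  exists r : R, [/\ 0 < r, c * expR (- (e * om (nx R z))) * r <= cabs (1 - monodromy a b z) &
   forall t s, t - 2 * pi <= s <= t -> expR (Bz PB z t - Bz PB z s) <= r].
Proof.
move=> e0; have [c c0 hc] := monodromy_ge wf sub edc e0; exists c => // z zx.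
have p0 := twopi_gt0 R.
have shift t : Bz PB z t - Bz PB z (t - 2 * pi) = 2 * pi * comb z (fun j => mean2pi (b j)).
  by have := Bz_shift a hPB z (t - 2 * pi); rewrite subrK => ->; rewrite addrC addKr.
have [s|s] := comb_signed z.
  have mono t r : r <= t -> Bz PB z t - Bz PB z r <= 0.
    move=> rt; rewrite subr_le0 -lerN2.
    apply: (@rder_ge0 R (fun t => - Bz PB z t) _ r t rt (fun t _ => rderN (rder_Bz hPB z t))).
    by move=> q _; rewrite oppr_ge0.
  have be : comb z (fun j => mean2pi (b j)) <= 0.
    have : 0 - 2 * pi <= 0 :> R by lra.
    by move=> /mono; rewrite shift pmulr_rle0.
  exists 1; split => //; first by rewrite mulr1; exact: hc.
  move=> t r /andP[_ rt]; rewrite -[leRHS]expR0 ler_expR; exact: mono.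
have mono t r : r <= t -> Bz PB z r <= Bz PB z t.
  by move=> rt; apply: (rder_ge0 rt (fun t _ => rder_Bz hPB z t)).
have be : comb (- z) (fun j => mean2pi (b j)) <= 0.
  have : 0 - 2 * pi <= 0 :> R by lra.
  move=> /mono; rewrite -subr_ge0 shift pmulr_rge0// => h.
  have -> : comb (- z) (fun j => mean2pi (b j)) = - comb z (fun j => mean2pi (b j)).
    by rewrite /comb -sumrN; apply: eq_bigr => j _; rewrite mxE rmorphN mulNr.
  by rewrite oppr_le0.
exists (cabs (monodromy a b z)); rewrite cabs_monodromy; split; first exact: expR_gt0.
  have := hc (- z); rewrite xpartN nxN => /(_ zx be) h.
  have -> : cabs (1 - monodromy a b z) = cabs (1 - monodromy a b (- z)) * cabs (monodromy a b z).
    by rewrite -cabsM mulrBl monodromyN mul1r -cabsN opprB.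
  by rewrite cabs_monodromy ler_pM2r// expR_gt0.
move=> t r /andP[r1 r2]; rewrite ler_expR -(shift t) lerD2l lerN2; exact: mono.
Qed.

Lemma fiber_solution (e : R) : 0 < e -> exists2 c : R, 0 < c & forall z F H, xpart_neq0 z ->
  BL (tf (N := N) F) -> tper F -> (forall t, cabs (F t) <= H) ->
  exists u : R -> R[i], [/\ tper u, BL (tf (N := N) u),
    forall t, cder u t (F t - 'i%C * gam a b z t * u t) &
    forall t, cabs (u t) <= c * expR (e * om (nx R z)) * H].
Proof.
move=> e0; have [c c0 hc] := sol_monodromy e0.
have pp := pi_gt0 R.
exists (4 * pi / c) => [|z F H zx hF pF bF]; first by rewrite divr_gt0// mulr_gt0.
have [r [r0 hr hB]] := hc z zx.
have H0 : 0 <= H by exact: le_trans (cabs_ge0 _) (bF 0).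
have [G hG] := ode_primitive hPA hPB z hF.
have E0 := expR_gt0 (- (e * om (nx R z))).
have k0 : 0 < cabs (1 - monodromy a b z) by apply: lt_le_trans hr; rewrite !mulr_gt0.
have kn : 1 - monodromy a b z != 0 by apply: contraTneq k0 => ->; rewrite cabs0 ltxx.
exists (fun t => (1 - monodromy a b z)^-1 * sol PA PB z G t); split.
- by move=> t; rewrite (sol_per hPA hPB pF hG).
- exact: BLZ (sol_BL wf sub ha hb hPA hPB hF pF hG).
- move=> t; apply: cder_eq (cderZ _ (sol_cder hPA hPB pF hG t)) _.
  by rewrite mulrBr mulrA mulVf// mul1r; ring.
- move=> t; rewrite (cabsM _ (sol _ _ _ _ _)) cabsV.
  have hs : cabs (sol PA PB z G t) <= 4 * pi * (r * H).
    apply: (sol_le hG) => s hs; apply: ler_pM; rewrite ?expR_ge0 ?cabs_ge0//; exact: hB.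
  rewrite mulrC ler_pdivrMr//; apply: le_trans hs _.
  have -> : 4 * pi * (r * H) = 4 * pi / c * expR (e * om (nx R z)) * H *
      (c * expR (- (e * om (nx R z))) * r).
    rewrite expRN; field; rewrite ?gt_eqF ?expR_gt0//.
  by rewrite ler_wpM2l// !mulr_ge0 ?expR_ge0// ?invr_ge0 ltW.
Qed.

End FiberSolutions.

(** * Solvability for data of zero mean *)

Section Solvability.
Variables (R : realType) (om : R -> R).
Hypotheses (wf : weight_function om) (sub : om_subadditive om).
Variables (N : nat) (a b : 'I_N -> R -> R).
Hypotheses (ha : forall j, inE1_realom om (a j)) (hb : forall j, inE1_realom om (b j)).
Implicit Types (z y : 'rV[int]_N.+1) (f : 'rV[R]_N.+1 -> R[i]).

Lemma qc_xpart z k : ~~ xpart_neq0 z -> qc a b z k = 0.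
Proof.
by move=> xz; rewrite /qc big1// => j _; rewrite (xpartP xz) mulr0 mul0r.
Qed.

Lemma fc_Lop0 f : inEom om f -> fc (Lop a b f) 0 = 0.
Proof.
move=> hf; have := fc_Lop wf sub ha hb hf 0.
have x0 : ~~ xpart_neq0 (0 : 'rV[int]_N.+1) by apply/existsPn => j; rewrite mxE eqxx.
rewrite mxE mulr0 mul0r subr0 => h.
apply: (is_csum_inj h); apply: eq_is_csum (@is_csum0 R _) => k.
by rewrite qc_xpart// mul0r.
Qed.

Section Sufficient.
Hypothesis nosign : forall j, ~ changes_sign (b j).
Hypothesis span1 : span_dim_le1 b.
Hypothesis edc : EDC1 om (fun j => mean2pi (a j)) (fun j => mean2pi (b j)).

Lemma fiber_solutions (c : 'rV[int]_N.+1 -> R[i]) : fastc om c ->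
  exists d A : R, [/\ 0 < d, fast om d A c & exists B : R, 0 <= B /\ forall z, xpart_neq0 z ->
   exists u : R -> R[i], [/\ tper u, BL (tf (N := N) u),
    forall t, cabs (u t) <= B * expR (- (d / 4 * om (nx R z))) &
    forall t, is_csum (fun k => qc a b z k * tc N u (t - k 0 0))
      (c (setz t z) - 'i%C * t%:~R * tc N u t)]].
Proof.
move=> hc; have [d [A [W [d0 hA W0 hp]]]] := fiber_fun_sup wf sub hc.
have [PA [PB hP]] := coef_primitives wf sub ha hb.
have hPA j := (hP j).1; have hPB j := (hP j).2.
have d4 : 0 < d / 4 by lra.
have [C C0 hC] := fiber_solution wf sub ha hb nosign span1 edc hPA hPB d4.
have A0 := fast_ge0 hA.
exists d, A; split => //; exists (C * (A * W)); split; first by rewrite !mulr_ge0// ltW.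
move=> z xz; have [p [p1 p2 p3 p4]] := hp z.
have [u [u1 u2 u3 u4]] := hC z p _ xz p2 p1 p4.
exists u; split => // t; last first.
  by have := ode_coef wf sub ha hb u2 u1 p2 u3 t; rewrite p3.
apply: le_trans (u4 t) _.
have -> : C * expR (d / 4 * om (nx R z)) * (A * expR (- (d / 2 * om (nx R z))) * W) =
  C * (A * W) * (expR (d / 4 * om (nx R z)) * expR (- (d / 2 * om (nx R z)))) by ring.
rewrite ler_wpM2l ?mulr_ge0 ?(ltW C0) ?(ltW W0)// -expRD ler_expR; lra.
Qed.

Theorem solve_zero_mean f : inEom om f -> fc f 0 = 0 ->
  exists u, inEom om u /\ f = Lop a b u.
Proof.
move=> hf f0; have /(inEomP wf sub)[_ _ hc] := hf; set c := fc f in hc f0.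
have [d0 [A [d00 hA [B [B0 hB]]]]] := fiber_solutions hc.
have /choice[U hU] : forall z, exists u : R -> R[i], xpart_neq0 z ->
   [/\ tper u, BL (tf (N := N) u),
    forall t, cabs (u t) <= B * expR (- (d0 / 4 * om (nx R z))) &
    forall t, is_csum (fun k => qc a b z k * tc N u (t - k 0 0))
      (c (setz t z) - 'i%C * t%:~R * tc N u t)].
  move=> z; case: (boolP (xpart_neq0 z)) => xz; last by exists (fun=> 0).
  by have [u hu] := hB z xz; exists u.
have A0 := fast_ge0 hA.
have xset t z : xpart_neq0 (setz t z) = xpart_neq0 z by apply: xpart_fib => j; rewrite setzS.
(* [U] is taken at [setz 0 y], one choice per fibre. On the fibre [xi = 0] the equation is
   [i tau u = c], solvable at [tau = 0] because the mean of [f] vanishes. *)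
have [u uE] : exists u : 'rV[int]_N.+1 -> R[i], forall y, u y =
    if xpart_neq0 y then tc N (U (setz 0 y)) (y 0 0)
    else if y 0 0 == 0 then 0 else c y / ('i%C * (y 0 0)%:~R).
  by exists (fun y => if xpart_neq0 y then tc N (U (setz 0 y)) (y 0 0)
    else if y 0 0 == 0 then 0 else c y / ('i%C * (y 0 0)%:~R)).
have iz t : t != 0 -> 'i%C * t%:~R != 0 :> R[i].
  move=> t0; rewrite mulf_neq0 ?intr_eq0//.
  by apply/eqP => /(congr1 (@cabs R)); rewrite cabsi cabs0 => /eqP; rewrite oner_eq0.
have solv : solves a b u c.
  move=> y; case: (boolP (xpart_neq0 y)) => xy.
    have xr : xpart_neq0 (setz 0 y) by rewrite xset.
    have [_ _ _ /(_ (y 0 0))] := hU _ xr; rewrite setz_setz setz_id uE xy.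
    apply: eq_is_csum => k.
    have -> : qc a b (setz 0 y) k = qc a b y k by apply: qc_eq => j; rewrite setzS.
    have e : setz (y 0 0) y - sh N k = setz (y 0 0 - k 0 0) y by exact: setz_sh.
    by rewrite -[in u _](setz_id y) e uE xset xy setz0 setz_setz.
  have -> : c y - 'i%C * (y 0 0)%:~R * u y = 0.
    rewrite uE (negbTE xy); case: (eqVneq (y 0 0) 0) => [y0|y0].
      rewrite mulr0 subr0 (_ : y = 0)//; apply: row_split => [|j]; rewrite mxE//.
      exact: xpartP.
    by rewrite mulrC divfK ?subrr// iz.
  by apply: eq_is_csum (@is_csum0 R _) => k; rewrite qc_xpart// mul0r.
have [d1 [S [d10 S0 hS]]] := cf_weighted wf sub ha hb.
have [m hm] := fiber_decay wf sub (ltW S0) (lexx 0).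
(* The fibre solutions decay in xi at rate [d0 / 4]: one half pays the loss [d m] of [fiber_decay],
   the other half covers the final rate [d]. *)
pose d := Num.min d1 (d0 / 8 / m.+1%:R).
have d_gt0 : 0 < d by rewrite lt_min d10 !divr_gt0.
have dm : d * m.+1%:R <= d0 / 8.
  by rewrite -ler_pdivlMr// ge_min lexx orbT.
have dd0 : d <= d0 / 8.
  by apply: le_trans dm; rewrite ler_peMr ?(ltW d_gt0)// ler1n.
have hS2 j : bsum (fun k => cabs (cf a b j k) * expR (d * ow om k)) S.
  apply: bsum_le (hS j) => k; rewrite ler_wpM2l ?cabs_ge0// ler_expR ler_wpM2r//.
    exact: ow_ge0.
  by rewrite ge_min lexx.
have fu : fastc om u.
  pose C := 4 * B * expR (d * (m%:R * om 1)) + 2 * A.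
  have BE0 : 0 <= B * expR (d * (m%:R * om 1)) by rewrite mulr_ge0// expR_ge0.
  exists d, C; split => // y.
  case: (boolP (xpart_neq0 y)) => xy; last first.
    have AC : A * expR (- (d0 * ow om y)) <= C * expR (- (d * ow om y)).
      apply: ler_pM; rewrite ?expR_ge0//; first by rewrite /C; lra.
      by rewrite ler_expR lerN2 ler_wpM2r ?ow_ge0//; lra.
    apply: le_trans AC; apply: le_trans (hA y).
    rewrite uE (negbTE xy); case: (eqVneq (y 0 0) 0) => [_|y0]; first by rewrite cabs0 cabs_ge0.
    rewrite (cabsM (c y)) cabsV (cabsM 'i%C) cabsi mul1r cabs_int.
    rewrite ler_pdivrMr ?ltr0z ?normr_gt0// ler_peMr ?cabs_ge0//.
    by rewrite -[1]/(1%:~R) ler_int -gtz0_ge1 normr_gt0.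
  have xr : xpart_neq0 (setz 0 y) by rewrite xset.
  have [u1 u2 u3 u4] := hU _ xr; rewrite nx_setz in u3.
  have q0 : 0 <= om (nx R y) by rewrite om_ge0// nx_ge0.
  pose H := 2 * (B * expR (- (d0 / 4 * om (nx R y)))).
  pose G := A * expR (- (d0 / 2 * om (nx R y))).
  have H0 : 0 <= H by rewrite !mulr_ge0// expR_ge0.
  have tcH t : cabs (tc N (U (setz 0 y)) t) <= H by exact: tc_le.
  have bnd : cabs (u y) <= 2 * (H * expR (d * (m%:R * (om (nx R y) + om 1))) + G) *
      expR (- (d * aw om (y 0 0))).
    rewrite uE xy.
    apply: (hm d (nx R y) H G (qc a b (setz 0 y)) (tc N (U (setz 0 y)))
      (fun t => c (setz t y)) 0 (ltW d_gt0) (nx_ge0 R _) H0).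
    - by rewrite mulr_ge0// expR_ge0.
    - by have := qc_weighted (setz 0 y) hS2; rewrite -/(nx R (setz 0 y)) nx_setz; exact.
    - by rewrite cabs0.
    - exists H => t; apply: le_trans (tcH t) _.
      by rewrite ler_peMr// -[leLHS]expR0 ler_expR mulr_ge0 ?(ltW d_gt0)// (aw_ge0 wf).
    - by move=> t _; exact: tcH.
    - move=> t; apply: le_trans (hA _) _; rewrite -mulrA -expRD ler_wpM2l// ler_expR.
      have q1 := aw_le_ow wf (setz t y); have q2 := om_nx_le wf (setz t y).
      rewrite setz0 in q1; rewrite nx_setz in q2.
      have d02 : 0 <= d0 / 2 by lra.
      have := ler_wpM2l d02 q1; have := ler_wpM2l d02 q2.
      have : d * aw om t <= d0 / 2 * aw om t by rewrite ler_wpM2r ?(aw_ge0 wf)//; lra.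
      lra.
    - move=> t; have := u4 t; rewrite setz_setz subr0; exact.
  apply: le_trans bnd _.
  have h6 : d * ow om y <= d * (aw om (y 0 0) + om (nx R y)).
    by rewrite ler_wpM2l ?(ltW d_gt0)//; exact: ow_le_aw.
  have h7 : d * om (nx R y) <= d0 / 8 * om (nx R y) by rewrite ler_wpM2r.
  have h8 : d * m%:R * om (nx R y) <= d0 / 8 * om (nx R y).
    rewrite ler_wpM2r//; apply: le_trans dm; rewrite ler_pM2l// ler_nat//.
  have h9 : H * expR (d * (m%:R * (om (nx R y) + om 1))) <=
      2 * (B * expR (d * (m%:R * om 1))) * expR (- (d * om (nx R y))).
    have -> : H * expR (d * (m%:R * (om (nx R y) + om 1))) = 2 * (B *
      (expR (- (d0 / 4 * om (nx R y))) * expR (d * (m%:R * (om (nx R y) + om 1))))).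
      by rewrite /H; ring.
    rewrite -[leRHS]mulrA ler_pM2l// -[leRHS]mulrA -!expRD ler_wpM2l// ler_expR.
    lra.
  have h10 : G <= A * expR (- (d * om (nx R y))).
    have q1 : 0 <= d0 * om (nx R y) by rewrite mulr_ge0// ltW.
    by rewrite /G ler_wpM2l// ler_expR; lra.
  apply: le_trans (_ : C * expR (- (d * om (nx R y))) * expR (- (d * aw om (y 0 0))) <= _).
    apply: ler_wpM2r; first exact: expR_ge0.
    by move: h9 h10; rewrite /C => h9 h10; lra.
  rewrite -mulrA -expRD; apply: ler_wpM2l; first by rewrite /C; lra.
  by rewrite ler_expR; lra.
have [h hh eh] := fastc_realize wf fu.
exists h; split => //; apply/esym/(Lop_unique wf sub ha hb hh hf); by rewrite eh.
Qed.

Theorem sufficient_solvable : strongly_solvable om a b.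
Proof.
have range g : inEom om g -> ((exists f, inEom om f /\ g = Lop a b f) <-> fc g 0 = 0).
  by move=> hg; split => [[f [hf ->]]|]; [exact: fc_Lop0|exact: solve_zero_mean].
split.
  move=> g hg ng; have g0 : fc g 0 != 0.
    by apply/eqP => e; apply: ng; exact/(range g hg).
  have k0 := cabs_gt0 g0.
  (* The range is the kernel of the continuous functional [fc _ 0]; a perturbation whose mean is at
     most half that of [g] cannot cancel it. *)
  exists [set h | inEom om h /\ cabs (fc h 0) <= cabs (fc g 0) / 2]; split; last first.
    move=> h hh [_ h2] [f [hf e]].
    have /(inEomP wf sub)[bg _ _] := hg; have /(inEomP wf sub)[bh _ _] := hh.
    have : fc (fun x => g x + h x) 0 = 0 by rewrite e; exact: fc_Lop0.
    rewrite fcD// => /eqP; rewrite addr_eq0 => /eqP e0.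
    by move: h2; rewrite e0 cabsN; move: k0; rewrite e0 cabsN; lra.
  split.
    move=> f1 f2 p q [h1 e1] [h2 e2] pq; split.
      by apply: (inEomD wf sub); exact: (inEomZ wf sub).
    have /(inEomP wf sub)[b1 _ _] := h1; have /(inEomP wf sub)[b2 _ _] := h2.
    rewrite fcD ?fcZ//; [|exact: BLZ..].
    apply: le_trans (cabsD _ _) _; rewrite (cabsM p) (cabsM q).
    have := ler_wpM2l (cabs_ge0 p) e1; have := ler_wpM2l (cabs_ge0 q) e2.
    have := cabs_ge0 p; have := cabs_ge0 q; nra.
  move=> k; have l0 : 0 < (k.+1%:R)^-1 :> R by rewrite invr_gt0.
  have [d [C [d0 C0 hC]]] := fc_fast wf sub N.+1 l0.
  exists (cabs (fc g 0) / 2 / C); split; first by rewrite !divr_gt0.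
  move=> f sf pf nf; split.
    by split => //; split => //; exists (k.+1%:R)^-1; split => //; exists (cabs (fc g 0) / 2 / C).
  have := hC f _ sf pf nf 0; rewrite (mulrC C) divfK ?gt_eqF// => h.
  apply: le_trans h _; rewrite ler_piMr ?divr_ge0 ?(ltW k0)//.
  by rewrite -[leRHS]expR0 ler_expR oppr_le0 mulr_ge0 ?(ltW d0)// ow_ge0.
(* A functional vanishing on all functions of mean zero is a multiple of the mean, with factor its
   value at the constant 1. *)
exists 1%N, (fun _ f => fc f 0) => mu hmu kmu.
exists (fun _ => mu (fun=> 1)) => f hf; rewrite big_ord1.
have h1 : inEom om (fun _ : 'rV[R]_N.+1 => 1 : R[i]).
  have := inEom_ee wf (0 : 'rV[int]_N.+1); congr inEom.
  by apply/funext => x; rewrite ee0.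
have hm1 := inEomZ wf sub (- fc f 0) h1.
have hg := inEomD wf sub hf hm1.
have /(inEomP wf sub)[bf _ _] := hf; have /(inEomP wf sub)[b1 _ _] := h1.
have fc1 : fc (fun _ : 'rV[R]_N.+1 => 1 : R[i]) 0 = 1.
  have -> : (fun=> 1) = ee (0 : 'rV[int]_N.+1) :> ('rV[R]_N.+1 -> R[i]).
    by apply/funext => x; rewrite ee0.
  by rewrite fc_ee eqxx.
have g0 : fc (fun x => f x + - fc f 0 * 1) 0 = 0.
  rewrite fcD//; last exact: BLZ.
  by rewrite fcZ// fc1 mulr1 subrr.
have [v [hv ev]] := (range _ hg).2 g0.
have := kmu v hv; rewrite -ev (dualD hmu hf hm1) (dualZ _ hmu h1) mulNr => /eqP.
by rewrite subr_eq0 => /eqP ->; rewrite mulrC.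
Qed.

End Sufficient.
End Solvability.

Theorem theorem2p3 (R : realType) (om : R -> R) (N : nat)
  (a b : 'I_N -> R -> R) :
  weight_function om -> om_subadditive om ->
  (forall j, inE1_realom om (a j)) -> (forall j, inE1_realom om (b j)) ->
  [<-> strongly_solvable om a b;
       globally_hypoelliptic om a b;
       [/\ forall j, ~ changes_sign (b j),
           span_dim_le1 b
         & EDC1 om (fun j => mean2pi (a j)) (fun j => mean2pi (b j))]].
Proof.
move=> wf sub ha hb; tfae.
- exact: solvable_hypoelliptic.
- move=> h; split.
  + exact: (hypoelliptic_no_sign_change wf sub ha hb h).
  + exact: (hypoelliptic_span wf sub ha hb h).
  + exact: (hypoelliptic_EDC wf sub ha hb h).
- by move=> [h1 h2 h3]; exact: sufficient_solvable.
Qed.
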